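(* Let $d>2$ be an integer and let $0 < a < \frac14$. For any $0 < \delta <\frac12\min\{1-4a,a\}$, define $\hat{\psi}_\delta : \mathbb{R}^d \to \mathbb{R}$ by $\hat{\psi}_\delta(x) = f_{([a,2a];\frac{\delta}{2},\delta)}(\Vert x \Vert)$, where $\Vert\cdot\Vert$ is the Euclidean norm, and let $\psi_\delta$ be its inverse Fourier transform. Then $\hat{\psi}_\delta\in\mathscr{S}(\mathbb{R}^d)$ and $\mathcal{W}(\psi_\delta)$ is a Parseval frame for $L^2(\mathbb{R}^d)$.
   Context: Fix a function $\theta \in C^\infty(\mathbb{R})$, real-valued, with $\theta(x)=0$ for $x\le -1$, $\theta(x)=1$ for $x \ge 1$, and $\theta(x)^2+\theta(-x)^2=1$ for all $x\in\mathbb{R}$ (such functions exist). For a closed interval $I=[c,b]$ and $\delta_1,\delta_2>0$ with $\delta_1+\delta_2\le b-c$, define $f_{(I;\delta_1,\delta_2)}:\mathbb{R}\to\mathbb{R}$ by $$f_{(I;\delta_1,\delta_2)}(x)=\begin{cases}\theta\left(\frac{x-c}{\delta_1}\right) & x<c+\delta_1,\\ 1 & c+\delta_1\le x\le b-\delta_2,\\ \theta\left(\frac{b-x}{\delta_2}\right) & x>b-\delta_2.\end{cases}$$ $\mathscr{S}(\mathbb{R}^d)$ is the Schwartz space. The Fourier transform is $\hat f(\gamma)=\int_{\mathbb{R}^d} f(x)e^{-2\pi i x\cdot\gamma}\,dx$, extended unitarily to $L^2$. For $\psi\in L^2(\mathbb{R}^d)$, the dyadic wavelet system is $\mathcal{W}(\psi)=\{2^{nd/2}\psi(2^n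 x-k): n\in\mathbb{Z},k\in\mathbb{Z}^d\}$. A family $\{e_j\}_{j\in J}$ in a separable Hilbert space $\mathcal{H}$ is a Parseval frame for $\mathcal{H}$ if $\sum_{j\in J}|\langle f,e_j\rangle|^2=\|f\|^2$ for all $f\in\mathcal{H}$. *)

(* Defs.v *)
From HB Require Import structures.
From mathcomp Require Import all_boot all_order all_algebra.
From mathcomp Require Import all_classical all_reals all_analysis.
From mathcomp Require Import complex.

Set Implicit Arguments.
Unset Strict Implicit.
Unset Printing Implicit Defensive.

Import Order.TTheory GRing.Theory Num.Theory.
Import numFieldNormedType.Exports.

Local Open Scope classical_set_scope.
Local Open Scope ring_scope.
Local Open Scope complex_scope.

(* R^n is 'rV[R]_n.  Its sigma-algebra is generated by the coordinate maps,
   as the library does for n.-tuple; over R this is the Borel sigma-algebra. *)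

Definition measure_row_display : measure_display -> measure_display.
Proof. exact. Qed.

Section measurable_row.
Context {d} {T : sigmaRingType d}.
Variable n : nat.

Let coors (i : 'I_n) (x : 'rV[T]_n) : T := x ord0 i.

Let row_set0 : g_sigma_preimage coors set0.
Proof. exact: sigma_algebra0. Qed.

Let row_setC A : g_sigma_preimage coors A -> g_sigma_preimage coors (~` A).
Proof. exact: sigma_algebraC. Qed.

Let row_bigcup (F : _^nat) : (forall i, g_sigma_preimage coors (F i)) ->
  g_sigma_preimage coors (\bigcup_i (F i)).
Proof. exact: sigma_algebra_bigcup. Qed.

HB.instance Definition _ := @isMeasurable.Build (measure_row_display d)
  'rV[T]_n (g_sigma_preimage coors) row_set0 row_setC row_bigcup.

End measurable_row.

Lemma measurable_row_coord d (T : measurableType d) n (i : 'I_n) :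
  measurable_fun [set: 'rV[T]_n] (fun x : 'rV[T]_n => x ord0 i).
Proof.
move=> _ Y mY; rewrite setTI; apply: sub_sigma_algebra => /=.
rewrite -bigcup_seq/=; exists i => /=; first by rewrite mem_index_enum.
by exists Y => //; rewrite setTI.
Qed.

Lemma measurable_fun_row d1 d2 (T1 : measurableType d1)
    (T2 : measurableType d2) n (f : T1 -> 'rV[T2]_n) :
  (forall i, measurable_fun [set: T1] (fun x => f x ord0 i)) ->
  measurable_fun [set: T1] f.
Proof.
move=> mf; apply: (measurability (\big[setU/set0]_(i < n)
  preimage_set_system setT (fun x : 'rV[T2]_n => x ord0 i) measurable)) => //.
move=> _ [A + <-]; rewrite -bigcup_seq => -[i _ [B mB <-]].
by rewrite !setTI -comp_preimage -[X in measurable X]setTI; exact: mf.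
Qed.

Definition row_cons {T : Type} {n : nat} (xv : T * 'rV[T]_n) : 'rV[T]_n.+1 :=
  row_mx (const_mx xv.1 : 'rV[T]_1) xv.2.

Definition row_uncons {T : Type} {n : nat} (v : 'rV[T]_n.+1) : T * 'rV[T]_n :=
  (v ord0 ord0, rsubmx (v : 'rV[T]_(1 + n))).

Lemma row_consK {T : Type} {n : nat} :
  cancel (@row_cons T n) (@row_uncons T n).
Proof.
case=> x v; rewrite /row_uncons row_mxKr; congr pair.
rewrite /row_cons mxE; case: splitP => [j _|j]; first by rewrite mxE.
by [].
Qed.

Lemma row_unconsK {T : Type} {n : nat} :
  cancel (@row_uncons T n) (@row_cons T n).
Proof.
move=> v; apply/rowP => i; rewrite /row_cons mxE.
case: splitP => [j ij|j ij] /=; rewrite mxE.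
  by congr (v _ _); apply/val_inj; rewrite /= ij ord1.
by congr (v _ _); apply/val_inj; rewrite /= ij.
Qed.

Lemma measurable_row_cons d (T : measurableType d) n :
  measurable_fun [set: T * 'rV[T]_n] (@row_cons T n).
Proof.
apply: measurable_fun_row => i; rewrite /row_cons.
case: (splitP (i : 'I_(1 + n))) => [j ij|j ij].
- rewrite (_ : (fun _ => _) = fst); first exact: measurable_fst.
  apply/funext => x /=; rewrite (_ : i = lshift n j); last exact/val_inj.
  by rewrite [LHS](row_mxEl (const_mx x.1 : 'rV[T]_1)) mxE.
- rewrite (_ : (fun _ => _) = (fun v : 'rV[T]_n => v ord0 j) \o snd).
    by apply: measurableT_comp => //; exact: measurable_row_coord.
  apply/funext => x /=; rewrite (_ : i = rshift 1 j); last exact/val_inj.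
  by rewrite [LHS](row_mxEr (const_mx x.1 : 'rV[T]_1)).
Qed.

Lemma measurable_row_uncons d (T : measurableType d) n :
  measurable_fun [set: 'rV[T]_n.+1] (@row_uncons T n).
Proof.
apply/measurable_fun_pairP; split; first exact: measurable_row_coord.
apply: measurable_fun_row => i /=.
rewrite (_ : (fun _ => _) = fun v : 'rV[T]_n.+1 => v ord0 (rshift 1 i)).
  exact: measurable_row_coord.
by apply/funext => v; rewrite /= mxE.
Qed.

Section lebesgue_row_step.
Local Open Scope ereal_scope.
Context {R : realType} {n : nat}.
Variable m : {sigma_finite_measure set 'rV[R]_n -> \bar R}.

Let mcons : measurable_fun [set: measurableTypeR R * 'rV[R]_n]
  (@row_cons R n : measurableTypeR R * 'rV[R]_n -> 'rV[R]_n.+1).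
Proof. exact: (@measurable_row_cons _ R n). Qed.

Let muncons : measurable_fun [set: 'rV[R]_n.+1]
  (@row_uncons R n : 'rV[R]_n.+1 -> measurableTypeR R * 'rV[R]_n).
Proof. exact: (@measurable_row_uncons _ R n). Qed.

Definition lebesgue_row_step : set 'rV[R]_n.+1 -> \bar R :=
  pushforward (lebesgue_measure \x m)
    (@row_cons R n : measurableTypeR R * 'rV[R]_n -> 'rV[R]_n.+1).

Let step0 : lebesgue_row_step set0 = 0.
Proof. exact: measure0. Qed.

Let step_ge0 A : 0 <= lebesgue_row_step A.
Proof. exact: measure_ge0. Qed.

Let step_sigma_additive : semi_sigma_additive lebesgue_row_step.
Proof. exact: measure_semi_sigma_additive. Qed.

HB.instance Definition _ := isMeasure.Build _ _ _ lebesgue_row_step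
  step0 step_ge0 step_sigma_additive.

Let step_sigma_finite : sigma_finite setT lebesgue_row_step.
Proof.
have /sigma_finiteP[F [TF ndF Foo]] :=
  sigma_finiteT (@lebesgue_measure R).
have /sigma_finiteP[G [TG ndG Goo]] := sigma_finiteT m.
exists (fun k => @row_uncons R n @^-1` (F k `*` G k)).
  apply/esym/seteqP; split=> // v _.
  have [i _ Fi] : (\bigcup_k F k) (row_uncons v).1 by rewrite -TF.
  have [j _ Gj] : (\bigcup_k G k) (row_uncons v).2 by rewrite -TG.
  exists (maxn i j) => //; split.
  - by move: Fi; exact/subsetPset/ndF/leq_maxl.
  - by move: Gj; exact/subsetPset/ndG/leq_maxr.
move=> k; have [mF Fk] := Foo k; have [mG Gk] := Goo k; split.
  by rewrite -[X in measurable X]setTI; apply: muncons => //; exact: measurableX.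
rewrite /lebesgue_row_step /pushforward -comp_preimage.
rewrite (_ : _ @^-1` _ = F k `*` G k).
  by rewrite product_measure1E// lte_mul_pinfty// ge0_fin_numE.
by apply/funext => x; exact: (congr1 (F k `*` G k) (@row_consK R n x)).
Qed.

HB.instance Definition _ := Measure_isSigmaFinite.Build _ _ _
  lebesgue_row_step step_sigma_finite.

End lebesgue_row_step.

(* d-dimensional Lebesgue measure: the unit mass in dimension 0, then the
   product with the one-dimensional Lebesgue measure along the first
   coordinate. *)
Fixpoint lebesgue_row {R : realType} (n : nat) :
    {sigma_finite_measure set 'rV[R]_n -> \bar R} :=
  match n with
  | 0 => [the {sigma_finite_measure set 'rV[R]_0 -> \bar R} of dirac (0 : 'rV[R]_0)]
  | n'.+1 => lebesgue_row_step (lebesgue_row n')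
  end.

Lemma lebesgue_row_box {R : realType} (n : nat) (a b : 'rV[R]_n) :
  (forall i, a ord0 i <= b ord0 i) ->
  lebesgue_row n [set x | forall i, a ord0 i < x ord0 i <= b ord0 i] =
    (\prod_(i < n) (b ord0 i - a ord0 i))%:E.
Proof.
elim: n a b => [|n IHn] a b ab.
  by rewrite big_ord0 /= diracE mem_set// => -[].
pose a' : 'rV_n := rsubmx (a : 'rV[R]_(1 + n)).
pose b' : 'rV_n := rsubmx (b : 'rV[R]_(1 + n)).
pose A' := [set x : 'rV[R]_n | forall i, a' ord0 i < x ord0 i <= b' ord0 i].
have lift0E (i : 'I_n) : lift ord0 i = rshift 1 i by exact/val_inj.
have mA' : measurable A'.
  rewrite (_ : A' = \big[setI/setT]_(i < n)
      ((fun x : 'rV[R]_n => x ord0 i) @^-1` `]a' ord0 i, b' ord0 i])).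
    apply: bigsetI_measurable => i _; rewrite -[X in measurable X]setTI.
    exact: (@measurable_row_coord _ R n i measurableT _ (measurable_itv _)).
  rewrite -bigcap_seq; apply/seteqP; split=> x Ax i.
    by move=> _ /=; rewrite in_itv/=; exact: Ax.
  by have := Ax i (mem_index_enum i); rewrite /= in_itv.
rewrite /= /lebesgue_row_step /pushforward.
rewrite (_ : _ @^-1` _ = `]a ord0 ord0, b ord0 ord0] `*` A').
  have a'b' i : a' ord0 i <= b' ord0 i by rewrite !mxE.
  rewrite product_measure1E//.
  rewrite [X in (X * _)%E](@lebesgue_measure_itv R `]a ord0 ord0, b ord0 ord0]).
  rewrite IHn// big_ord_recl /= lte_fin EFinM; congr (_ * _)%E.
    have := ab ord0; rewrite le_eqVlt => /predU1P[->|->//].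
    by rewrite ltxx subrr.
  by congr EFin; apply: eq_bigr => i _; rewrite !mxE lift0E.
apply/seteqP; split=> -[x v] /=.
  move=> h; split=> [|i].
    have := h (@lshift 1 n ord0).
    rewrite /row_cons /= (row_mxEl (const_mx x : 'rV[R]_1) v) mxE in_itv /=.
    by rewrite (_ : @lshift 1 n ord0 = ord0 :> 'I_n.+1) //; exact/val_inj.
  have := h (@rshift 1 n i).
  by rewrite /row_cons /= (row_mxEr (const_mx x : 'rV[R]_1) v) !mxE.
rewrite in_itv /= => -[hx hv] i.
rewrite /row_cons mxE; case: (splitP (i : 'I_(1 + n))) => j ij.
  by rewrite mxE (_ : i = ord0) //; apply/val_inj; rewrite /= ij ord1.
have -> : i = rshift 1 j by exact/val_inj.
by have := hv j; rewrite !mxE.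
Qed.

Section euclidean_space.
Context {R : realType} {d : nat}.
Implicit Types x y : 'rV[R]_d.

Definition edot x y : R := \sum_(i < d) x ord0 i * y ord0 i.

(* The library norm of 'rV[R]_d is the sup norm, hence this one. *)
Definition enorm x : R := Num.sqrt (edot x x).

End euclidean_space.

Section schwartz_space.
Context {R : realType} {d : nat}.

Definition partial (i : 'I_d) (f : 'rV[R]_d -> R) : 'rV[R]_d -> R :=
  fun x => 'D_(delta_mx ord0 i) f x.

Definition partials (s : seq 'I_d) (f : 'rV[R]_d -> R) : 'rV[R]_d -> R :=
  foldr partial f s.

Definition smooth (f : 'rV[R]_d -> R) : Prop :=
  forall s : seq 'I_d, continuous (partials s f) /\
    forall (i : 'I_d) x, derivable (partials s f) x (delta_mx ord0 i).

Definition rapidly_decreasing (f : 'rV[R]_d -> R) : Prop :=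
  forall (alpha : 'I_d -> nat) (s : seq 'I_d), exists C : R,
    forall x : 'rV[R]_d,
      `| (\prod_(i < d) x ord0 i ^+ alpha i) * partials s f x | <= C.

Definition schwartz (f : 'rV[R]_d -> R[i]) : Prop :=
  [/\ smooth (fun x => complex.Re (f x)),
      smooth (fun x => complex.Im (f x)),
      rapidly_decreasing (fun x => complex.Re (f x)) &
      rapidly_decreasing (fun x => complex.Im (f x))].

End schwartz_space.

Section L2_space.
Context {R : realType} {d : nat}.

Definition cintegral (f : 'rV[R]_d -> R[i]) : R[i] :=
  (\int[lebesgue_row d]_x complex.Re (f x)) +i*
  (\int[lebesgue_row d]_x complex.Im (f x)).

(* Square-integrable functions; functions equal almost everywhere are not
   identified, which affects neither L2_dot nor the notion of frame. *)
Definition L2 : set ('rV[R]_d -> R[i]) :=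
  [set f | (fun x => complex.Re (f x)) \in Lfun (lebesgue_row d) 2%:E /\
           (fun x => complex.Im (f x)) \in Lfun (lebesgue_row d) 2%:E].

Definition L2_dot (f g : 'rV[R]_d -> R[i]) : R[i] :=
  cintegral (fun x => f x * (g x)^*).

Definition expi2pi (t : R) : R[i] :=
  cos (2 * pi * t) +i* sin (2 * pi * t).

(* Inverse of the transform with kernel exp(-2 i pi x . gamma). *)
Definition inverse_fourier (g : 'rV[R]_d -> R[i]) : 'rV[R]_d -> R[i] :=
  fun x => cintegral (fun gamma => g gamma * expi2pi (edot x gamma)).

Definition wavelet_system (psi : 'rV[R]_d -> R[i]) (j : int * 'rV[int]_d) :
    'rV[R]_d -> R[i] :=
  fun x => (2 `^ (j.1%:~R * d%:R / 2))%:C *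
    psi ((2 ^ j.1) *: x - map_mx intr j.2).

End L2_space.

(* H is the underlying set of a Hilbert space whose inner product is dot. *)
Definition parseval_frame {R : realType} {V : Type} (H : set V)
    (dot : V -> V -> R[i]) {J : choiceType} (e : J -> V) : Prop :=
  (forall j, H (e j)) /\
  forall f, H f ->
    (\esum_(j in [set: J]) ((ComplexField.Normc.normc (dot f (e j)) ^+ 2)%:E)
      = (complex.Re (dot f f))%:E)%E.

Definition cutoff_function {R : realType} (theta : R -> R) : Prop :=
  [/\ forall (n : nat) (x : R), derivable (derive1n n theta) x 1,
      forall x, x <= -1 -> theta x = 0,
      forall x, 1 <= x -> theta x = 1 &
      forall x, theta x ^+ 2 + theta (- x) ^+ 2 = 1].

(* f_(I; delta1, delta2) for I = [c, b]. *)
Definition bump_fun {R : realType} (theta : R -> R) (c b delta1 delta2 x : R) : R :=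
  if x < c + delta1 then theta ((x - c) / delta1)
  else if x <= b - delta2 then 1
  else theta ((b - x) / delta2).

Definition psi_hat {R : realType} (theta : R -> R) {d : nat} (a delta : R) :
    'rV[R]_d -> R :=
  fun x => bump_fun theta a (2 * a) (delta / 2) delta (enorm x).

Definition psi {R : realType} (theta : R -> R) {d : nat} (a delta : R) :
    'rV[R]_d -> R[i] :=
  inverse_fourier (fun x => (psi_hat theta a delta x)%:C).

(* Main.v *)
(* Parseval for Fourier series on the cube Q = ]-1/2, 1/2]^d.  The real
   trigonometric polynomials form an algebra.  The bounded functions that they
   approximate in L^2(Q) form an algebra stable under bounded pointwise limits,
   hence under the absolute value, so the sets whose indicator is approximable
   form a sigma-algebra; it contains the half-spaces {c < x_i}, hence every
   measurable set.  Orthonormality of the exponentials then gives Parseval.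

   Plancherel.  Parseval applied to y |-> h(y) e(s.y), integrated over s in Q:
   the integer translates of Q tile R^d.

   Frame identity.  Let f be bounded with bounded support.  By Fubini,
   <f, psi_{m,k}> is a Fourier coefficient, indexed by k, of
   2^{md/2} psi_hat(y) F(2^m y), where F is a Fourier transform of f: the
   function psi_hat vanishes off Q because 2a + delta < 1/2.  Summing over k by
   Parseval and then over m gives ||F||^2 = ||f||^2, since
   sum_m psi_hat(2^{-m} y)^2 = 1: with A(r) = theta((2a - r) / delta)^2, the
   m-th term telescopes as psi_hat(y)^2 = A(|y|) - A(2|y|).  Truncation extends
   the identity to L^2.

   Smoothness.  psi_hat vanishes outside an annulus, and away from 0 it lies in
   the algebra generated by the coordinates, 1/|x| and the functions
   theta^(k)(p|x| + q), which is stable under partial derivatives and bounded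
   on annuli. *)

Require Import Defs.
From HB Require Import structures.
From mathcomp Require Import all_boot all_order all_algebra.
From mathcomp Require Import all_classical all_reals all_analysis.
From mathcomp Require Import measurable_realfun complex ring lra zify.

Set Implicit Arguments.
Unset Strict Implicit.
Unset Printing Implicit Defensive.

Import Order.TTheory GRing.Theory Num.Theory.
Import numFieldNormedType.Exports.

Local Open Scope classical_set_scope.
Local Open Scope ring_scope.
Local Open Scope complex_scope.

(** The integral formula gives a transform only on integrable functions, and the transform is never
    extended to L^2. Plancherel and the frame identity are therefore proved for bounded functions of
    bounded support, where Fubini applies directly, and only the frame identity is carried over to
    L^2. Passing to the limit in finite partial sums gives the Bessel inequality; Bessel for the
    remainder of the truncation then gives the reverse inequality, through |z + w|^2 <= (1 + eps)
    |z|^2 + (1 + 1/eps) |w|^2.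

    Coefficients are written as bilinear integrals of e_j h, where h is the conjugate of f, so that
    the same inverse transform serves for psi and for h.

    The profile has two transition zones, [a - delta/2, a + delta/2] and [2a - delta, 2a + delta].
    Doubling the radius maps the first onto the second, which is why the widths are delta/2 and
    delta and why the squares telescope; delta < a/2 keeps the zones apart and the first one away
    from 0. *)

Local Notation cabs := ComplexField.Normc.normc.

(** * Complex-valued integrals *)

Section complex_modulus.
Context {R : realType}.
Implicit Types z w : R[i].

(** The squared modulus as a polynomial in the two parts, so that [ring] and integrability arguments
    apply without square roots. *)
Definition nsq z : R := complex.Re z ^+ 2 + complex.Im z ^+ 2.

Lemma nsq_ge0 z : 0 <= nsq z.
Proof. by rewrite addr_ge0// sqr_ge0. Qed.

Lemma sqr_cabs z : cabs z ^+ 2 = nsq z.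
Proof. by case: z => a b; rewrite /= sqr_sqrtr// addr_ge0// sqr_ge0. Qed.

Lemma cabs_ge0 z : 0 <= cabs z.
Proof. by case: z => a b; rewrite /= sqrtr_ge0. Qed.

Lemma nsqM z w : nsq (z * w) = nsq z * nsq w.
Proof. by case: z w => a b [c d]; rewrite /nsq/=; ring. Qed.

Lemma nsq_conj z : nsq z^* = nsq z.
Proof. by case: z => a b; rewrite /nsq/= sqrrN. Qed.

Lemma nsq_real (x : R) : nsq x%:C = x ^+ 2.
Proof. by rewrite /nsq/= [0 ^+ 2]expr0n addr0. Qed.

Lemma mulc_conj z : z * z^* = (nsq z)%:C.
Proof. by case: z => a b; rewrite /nsq; apply/eqP; rewrite eq_complex/=; apply/andP; split;
  apply/eqP; ring. Qed.

Lemma cReD z w : complex.Re (z + w) = complex.Re z + complex.Re w.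
Proof. by case: z w => a b [c d]. Qed.

Lemma cImD z w : complex.Im (z + w) = complex.Im z + complex.Im w.
Proof. by case: z w => a b [c d]. Qed.

Lemma cReM z w : complex.Re (z * w) =
  complex.Re z * complex.Re w - complex.Im z * complex.Im w.
Proof. by case: z w => a b [c d]. Qed.

Lemma cImM z w : complex.Im (z * w) =
  complex.Re z * complex.Im w + complex.Im z * complex.Re w.
Proof. by case: z w => a b [c d]. Qed.

Lemma complexP z w : complex.Re z = complex.Re w ->
  complex.Im z = complex.Im w -> z = w.
Proof. by case: z w => a b [c d] /= -> ->. Qed.

Lemma normRe_le_cabs z : `|complex.Re z| <= cabs z.
Proof.
case: z => a b /=; rewrite -sqrtr_sqr ler_wsqrtr// lerDl sqr_ge0//.
Qed.

Lemma normIm_le_cabs z : `|complex.Im z| <= cabs z.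
Proof.
case: z => a b /=; rewrite -sqrtr_sqr ler_wsqrtr// lerDr sqr_ge0//.
Qed.

Lemma cabsM z w : cabs (z * w) = cabs z * cabs w.
Proof. exact: ComplexField.Normc.normcM. Qed.

Lemma cabs_real (x : R) : cabs x%:C = `|x|.
Proof. by rewrite /= expr0n addr0 sqrtr_sqr. Qed.

Lemma cabs_conj z : cabs z^* = cabs z.
Proof. by case: z => a b /=; rewrite sqrrN. Qed.

Lemma cabs_le_ReIm z : cabs z <= `|complex.Re z| + `|complex.Im z|.
Proof.
rewrite -(ler_pXn2r (n := 2)) ?nnegrE ?cabs_ge0 ?addr_ge0// sqr_cabs.
rewrite /nsq sqrrD !real_normK ?num_real// -addrA lerD2l lerDr.
by rewrite mulrn_wge0// mulr_ge0.
Qed.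

Lemma expi2piD (s t : R) : expi2pi (s + t) = expi2pi s * expi2pi t.
Proof.
apply: complexP; rewrite /expi2pi/= mulrDr ?cosD ?sinD//; ring.
Qed.

Lemma expi2piN (t : R) : expi2pi (- t) = (expi2pi t)^*.
Proof. by rewrite /expi2pi mulrN cosN sinN. Qed.

Lemma expi2pi0 : expi2pi (0 : R) = 1.
Proof. by rewrite /expi2pi mulr0 cos0 sin0. Qed.

Lemma nsq_expi2pi (t : R) : nsq (expi2pi t) = 1.
Proof. by rewrite /nsq/= cos2Dsin2. Qed.

Lemma cabs_expi2pi (t : R) : cabs (expi2pi t) = 1.
Proof. by rewrite /= cos2Dsin2 sqrtr1. Qed.

End complex_modulus.

Section complex_measurable.
Context {d} {T : measurableType d} {R : realType}.
Implicit Types f g : T -> R[i].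

(** Componentwise, like [cint] and [cintegrable] below, so that each complex statement reduces to
    two real ones. *)
Definition cmeas f := measurable_fun setT (fun x => complex.Re (f x)) /\
  measurable_fun setT (fun x => complex.Im (f x)).

Lemma cmeas_cst c : cmeas (fun=> c).
Proof. by split; exact: measurable_cst. Qed.

Lemma cmeas_real (f : T -> R) : measurable_fun setT f ->
  cmeas (fun x => (f x)%:C).
Proof. by move=> mf; split => //=; exact: measurable_cst. Qed.

Lemma cmeasD f g : cmeas f -> cmeas g -> cmeas (fun x => f x + g x).
Proof.
move=> [f1 f2] [g1 g2]; split.
- rewrite (_ : (fun _ => _) = fun x => complex.Re (f x) + complex.Re (g x)).
    exact: measurable_funD.
  by apply/funext => x; rewrite cReD.
- rewrite (_ : (fun _ => _) = fun x => complex.Im (f x) + complex.Im (g x)).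
    exact: measurable_funD.
  by apply/funext => x; rewrite cImD.
Qed.

Lemma cmeasM f g : cmeas f -> cmeas g -> cmeas (fun x => f x * g x).
Proof.
move=> [f1 f2] [g1 g2]; split.
- rewrite (_ : (fun _ => _) = fun x => complex.Re (f x) * complex.Re (g x)
     - complex.Im (f x) * complex.Im (g x)).
    by apply: measurable_funB; exact: measurable_funM.
  by apply/funext => x; rewrite cReM.
- rewrite (_ : (fun _ => _) = fun x => complex.Re (f x) * complex.Im (g x)
     + complex.Im (f x) * complex.Re (g x)).
    by apply: measurable_funD; exact: measurable_funM.
  by apply/funext => x; rewrite cImM.
Qed.

Lemma cmeasZ c f : cmeas f -> cmeas (fun x => c * f x).
Proof. exact/cmeasM/cmeas_cst. Qed.

Lemma cmeasB f g : cmeas f -> cmeas g -> cmeas (fun x => f x - g x).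
Proof.
move=> mf mg; have -> : (fun x => f x - g x) = fun x => f x + (-1) * g x.
  by apply/funext => x; rewrite mulN1r.
by apply: cmeasD => //; exact: cmeasZ.
Qed.

Lemma cmeas_conj f : cmeas f -> cmeas (fun x => (f x)^*).
Proof.
move=> [f1 f2]; split.
  by rewrite (_ : (fun _ => _) = fun x => complex.Re (f x)) //; apply/funext => x; case: (f x).
rewrite (_ : (fun _ => _) = fun x => - complex.Im (f x)); last first.
  by apply/funext => x; case: (f x).
by apply: measurableT_comp.
Qed.

Lemma cmeas_sum I (s : seq I) (F : I -> T -> R[i]) :
  (forall i, cmeas (F i)) -> cmeas (fun x => \sum_(i <- s) F i x).
Proof.
move=> mF; elim: s => [|i s IH].
  have -> : (fun x => \sum_(i <- [::]) F i x) = fun=> 0.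
    by apply/funext => x; rewrite big_nil.
  exact: cmeas_cst.
have -> : (fun x => \sum_(j <- i :: s) F j x) =
    fun x => F i x + \sum_(j <- s) F j x.
  by apply/funext => x; rewrite big_cons.
exact: cmeasD.
Qed.

Lemma cmeas_expi2pi (f : T -> R) : measurable_fun setT f ->
  cmeas (fun x => expi2pi (f x)).
Proof.
move=> mf; split => /=.
  apply: (measurableT_comp (f := cos)) => //.
    by apply: continuous_measurable_fun; exact: continuous_cos.
  by apply: measurable_funM.
apply: (measurableT_comp (f := sin)) => //.
  by apply: continuous_measurable_fun; exact: continuous_sin.
by apply: measurable_funM.
Qed.

Lemma measurable_nsq f : cmeas f -> measurable_fun setT (fun x => nsq (f x)).
Proof.
move=> [f1 f2].
by apply: measurable_funD; apply: measurable_funX.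
Qed.

Lemma measurable_cabs f : cmeas f -> measurable_fun setT (fun x => cabs (f x)).
Proof.
move=> mf; have -> : (fun x => cabs (f x)) = fun x => Num.sqrt (nsq (f x)).
  by apply/funext => x; rewrite -sqr_cabs sqrtr_sqr ger0_norm// cabs_ge0.
apply: (measurableT_comp (f := @Num.sqrt R)).
  by apply: continuous_measurable_fun; exact: sqrt_continuous.
exact: measurable_nsq.
Qed.

End complex_measurable.

Lemma cmeas_comp {d1 d2} {T1 : measurableType d1} {T2 : measurableType d2}
    {R : realType} (f : T2 -> R[i]) (g : T1 -> T2) :
  cmeas f -> measurable_fun setT g -> cmeas (fun x => f (g x)).
Proof. by move=> [f1 f2] mg; split;
  [exact: (measurableT_comp f1 mg)|exact: (measurableT_comp f2 mg)]. Qed.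

Section complex_integral.
Context {d} {T : measurableType d} {R : realType}.
Variables (mu : {measure set T -> \bar R}) (D : set T) (mD : measurable D).
Implicit Types f g : T -> R[i].

(** For the measure [lebesgue_row d] and the domain [setT] this is [cintegral] by conversion. *)
Definition cint f : R[i] :=
  (\int[mu]_(x in D) complex.Re (f x)) +i* (\int[mu]_(x in D) complex.Im (f x)).

Definition cintegrable f :=
  mu.-integrable D (fun x => (complex.Re (f x))%:E) /\
  mu.-integrable D (fun x => (complex.Im (f x))%:E).

Lemma eq_cint f g : (forall x, D x -> f x = g x) -> cint f = cint g.
Proof.
move=> fg; rewrite /cint; congr (_ +i* _); apply: eq_Rintegral => x.
  by rewrite inE => /fg ->.
by rewrite inE => /fg ->.
Qed.

Lemma eq_cintegrable f g : (forall x, D x -> f x = g x) -> cintegrable f -> cintegrable g.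
Proof.
move=> fg [f1 f2]; split.
  by apply: (eq_integrable mD _ _ _ f1) => x; rewrite inE => /fg ->.
by apply: (eq_integrable mD _ _ _ f2) => x; rewrite inE => /fg ->.
Qed.

Lemma cintegrable_dom f (g : T -> R) : cmeas f ->
  mu.-integrable D (fun x => (g x)%:E) ->
  (forall x, D x -> cabs (f x) <= g x) -> cintegrable f.
Proof.
move=> [f1 f2] ig fg; split; apply: (le_integrable mD _ _ ig).
- by apply/measurable_EFinP; exact: measurable_funTS.
- move=> x Dx /=; rewrite lee_fin (le_trans (normRe_le_cabs _))//.
  by rewrite (le_trans (fg _ Dx))// ler_norm.
- by apply/measurable_EFinP; exact: measurable_funTS.
- move=> x Dx /=; rewrite lee_fin (le_trans (normIm_le_cabs _))//.
  by rewrite (le_trans (fg _ Dx))// ler_norm.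
Qed.

Lemma integrable_cabs f : cmeas f -> cintegrable f ->
  mu.-integrable D (fun x => (cabs (f x))%:E).
Proof.
move=> mf [f1 f2].
have i12 : mu.-integrable D (fun x => (`|complex.Re (f x)| + `|complex.Im (f x)|)%:E).
  rewrite (_ : (fun _ => _) = (fun x => (`|complex.Re (f x)|)%:E) \+ (fun x =>
    (`|complex.Im (f x)|)%:E)).
    by apply: integrableD => //; exact: integrable_norm.
  by apply/funext => x /=; rewrite EFinD.
apply: (le_integrable mD _ _ i12).
  by apply/measurable_EFinP/measurable_funTS/measurable_cabs.
move=> x Dx /=; rewrite lee_fin ger0_norm ?cabs_ge0// ger0_norm ?addr_ge0//.
exact: cabs_le_ReIm.
Qed.

Lemma cintD f g : cintegrable f -> cintegrable g ->
  cint (fun x => f x + g x) = cint f + cint g.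
Proof.
move=> [f1 f2] [g1 g2]; apply: complexP; rewrite ?cReD ?cImD /=.
  by rewrite -RintegralD//; apply: eq_Rintegral => x _; rewrite cReD.
by rewrite -RintegralD//; apply: eq_Rintegral => x _; rewrite cImD.
Qed.

Let integrableZR (k : R) (f : T -> R) : mu.-integrable D (EFin \o f) ->
  mu.-integrable D (fun x => (k * f x)%:E).
Proof. by move=> /(integrableZl mD k); apply: eq_integrable => // x _ /=; rewrite EFinM. Qed.

Let integrableBR (f g : T -> R) : mu.-integrable D (EFin \o f) -> mu.-integrable D (EFin \o g) ->
  mu.-integrable D (fun x => (f x - g x)%:E).
Proof. by move=> jf jg; have := integrableB mD jf jg; apply: eq_integrable => // x _ /=;
  rewrite EFinB. Qed.

Let integrableDR (f g : T -> R) : mu.-integrable D (EFin \o f) -> mu.-integrable D (EFin \o g) ->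
  mu.-integrable D (fun x => (f x + g x)%:E).
Proof. by move=> jf jg; have := integrableD mD jf jg; apply: eq_integrable => // x _ /=;
  rewrite EFinD. Qed.

Lemma cintegrableZ c f : cintegrable f -> cintegrable (fun x => c * f x).
Proof.
move=> [f1 f2]; split.
- apply: (eq_integrable mD (fun x => (complex.Re c * complex.Re
  (f x) - complex.Im c * complex.Im (f x))%:E)).
    by move=> x _ /=; rewrite cReM.
  by apply: integrableBR; exact: integrableZR.
- apply: (eq_integrable mD (fun x => (complex.Re c * complex.Im
  (f x) + complex.Im c * complex.Re (f x))%:E)).
    by move=> x _ /=; rewrite cImM.
  by apply: integrableDR; exact: integrableZR.
Qed.

Lemma cintZ c f : cintegrable f -> cint (fun x => c * f x) = c * cint f.
Proof.
move=> [f1 f2]; apply: complexP; rewrite ?cReM ?cImM /=.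
  rewrite -!RintegralZl// -RintegralB//; [|exact: integrableZR|exact: integrableZR].
  by apply: eq_Rintegral => x _; rewrite cReM.
rewrite -!RintegralZl// -RintegralD//; [|exact: integrableZR|exact: integrableZR].
by apply: eq_Rintegral => x _; rewrite cImM.
Qed.

Lemma cintB f g : cintegrable f -> cintegrable g ->
  cint (fun x => f x - g x) = cint f - cint g.
Proof.
move=> jf jg; rewrite -mulN1r -cintZ// -cintD//; last exact: cintegrableZ.
by apply: eq_cint => x _; rewrite mulN1r.
Qed.

Lemma cint_conj f : cintegrable f -> cint (fun x => (f x)^*) = (cint f)^*.
Proof.
move=> [f1 f2]; apply: complexP => /=.
  by apply: eq_Rintegral => x _; case: (f x).
rewrite -mulN1r -RintegralZl//.
by apply: eq_Rintegral => x _; case: (f x) => a b/=; rewrite mulN1r.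
Qed.

End complex_integral.

(** * Fubini for real-valued and complex-valued functions *)

Section complex_fubini.
Context {d1 d2} {T1 : measurableType d1} {T2 : measurableType d2} {R : realType}.
Variables (m1 : {sigma_finite_measure set T1 -> \bar R})
          (m2 : {sigma_finite_measure set T2 -> \bar R}).

(** The inner integral is a real number obtained through [fine]. Since the extended inner integral
    is finite almost everywhere, [fine] changes it only on a null set. *)
Lemma Rintegral12_prod_meas1 (f : T1 * T2 -> R) :
  (m1 \x m2)%E.-integrable setT (EFin \o f) ->
  \int[m1]_x \int[m2]_y f (x, y) = \int[(m1 \x m2)%E]_z f z.
Proof.
move=> jf; rewrite /Rintegral -(integral12_prod_meas1 jf); congr fine.
have jF := integrable_fubini_F jf.
have mF := measurable_int _ jF.
apply: ae_eq_integral => //.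
  by apply/measurable_EFinP/measurableT_comp.
apply: filterS (integrable_ae measurableT jF) => x + _ => /(_ I).
by move=> /fineK.
Qed.

Lemma Rintegral21_prod_meas1 (f : T1 * T2 -> R) :
  (m1 \x m2)%E.-integrable setT (EFin \o f) ->
  \int[m2]_y \int[m1]_x f (x, y) = \int[(m1 \x m2)%E]_z f z.
Proof.
move=> jf; rewrite /Rintegral -(integral12_prod_meas1 jf) Fubini//; congr fine.
(* The other order of integration: integrability of the inner integral follows from the finiteness
   of the iterated integral of |f|. *)
have jG : m2.-integrable setT (fubini_G m1 (EFin \o f)).
  apply/integrableP; split; first exact: (measurable_fubini_G jf).
  have /integrable21ltyP := jf => ltG.
  move: (ltG (measurable_int _ jf)); apply: le_lt_trans.
  apply: ge0_le_integral => //.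
  - by apply: measurableT_comp => //; exact: (measurable_fubini_G jf).
  - apply: (measurable_fun_fubini_tonelli_G (abse \o (EFin \o f))) => //=.
    by apply: measurableT_comp => //; exact: (measurable_int _ jf).
  - move=> y _; apply: le_abse_integral => //.
    by apply: measurableT_comp => //; exact: measurable_int jf.
have mG := measurable_int _ jG.
apply: ae_eq_integral => //.
  by apply/measurable_EFinP/measurableT_comp.
apply: filterS (integrable_ae measurableT jG) => x + _ => /(_ I).
by move=> /fineK.
Qed.

Lemma cint_fubini (f : T1 * T2 -> R[i]) :
  cintegrable (m1 \x m2)%E setT f ->
  cint m1 setT (fun x => cint m2 setT (fun y => f (x, y))) =
  cint m2 setT (fun y => cint m1 setT (fun x => f (x, y))).
Proof.
move=> [f1 f2]; apply: complexP => /=.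
  by rewrite (Rintegral12_prod_meas1 f1) (Rintegral21_prod_meas1 f1).
by rewrite (Rintegral12_prod_meas1 f2) (Rintegral21_prod_meas1 f2).
Qed.

Lemma integrable_prod (f : T1 -> R) (g : T2 -> R) :
  m1.-integrable setT (EFin \o f) -> m2.-integrable setT (EFin \o g) ->
  (m1 \x m2)%E.-integrable setT (fun z => (f z.1 * g z.2)%:E).
Proof.
move=> /integrableP[mf jf] /integrableP[mg jg].
have mfg : measurable_fun setT (fun z : T1 * T2 => (f z.1 * g z.2)%:E).
  apply/measurable_EFinP; apply: measurable_funM.
    by apply: (measurableT_comp (f := f)) => //; exact/measurable_EFinP.
  by apply: (measurableT_comp (f := g)) => //; exact/measurable_EFinP.
have nf : measurable_fun setT (fun x => `|f x|%:E).
  by apply/measurable_EFinP/measurableT_comp => //; exact/measurable_EFinP.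
have ng : measurable_fun setT (fun x => `|g x|%:E).
  by apply/measurable_EFinP/measurableT_comp => //; exact/measurable_EFinP.
apply/integrable12ltyP => //=.
have -> : (\int[m1]_x \int[m2]_y `|f x * g y|%:E =
    (\int[m1]_x `|f x|%:E) * \int[m2]_y `|g y|%:E)%E.
  rewrite -ge0_integralZr//; last exact: integral_ge0.
  apply: eq_integral => x _; rewrite -ge0_integralZl ?lee_fin//.
  by apply: eq_integral => y _; rewrite normrM EFinM.
by rewrite lte_mul_pinfty// ?integral_ge0// ge0_fin_numE ?integral_ge0.
Qed.

(** The factor [u] is meant for the unimodular Fourier kernel, which couples the two variables;
    [u = 1] gives plain products. *)
Lemma cintegrable_prod (f : T1 -> R[i]) (g : T2 -> R[i]) (u : T1 * T2 -> R[i]) :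
  cmeas f -> cintegrable m1 setT f -> cmeas g -> cintegrable m2 setT g ->
  cmeas u -> (forall z, cabs (u z) <= 1) ->
  cintegrable (m1 \x m2)%E setT (fun z => f z.1 * g z.2 * u z).
Proof.
move=> mf jf mg jg mu u1.
apply: (cintegrable_dom measurableT (g := fun z => cabs (f z.1) * cabs (g z.2))).
- apply: cmeasM => //; apply: cmeasM.
    by apply: (cmeas_comp (f := f)) => //; exact: measurable_fst.
  by apply: (cmeas_comp (f := g)) => //; exact: measurable_snd.
- by apply: (integrable_prod (f := fun x => cabs (f x)) (g := fun x => cabs (g x)));
    exact: integrable_cabs.
- by move=> z _; rewrite !cabsM ler_piMr// mulr_ge0// cabs_ge0.
Qed.

(** The integrals of the positive and negative parts are measurable in the parameter by Tonelli, and
    so is their extended difference. Integrability of the sections is thus never assumed, and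
    transforms are measurable for every measurable function. *)
Let measurable_Rintegral_param (f : T1 * T2 -> R) : measurable_fun setT f ->
  measurable_fun setT (fun x => \int[m2]_y f (x, y)).
Proof.
move=> mf; apply: measurableT_comp; first exact: fine_measurable.
have mF : measurable_fun setT (EFin \o f) by exact/measurable_EFinP.
have -> : (fun x => \int[m2]_y (f (x, y))%:E)%E =
  ((fun x => \int[m2]_y (EFin \o f)^\+ (x, y)) \-
   (fun x => \int[m2]_y (EFin \o f)^\- (x, y)))%E.
  apply/funext=> x; rewrite [LHS](_ : _ = \int[m2]_y (EFin \o f) (x, y))%E//.
  rewrite integralE; congr (_ - _)%E; apply: eq_integral => y _.
    by rewrite (funepos_comp (EFin \o f) (pair x)).
  by rewrite (funeneg_comp (EFin \o f) (pair x)).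
apply: emeasurable_funB.
  by apply: (measurable_fun_fubini_tonelli_F (EFin \o f)^\+%E) => //; apply: measurable_funepos.
by apply: (measurable_fun_fubini_tonelli_F (EFin \o f)^\-%E) => //; apply: measurable_funeneg.
Qed.

Lemma cmeas_cint (f : T1 * T2 -> R[i]) : cmeas f ->
  cmeas (fun x => cint m2 setT (fun y => f (x, y))).
Proof.
move=> [f1 f2]; split => /=.
  exact: (measurable_Rintegral_param (f := fun z => complex.Re (f z))).
exact: (measurable_Rintegral_param (f := fun z => complex.Im (f z))).
Qed.

End complex_fubini.

(** * Sums over countable index types *)

(** Rewriting the sum as a series over codes makes monotone convergence for series available. A
    number may decode to some [j] without being its code, hence the test [pickle j == n]. *)
Lemma esum_pickle {R : realType} (J : countType) (a : J -> \bar R) :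
  (forall j, 0 <= a j)%E ->
  (\esum_(j in [set: J]) a j = \sum_(n <oo)
     (if unpickle n is Some j then if pickle j == n then a j else 0 else 0))%E.
Proof.
move=> a0; rewrite nneseries_esumT; last first.
  by move=> n; case: unpickle => [j|]; rewrite ?lexx//; case: ifP; rewrite ?lexx.
rewrite (esumID (range (@pickle J))) ?[X in (_ + X)%E]esum1 ?adde0; last first.
- by move=> n _; case: unpickle => [j|]; rewrite ?lexx//; case: ifP; rewrite ?lexx.
- move=> n [_ /= nrange]; case: unpickle => [j|]; rewrite ?lexx//.
  by case: ifP => // /eqP jn; exfalso; apply: nrange; exists j.
rewrite setTI esum_image; last first.
  by move=> x y _ _; exact: (pcan_inj pickleK).
by apply: eq_esum => j _; rewrite pickleK eqxx.
Qed.

Lemma ge0_esumZl {R : realType} (J : countType) (c : R) (a : J -> \bar R) :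
  0 <= c -> (forall j, 0 <= a j)%E ->
  (\esum_(j in [set: J]) (c%:E * a j) = c%:E * \esum_(j in [set: J]) a j)%E.
Proof.
move=> c0 a0; rewrite !esum_pickle//; last by move=> j; rewrite mule_ge0.
rewrite -nneseriesZl//; last first.
  by move=> n _; case: unpickle => [j|]; rewrite ?lexx//; case: ifP; rewrite ?lexx.
by apply: eq_eseriesr => n _; case: unpickle => [j|]; rewrite ?mule0//; case: ifP; rewrite ?mule0.
Qed.

Lemma measurable_esum {d} {T : measurableType d} {R : realType} (J : countType)
    (f : J -> T -> \bar R) : (forall j, measurable_fun setT (f j)) ->
    (forall j x, (0 <= f j x)%E) ->
  measurable_fun setT (fun x => \esum_(j in [set: J]) f j x)%E.
Proof.
move=> mf f0.
have -> : (fun x => \esum_(j in [set: J]) f j x)%E = (fun x => \sum_(n <oo)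
     (if unpickle n is Some j then if pickle j == n then f j x else 0 else 0))%E.
  by apply/funext => x; rewrite esum_pickle.
apply: ge0_emeasurable_sum => n.
  by move=> x _ _; case: unpickle => [j|]; rewrite ?lexx//; case: ifP; rewrite ?lexx.
move=> _; case: unpickle => [j|]; last exact: measurable_cst.
by case: (pickle j == n) => //; exact: measurable_cst.
Qed.

Lemma integral_esum {d} {T : measurableType d} {R : realType}
    (mu : {measure set T -> \bar R}) (D : set T) (J : countType)
    (f : J -> T -> \bar R) : measurable D ->
    (forall j, measurable_fun D (f j)) -> (forall j x, (0 <= f j x)%E) ->
  (\int[mu]_(x in D) (\esum_(j in [set: J]) f j x) =
   \esum_(j in [set: J]) \int[mu]_(x in D) f j x)%E.
Proof.
move=> mD mf f0.
rewrite [RHS]esum_pickle; last by move=> j; exact: integral_ge0.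
transitivity (\int[mu]_(x in D) \sum_(n <oo) (if unpickle n is Some j then
    if pickle j == n then f j x else 0 else 0))%E.
  by apply: eq_integral => x _; rewrite esum_pickle.
rewrite integral_nneseries//.
- apply: eq_eseriesr => n _; case: unpickle => [j|]; last by rewrite integral0.
  by case: ifP => // _; rewrite integral0.
- move=> n; case: unpickle => [j|]; last exact: measurable_cst.
  by case: (pickle j == n) => //; exact: measurable_cst.
- by move=> n x _; case: unpickle => [j|]; rewrite ?lexx//; case: ifP; rewrite ?lexx.
Qed.

(** The image of Lebesgue measure under x |-> t x + s, multiplied by t, gives each interval ]a, b]
    its length, so it is Lebesgue measure by uniqueness. *)
Lemma ge0_integral_affine {R : realType} (t s : R) (f : R -> \bar R) :
  0 < t -> measurable_fun [set: measurableTypeR R] f -> (forall x, 0 <= f x)%E ->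
  (\int[lebesgue_measure]_x f x =
   t%:E * \int[lebesgue_measure]_x f (t * x + s)%R)%E.
Proof.
move=> t0 mf f0.
pose phi : measurableTypeR R -> measurableTypeR R := fun x => t * x + s.
have mphi : measurable_fun setT phi.
  by apply: measurable_funD => //; exact: measurable_funM.
(* The pushforward is a measure only in the presence of [mphi]; naming it [P] hides this
   dependency. *)
have [P PE] : exists P : {measure set (measurableTypeR R) -> \bar R},
    P = pushforward lebesgue_measure phi :> (set (measurableTypeR R) -> \bar R).
  unshelve eexists; first by apply: [the {measure set (measurableTypeR R) ->
    \bar R} of pushforward (@lebesgue_measure R) phi]; exact: mphi.
  by [].
pose M : {measure set (measurableTypeR R) -> \bar R} := mscale (NngNum (ltW t0)) P.
have E A : measurable A -> lebesgue_measure A = M A.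
  apply: lebesgue_measure_unique => _ [[a b]] _ <-.
  transitivity (t%:E * lebesgue_measure (phi @^-1` `]a, b]))%E; last first.
    by rewrite -[RHS]/(t%:E * P `]a, b]%classic)%E PE.
  have -> : (phi @^-1` `]a, b]) = `](a - s) / t, (b - s) / t]%classic.
    apply/seteqP; split => x /=; rewrite !in_itv/= /phi.
      by rewrite ltr_pdivrMr// ler_pdivlMr// ltrBlDr lerBrDr mulrC.
    by rewrite ltr_pdivrMr// ler_pdivlMr// ltrBlDr lerBrDr mulrC.
  rewrite !lebesgue_measure_itv/= !lte_fin ltr_pM2r ?invr_gt0// ltrD2r.
  case: ifP => ab; last by rewrite mule0.
  by rewrite -!EFinB -EFinM; congr EFin; field; rewrite gt_eqF.
rewrite (eq_measure_integral M); last by move=> A mA _; exact: E.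
rewrite /M ge0_integral_mscale//; congr (_ * _)%E.
by rewrite PE (ge0_integral_pushforward mphi).
Qed.

(** * Lebesgue measure on rows *)

Section lebesgue_row_integral.
Context {R : realType}.
Local Notation mu n := (@lebesgue_row R n).

Lemma measurable_row_consR n : measurable_fun [set: measurableTypeR R * 'rV[R]_n]
  (@row_cons R n : measurableTypeR R * 'rV[R]_n -> 'rV[R]_n.+1).
Proof. exact: (@measurable_row_cons _ R n). Qed.

Lemma measurable_comp_row_cons n d (T : measurableType d) (f : 'rV[R]_n.+1 -> T) :
  measurable_fun setT f -> measurable_fun [set: measurableTypeR R * 'rV[R]_n]
    (fun z => f (row_cons z)).
Proof. by move=> mf; exact: (measurableT_comp mf (@measurable_row_consR n)). Qed.

Lemma ge0_integral_row_cons n (f : 'rV[R]_n.+1 -> \bar R) :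
  measurable_fun setT f -> (forall x, 0 <= f x)%E ->
  (\int[mu n.+1]_v f v = \int[lebesgue_measure \x mu n]_z f (row_cons z))%E.
Proof.
move=> mf f0.
by rewrite [LHS](ge0_integral_pushforward (@measurable_row_consR n)).
Qed.

Lemma measurable_row_affine n (t : R) (s : 'rV[R]_n) :
  measurable_fun setT (fun x : 'rV[R]_n => t *: x + s).
Proof.
apply: measurable_fun_row => i.
rewrite (_ : (fun _ => _) = fun x : 'rV[R]_n => t * x ord0 i + s ord0 i); last first.
  by apply/funext => x; rewrite !mxE.
apply: measurable_funD => //; apply: measurable_funM => //.
exact: measurable_row_coord.
Qed.

(** Tonelli along the recursive definition of the measure: the first coordinate contributes a factor
    t, the others t^n by induction. *)
Lemma ge0_integral_row_affine n (t : R) (s : 'rV[R]_n) (f : 'rV[R]_n -> \bar R) :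
  0 < t -> measurable_fun setT f -> (forall x, 0 <= f x)%E ->
  (\int[mu n]_x f x = (t ^+ n)%:E * \int[mu n]_x f (t *: x + s)%R)%E.
Proof.
move=> t0; elim: n s f => [|n IH] s f mf f0.
  rewrite expr0 mul1e; apply: eq_integral => x _; congr f.
  by apply/rowP => -[].
have mfa : measurable_fun setT (fun x : 'rV[R]_n.+1 => f (t *: x + s)).
  exact: (measurableT_comp mf (measurable_row_affine t s)).
rewrite ge0_integral_row_cons// [in RHS]ge0_integral_row_cons//.
have mfc := measurable_comp_row_cons mf.
have mfac := measurable_comp_row_cons mfa.
rewrite fubini_tonelli1// [in RHS]fubini_tonelli1//.
pose F (x : R) := (\int[mu n]_v f (row_cons (x, v)))%E.
have mF : measurable_fun [set: measurableTypeR R] F.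
  exact: (measurable_fun_fubini_tonelli_F (fun z => f (row_cons z))).
have F0 x : (0 <= F x)%E by exact: integral_ge0.
rewrite [LHS](ge0_integral_affine (s ord0 ord0) t0 mF F0).
pose G (x : R) := (\int[mu n]_v f (t *: row_cons (x, v) + s)%R)%E.
rewrite -[X in (_ * X)%E]/(\int[lebesgue_measure]_x F (t * x + s ord0 ord0)%R)%E.
rewrite -[X in _ = (_ * X)%E]/(\int[lebesgue_measure]_x G x)%E.
have mG : measurable_fun [set: measurableTypeR R] G.
  exact: (measurable_fun_fubini_tonelli_F (fun z => f (t *: row_cons z + s)%R)).
have G0 x : (0 <= G x)%E by exact: integral_ge0.
rewrite exprS EFinM -muleA; congr (_ * _)%E.
rewrite -ge0_integralZl//; last by rewrite lee_fin exprn_ge0// ltW.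
apply: eq_integral => x _; rewrite /F /G.
rewrite (IH (rsubmx (s : 'rV[R]_(1 + n))) (fun v => f (row_cons
  (t * x + s ord0 ord0, v))))//; last first.
  exact: (measurable_fun_pair2 (t * x + s ord0 ord0) mfc).
congr (_ * _)%E; apply: eq_integral => v _; congr f.
apply/rowP => i; rewrite /row_cons !mxE.
case: (splitP (i : 'I_(1 + n))) => j ij; rewrite !mxE.
  by congr (_ + s _ _); apply: val_inj; rewrite /= ij ord1.
by congr (_ + s _ _); apply: val_inj; rewrite /= ij.
Qed.

End lebesgue_row_integral.

(** * The unit cube and its exponentials *)

Section unit_cube.
Context {R : realType}.
Local Notation mu n := (@lebesgue_row R n).

Lemma expi2pi_int (m : int) : expi2pi (m%:~R : R) = 1.
Proof.
have E1 : expi2pi (1 : R) = 1.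
  by rewrite /expi2pi mulr1 [2 * pi]mulrC mulr_natr cos2pi sin2pi.
have En (n : nat) : expi2pi (n%:R : R) = 1.
  elim: n => [|n IH]; first by rewrite expi2pi0.
  by rewrite -addn1 natrD expi2piD IH E1 mulr1.
case: m => n; first by rewrite -pmulrn En.
by rewrite NegzE mulrNz expi2piN -pmulrn En conjc1.
Qed.

(** Half-open sides make the integer translates an exact partition, with no null set to discard. *)
Definition cube n : set 'rV[R]_n := [set v | forall i, - (1 / 2) < v ord0 i <= 1 / 2].
Arguments cube n : clear implicits.

Lemma measurable_cube n : measurable (cube n).
Proof.
rewrite (_ : cube n = \big[setI/setT]_(i < n)
    ((fun x : 'rV[R]_n => x ord0 i) @^-1` `]- (1 / 2), 1 / 2])).
  apply: bigsetI_measurable => i _; rewrite -[X in measurable X]setTI.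
  exact: (@measurable_row_coord _ R n i measurableT _ (measurable_itv _)).
rewrite -bigcap_seq; apply/seteqP; split=> x Ax i.
  by move=> _ /=; rewrite in_itv/=; exact: Ax.
by have := Ax i (mem_index_enum i); rewrite /= in_itv.
Qed.

Lemma lebesgue_cube n : mu n (cube n) = 1%E.
Proof.
rewrite (_ : cube n = [set x | forall i, (const_mx (- (1 / 2)) : 'rV[R]_n) ord0 i <
    x ord0 i <= (const_mx (1 / 2) : 'rV[R]_n) ord0 i]); last first.
  by apply/seteqP; split => v /= h i; have := h i; rewrite !mxE.
rewrite lebesgue_row_box; last by move=> i; rewrite !mxE; lra.
by rewrite big1//= => i _; rewrite !mxE; lra.
Qed.

Lemma row_cons_cube n (z : R * 'rV[R]_n) :
  cube n.+1 (row_cons z) <-> `]- (1 / 2), 1 / 2]%classic z.1 /\ cube n z.2.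
Proof.
case: z => x v /=; split.
  move=> h; split=> [|i].
    have := h (@lshift 1 n ord0).
    by rewrite /row_cons /= (row_mxEl (const_mx x : 'rV[R]_1) v) mxE in_itv.
  have := h (@rshift 1 n i).
  by rewrite /row_cons /= (row_mxEr (const_mx x : 'rV[R]_1) v).
rewrite in_itv /= => -[hx hv] i.
rewrite /row_cons mxE; case: (splitP (i : 'I_(1 + n))) => j ij.
  by rewrite mxE.
exact: hv.
Qed.

(** The primitives of the two parts are multiples of sine and cosine of w x, which take equal values
    at the two ends by periodicity. *)
Lemma cint_expi2pi_itv (m : int) : m != 0 ->
  cint lebesgue_measure `]- (1 / 2), 1 / 2]%classic (fun x : R => expi2pi (m%:~R * x)) = 0.
Proof.
move=> m0.
have w0 : 2 * pi * m%:~R != 0 :> R.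
  by rewrite !mulf_neq0 ?intr_eq0// gt_eqF// pi_gt0.
set w := 2 * pi * m%:~R in w0.
(* The two arguments differ by the integer m, at which the exponential is 1. *)
have per : expi2pi (m%:~R * (1 / 2) : R) = expi2pi (m%:~R * (- (1 / 2))).
  rewrite -[RHS]mul1r -(expi2pi_int m) -expi2piD; congr expi2pi; lra.
have wE (x : R) : 2 * pi * (m%:~R * x) = w * x by rewrite mulrA.
move: per; rewrite /expi2pi => -[]; rewrite !wE => pc ps.
have ab : - (1 / 2) < 1 / 2 :> R by lra.
have FTC (f F : R -> R) : continuous f -> (forall x, is_derive x (1 : R) F (f x)) ->
    F (1 / 2) = F (- (1 / 2)) ->
    \int[lebesgue_measure]_(x in `]- (1 / 2), 1 / 2]) f x = 0.
  move=> cf dF FE; rewrite /Rintegral integral_itv_obnd_cbnd; last first.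
    apply/measurable_EFinP; apply: measurable_funTS.
    by apply: continuous_measurable_fun; exact: cf.
  have cF : continuous F.
    by move=> x; apply/differentiable_continuous/derivable1_diffP/ex_derive.
  rewrite (continuous_FTC2 (F := F))//.
  - by rewrite FE -EFinB subrr.
  - exact: continuous_subspaceT.
  - split.
    + by move=> x _; apply: ex_derive.
    + by apply: cvg_at_right_filter; exact: cF.
    + by apply: cvg_at_left_filter; exact: cF.
  - by move=> x _; rewrite derive1E; apply: derive_val.
have cw : continuous (fun x : R => w * x) by move=> x; apply: cvgMr; exact: cvg_id.
have -> : (fun x : R => expi2pi (m%:~R * x)) =
    fun x => cos (w * x) +i* sin (w * x).
  by apply/funext => x; rewrite /expi2pi wE.
rewrite /cint.
apply: complexP => /=.
  apply: (FTC _ (fun x => w^-1 * sin (w * x))).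
  - by move=> x; apply: (continuous_comp (@cw x)); exact: continuous_cos.
  - by move=> x; apply: is_derive_eq; rewrite /GRing.scale/=; field.
  - by rewrite ps.
apply: (FTC _ (fun x => - (w^-1 * cos (w * x)))).
- by move=> x; apply: (continuous_comp (@cw x)); exact: continuous_sin.
- by move=> x; apply: is_derive_eq; rewrite /GRing.scale/=; field.
- by rewrite pc.
Qed.

End unit_cube.
Arguments cube {R} n _.

(** Moving the domain into the integrand lets an integral over the cube be split along a product
    measure. *)
Lemma cint_mkcond {d} {T : measurableType d} {R : realType}
    (mu : {measure set T -> \bar R}) (D : set T) (f : T -> R[i]) :
  cint mu D f = cint mu setT (fun x => (\1_D x)%:C * f x).
Proof.
rewrite /cint; congr (_ +i* _); rewrite Rintegral_mkcond; apply: eq_Rintegral => x _.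
  by rewrite patchE indicE cReM/=; case: (x \in D); rewrite /= ?mul1r ?mul0r subr0.
by rewrite patchE indicE cImM/=; case: (x \in D); rewrite /= ?mul1r ?mul0r addr0.
Qed.

Lemma cint_prod {d1 d2} {T1 : measurableType d1} {T2 : measurableType d2} {R : realType}
    (m1 : {sigma_finite_measure set T1 -> \bar R})
    (m2 : {sigma_finite_measure set T2 -> \bar R}) (f : T1 -> R[i]) (g : T2 -> R[i]) :
  cmeas f -> cintegrable m1 setT f -> cmeas g -> cintegrable m2 setT g ->
  cint (m1 \x m2)%E setT (fun z => f z.1 * g z.2) = cint m1 setT f * cint m2 setT g.
Proof.
move=> mf jf mg jg.
have [h1 h2] : cintegrable (m1 \x m2)%E setT (fun z => f z.1 * g z.2).
  have := cintegrable_prod mf jf mg jg (u := fun=> 1) (cmeas_cst 1).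
  rewrite ComplexField.Normc.normc1 => /(_ (fun=> lexx _)).
  by apply: eq_cintegrable => // x _; rewrite mulr1.
transitivity (cint m1 setT (fun x => cint m2 setT (fun y => f x * g y))).
  by apply: complexP => /=; rewrite -Rintegral12_prod_meas1.
rewrite mulrC -cintZ//; apply: eq_cint => x _.
by rewrite cintZ// mulrC.
Qed.

Lemma cintegrable_mkcond {d} {T : measurableType d} {R : realType}
    (mu : {measure set T -> \bar R}) (D : set T) (f : T -> R[i]) : measurable D ->
  cintegrable mu D f <-> cintegrable mu setT (fun x => (\1_D x)%:C * f x).
Proof.
move=> mD.
have E1 : (fun x => (complex.Re ((\1_D x)%:C * f x))%:E) =
    (fun x => (complex.Re (f x))%:E) \_ D.
  apply/funext => x; rewrite patchE indicE cReM/=.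
  by case: (x \in D); rewrite /= ?mul1r ?mul0r subr0.
have E2 : (fun x => (complex.Im ((\1_D x)%:C * f x))%:E) =
    (fun x => (complex.Im (f x))%:E) \_ D.
  apply/funext => x; rewrite patchE indicE cImM/=.
  by case: (x \in D); rewrite /= ?mul1r ?mul0r addr0.
rewrite /cintegrable E1 E2; split=> -[h1 h2]; split;
  by [apply/(integrable_mkcond _ mD)|apply/(integrable_mkcond (fun x => (complex.Re (f x))%:E) mD)
     |apply/(integrable_mkcond (fun x => (complex.Im (f x))%:E) mD)].
Qed.

Lemma cintegrable_bounded {d} {T : measurableType d} {R : realType}
    (mu : {measure set T -> \bar R}) (D : set T) (f : T -> R[i]) (M : R) : measurable D ->
  (mu D < +oo)%E -> cmeas f -> (forall x, D x -> cabs (f x) <= M) ->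
  cintegrable mu D f.
Proof.
move=> mD Doo mf fM; apply: (cintegrable_dom mD (g := fun=> M)) => //.
apply: (measurable_bounded_integrable mD Doo).
  exact: measurable_cst.
exists `|M|; split; first exact: num_real.
by move=> y My x _ /=; exact/ltW.
Qed.

Section lebesgue_row_integral2.
Context {R : realType}.
Local Notation mu n := (@lebesgue_row R n).

Lemma cint_row_cons n (f : 'rV[R]_n.+1 -> R[i]) : cmeas f ->
  cintegrable (lebesgue_measure \x mu n)%E setT (fun z => f (row_cons z)) ->
  cint (mu n.+1) setT f = cint (lebesgue_measure \x mu n)%E setT (fun z => f (row_cons z)).
Proof.
move=> [m1 m2] [j1 j2]; have mr := @measurable_row_consR R n.
have E (g : 'rV[R]_n.+1 -> R) : measurable_fun setT g ->
    (lebesgue_measure \x mu n)%E.-integrable setT (fun z => (g (row_cons z))%:E) ->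
    \int[mu n.+1]_x g x = \int[(lebesgue_measure \x mu n)%E]_z g (row_cons z).
  move=> mg jg; congr fine.
  have mg' : measurable_fun setT (EFin \o g) by exact/measurable_EFinP.
  exact: (integral_pushforward mr mg' jg measurableT).
by apply: complexP => /=; exact: E.
Qed.

Lemma integral_row_affine n (t : R) (s : 'rV[R]_n) (f : 'rV[R]_n -> R) :
  0 < t -> (mu n).-integrable setT (EFin \o f) ->
  (mu n).-integrable setT (fun x => (f (t *: x + s))%:E) /\
  \int[mu n]_x f x = t ^+ n * \int[mu n]_x f (t *: x + s).
Proof.
move=> t0 jf; have mf := measurable_int _ jf.
have tn0 : 0 < t ^+ n by rewrite exprn_gt0.
have ma := measurable_row_affine t s.
have jg : (mu n).-integrable setT (fun x => (f (t *: x + s))%:E).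
  apply/integrableP; split; first exact: (measurableT_comp mf ma).
  have /integrableP[_] := jf.
  rewrite (ge0_integral_row_affine s t0) => [|//|//]; last by apply: measurableT_comp mf.
  rewrite -[(\int[_]_x _)%E]/(\int[mu n]_x `|(f (t *: x + s)%R)%:E|)%E.
  (* If the rescaled integral were infinite, so would be its product with the positive factor
     t^n. *)
  case: (\int[mu n]_x `|(f (t *: x + s)%R)%:E|)%E => [r| |]//=.
    by rewrite -EFinM !ltry.
  by rewrite gt0_muley// lte_fin.
split => //; rewrite /Rintegral.
have -> : (t ^+ n) = fine ((t ^+ n)%:E : \bar R) by [].
rewrite -fineM//; last by apply: integrable_fin_num jg.
congr fine.
have E (h : 'rV[R]_n -> \bar R) : measurable_fun setT h ->
    (mu n).-integrable setT (fun x => h (t *: x + s)) ->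
    (\int[mu n]_x h x = (t ^+ n)%:E * \int[mu n]_x h (t *: x + s)%R)%E.
  move=> mh jh.
  rewrite integralE [in RHS]integralE.
  have -> : (fun x => h (t *: x + s)%R)^\+%E = (fun x => h^\+ (t *: x + s)%R)%E.
    exact: (funepos_comp h (fun x => t *: x + s)).
  have -> : (fun x => h (t *: x + s)%R)^\-%E = (fun x => h^\- (t *: x + s)%R)%E.
    exact: (funeneg_comp h (fun x => t *: x + s)).
  rewrite muleBr//; last first.
    apply: fin_num_adde_defr.
    have := integrable_pos_fin_num measurableT jh.
    by rewrite (funepos_comp h (fun x => t *: x + s)).
  rewrite -!(ge0_integral_row_affine s t0)//.
  - exact: measurable_funeneg.
  - exact: measurable_funepos.
exact: E.
Qed.

Lemma cint_row_affine n (t : R) (s : 'rV[R]_n) (f : 'rV[R]_n -> R[i]) :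
  0 < t -> cintegrable (mu n) setT f ->
  cintegrable (mu n) setT (fun x => f (t *: x + s)) /\
  cint (mu n) setT f = (t ^+ n)%:C * cint (mu n) setT (fun x => f (t *: x + s)).
Proof.
move=> t0 [f1 f2].
have [g1 E1] := integral_row_affine s t0 f1.
have [g2 E2] := integral_row_affine s t0 f2.
split; first by split.
apply: complexP; rewrite ?cReM ?cImM /= mul0r ?subr0 ?addr0.
  exact: E1.
exact: E2.
Qed.

(** Integrate f(x) = sum_k 1_Q(x + k) f(x), where exactly one term is multiplied by 1, and translate
    each term back to the cube. *)
Lemma ge0_integral_tiling n (f : 'rV[R]_n -> \bar R) :
  measurable_fun setT f -> (forall x, 0 <= f x)%E ->
  (\int[mu n]_x f x = \esum_(k in [set: 'rV[int]_n])
    \int[mu n]_(x in cube n) f (x - map_mx intr k)%R)%E.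
Proof.
move=> mf f0.
have mt (k : 'rV[int]_n) : measurable_fun setT (fun x : 'rV[R]_n => x + map_mx intr k).
  have -> : (fun x : 'rV[R]_n => x + map_mx intr k) = fun x => 1 *: x + map_mx intr k.
    by apply/funext => x; rewrite scale1r.
  exact: measurable_row_affine.
pose g (k : 'rV[int]_n) x := ((\1_(cube n) (x + map_mx intr k) : R)%:E * f x)%E.
have mg k : measurable_fun setT (g k).
  apply: emeasurable_funM => //; apply/measurable_EFinP.
  have mi : measurable_fun setT (\1_(cube n) : 'rV[R]_n -> R).
    by apply: measurable_indic; exact: measurable_cube.
  exact: (measurableT_comp mi (mt k)).
have g0 k x : (0 <= g k x)%E by rewrite mule_ge0// lee_fin indicE ler0n.
transitivity (\int[mu n]_x (\esum_(k in [set: 'rV[int]_n]) g k x))%E; last first.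
  rewrite integral_esum//; apply: eq_esum => k _.
  rewrite (ge0_integral_row_affine (- map_mx intr k) (ltr01 : 0 < 1 :> R))//.
  rewrite expr1n mul1e [RHS]integral_mkcond; apply: eq_integral => x _.
  rewrite /g scale1r subrK indicE patchE.
  by case: (x \in cube n); rewrite ?mul1e ?mul0e.
apply: eq_integral => x _.
(* The condition -1/2 < x_i + k_i <= 1/2 says that -k_i is the least integer above or equal to x_i -
   1/2. *)
pose k0 : 'rV[int]_n := \row_i (- Num.ceil (x ord0 i - 1 / 2)).
have k0P k : cube n (x + map_mx intr k) <-> k = k0.
  split=> [h|->].
    apply/rowP => i; have := h i; rewrite !mxE => /andP[h1 h2].
    apply/eqP; rewrite -eqr_oppLR eq_le; apply/andP; split.
      rewrite -[leLHS](subrK 1) lezD1 ceil_gt_int intrB mulrNz; lra.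
    by rewrite ceil_le_int mulrNz; lra.
  move=> i; rewrite !mxE mulrNz.
  have := ceil_ge (x ord0 i - 1 / 2); have := ceilB1_lt (x ord0 i - 1 / 2).
  rewrite intrB; move: (_%:~R) => c; lra.
rewrite (esumID [set k0])//= setTI esum_set1// esum1 ?adde0; last first.
  move=> k [_ /= kk0]; rewrite /g indicE memNset ?mul0e//.
  by move/k0P.
by rewrite /g indicE mem_set ?mul1e//; exact/k0P.
Qed.

Lemma edot_row_cons n (k : 'rV[R]_n.+1) (z : R * 'rV[R]_n) :
  edot k (row_cons z) = k ord0 ord0 * z.1 + edot (row_uncons k).2 z.2.
Proof.
case: z => x v; rewrite /edot big_ord_recl; congr (_ * _ + _).
  have := @row_consK R n (x, v).
  by rewrite /row_uncons => /(congr1 fst).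
apply: eq_bigr => i _; rewrite !mxE; congr (k _ _ * _).
  exact/val_inj.
case: (splitP (lift ord0 i : 'I_(1 + n))) => j /= ij.
  by have := ltn_ord j; rewrite -ij.
by congr (v _ _); apply: val_inj; move: ij => /= [].
Qed.

Lemma measurable_edot n (k : 'rV[R]_n) : measurable_fun setT (fun x => edot k x).
Proof.
rewrite /edot; apply: measurable_sum => i.
by apply: measurable_funM => //; exact: measurable_row_coord.
Qed.

Lemma cmeas_expi2pi_edot n (k : 'rV[R]_n) : cmeas (fun x => expi2pi (edot k x)).
Proof. by apply: cmeas_expi2pi; exact: measurable_edot. Qed.

(** Both the indicator of the cube and the exponential factor along the first coordinate. If the
    tail of k is nonzero, its factor vanishes by induction; otherwise the first entry is nonzero and
    the one-dimensional factor vanishes. *)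
Lemma cint_cube_expi2pi n (k : 'rV[int]_n) : k != 0 ->
  cint (mu n) (cube n) (fun x => expi2pi (edot (map_mx intr k) x)) = 0.
Proof.
elim: n k => [|n IH] k; first by move=> /eqP[]; apply/rowP => -[].
move=> k0; pose kn : 'rV[int]_n := (row_uncons k).2.
have mE := cmeas_expi2pi_edot (map_mx intr k : 'rV[R]_n.+1).
have m1 : cmeas (fun x : measurableTypeR R => expi2pi ((k ord0 ord0)%:~R * x)).
  by apply: cmeas_expi2pi; exact: measurable_funM.
have m2 := cmeas_expi2pi_edot (map_mx intr kn : 'rV[R]_n).
have mind d (T : measurableType d) (D : set T) : measurable D -> cmeas (fun x => (\1_D x : R)%:C).
  by move=> mD; apply: cmeas_real; exact: measurable_indic.
pose q := `]- (1 / 2), 1 / 2]%classic : set (measurableTypeR R).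
have mq : measurable q by exact: measurable_itv.
have j1 : cintegrable lebesgue_measure q (fun x :
  measurableTypeR R => expi2pi ((k ord0 ord0)%:~R * x)).
  apply: (cintegrable_bounded (M := 1)) => //.
    by rewrite [ltLHS]lebesgue_measure_itv/=; case: ifP; rewrite -?EFinB ltry.
  by move=> x _; rewrite cabs_expi2pi.
have j2 : cintegrable (mu n) (cube n) (fun x => expi2pi (edot (map_mx intr kn) x)).
  apply: (cintegrable_bounded (M := 1)) => //; first exact: measurable_cube.
    by rewrite [ltLHS]lebesgue_cube ltry.
  by move=> x _; rewrite cabs_expi2pi.
have E (z : measurableTypeR R * 'rV[R]_n) :
    (\1_(cube n.+1) (row_cons z) : R)%:C * expi2pi (edot (map_mx intr k) (row_cons z)) =
    ((\1_q z.1)%:C * expi2pi ((k ord0 ord0)%:~R * z.1)) *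
    ((\1_(cube n) z.2)%:C * expi2pi (edot (map_mx intr kn) z.2)).
  rewrite edot_row_cons expi2piD mulrACA; congr (_ * (expi2pi _ * expi2pi _)).
  - rewrite -rmorphM !indicE -natrM mulnb; congr (_%:R%:C); apply: congr1.
    apply/idP/andP => [/set_mem/row_cons_cube[]|[]].
      by move=> h1 h2; split; exact: mem_set.
    by move=> /set_mem h1 /set_mem h2; apply/mem_set/row_cons_cube.
  - by rewrite mxE.
  - by congr edot; apply/rowP => i; rewrite !mxE.
pose f (x : measurableTypeR R) : R[i] := (\1_q x)%:C * expi2pi ((k ord0 ord0)%:~R * x).
pose g (x : 'rV[R]_n) : R[i] := (\1_(cube n) x)%:C * expi2pi (edot (map_mx intr kn) x).
have mf : cmeas f by apply: cmeasM => //; exact: mind.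
have jf : cintegrable lebesgue_measure setT f by exact: (iffLR (cintegrable_mkcond _ _ mq) j1).
have mg : cmeas g by apply: cmeasM => //; apply: mind; exact: measurable_cube.
have jg : cintegrable (mu n) setT g.
  exact: (iffLR (cintegrable_mkcond _ _ (@measurable_cube R n)) j2).
rewrite cint_mkcond cint_row_cons; last 2 first.
- by apply: cmeasM => //; apply: mind; exact: measurable_cube.
- rewrite (funext E).
  have := cintegrable_prod mf jf mg jg (u := fun=> 1) (cmeas_cst 1).
  rewrite ComplexField.Normc.normc1 => /(_ (fun=> lexx _)).
  by apply: eq_cintegrable => // z _; rewrite mulr1.
rewrite (funext E) (cint_prod mf jf mg jg).
rewrite -!cint_mkcond; have [kn0|kn0] := eqVneq kn 0; last by rewrite IH// mulr0.
rewrite cint_expi2pi_itv ?mul0r//; apply: contra_neq k0 => k00.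
have -> : k = row_cons (0, 0).
  by rewrite -[LHS]row_unconsK [row_uncons k]surjective_pairing -/kn kn0 [(_).1]k00.
apply/rowP => i; rewrite /row_cons !mxE.
by case: splitP => j _; rewrite mxE.
Qed.

End lebesgue_row_integral2.

(** * Approximation by an algebra of bounded functions *)

Section algebra_closure.
Context {d} {T : measurableType d} {R : realType}.
Variables (mu : {measure set T -> \bar R}) (D : set T).
Hypotheses (mD : measurable D) (Doo : (mu D < +oo)%E).
Implicit Types f g p : T -> R.

Definition bounded_measurable f :=
  measurable_fun setT f /\ exists M, forall x, `|f x| <= M.

Lemma bounded_measurable_cst c : bounded_measurable (fun=> c).
Proof. by split; [exact: measurable_cst|exists `|c|]. Qed.

Lemma bounded_measurableD f g : bounded_measurable f -> bounded_measurable g ->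
  bounded_measurable (fun x => f x + g x).
Proof.
move=> [mf [M fM]] [mg [N gN]]; split; first exact: measurable_funD.
by exists (M + N) => x; rewrite (le_trans (ler_normD _ _))// lerD.
Qed.

Lemma bounded_measurableM f g : bounded_measurable f -> bounded_measurable g ->
  bounded_measurable (fun x => f x * g x).
Proof.
move=> [mf [M fM]] [mg [N gN]]; split; first exact: measurable_funM.
by exists (M * N) => x; rewrite normrM ler_pM.
Qed.

Lemma bounded_measurableB f g : bounded_measurable f -> bounded_measurable g ->
  bounded_measurable (fun x => f x - g x).
Proof.
move=> [mf [M fM]] [mg [N gN]]; split; first exact: measurable_funB.
by exists (M + N) => x; rewrite (le_trans (ler_normB _ _))// lerD.
Qed.

Lemma bounded_measurable_integrable f : bounded_measurable f ->
  mu.-integrable D (fun x => (f x)%:E).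
Proof.
move=> [mf [M fM]]; apply: (measurable_bounded_integrable mD Doo).
  exact: measurable_funTS.
exists M; split; first exact: num_real.
by move=> y My x _ /=; exact: le_trans (fM x) (ltW My).
Qed.

Definition sqdist f g : R := \int[mu]_(x in D) (f x - g x) ^+ 2.

Let bounded_measurable_sqrB f g : bounded_measurable f -> bounded_measurable g ->
  bounded_measurable (fun x => (f x - g x) ^+ 2).
Proof. by move=> bf bg; under eq_fun do rewrite expr2; apply: bounded_measurableM;
  exact: bounded_measurableB. Qed.

(** Triangle inequality for squared distances: 2u^2 + 2v^2 - (u + v)^2 = (u - v)^2. The factors 2
    are why tolerances are divided by 4 below. *)
Lemma sqdist_le_trans f g h : bounded_measurable f -> bounded_measurable g ->
  bounded_measurable h -> sqdist f h <= 2 * sqdist f g + 2 * sqdist g h.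
Proof.
move=> bf bg bh; rewrite /sqdist -!RintegralZl//;
  try by apply: bounded_measurable_integrable; exact: bounded_measurable_sqrB.
have b2 f1 g1 : bounded_measurable f1 -> bounded_measurable g1 ->
    bounded_measurable (fun x => 2 * (f1 x - g1 x) ^+ 2).
  by move=> bf1 bg1; apply: bounded_measurableM;
    [exact: bounded_measurable_cst|exact: bounded_measurable_sqrB].
rewrite -RintegralD//; try by apply: bounded_measurable_integrable; exact: b2.
apply: le_Rintegral => //; try (by apply: bounded_measurable_integrable;
  apply: bounded_measurableD; exact: b2); first by apply: bounded_measurable_integrable;
    exact: bounded_measurable_sqrB.
by move=> x _; have := sqr_ge0 ((f x - g x) - (g x - h x)); nra.
Qed.

Lemma sqdistMl f g h (M : R) : bounded_measurable f -> bounded_measurable g ->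
  bounded_measurable h -> (forall x, `|h x| <= M) ->
  sqdist (fun x => h x * f x) (fun x => h x * g x) <= M ^+ 2 * sqdist f g.
Proof.
move=> bf bg bh hM; rewrite /sqdist -RintegralZl//;
  last by apply: bounded_measurable_integrable; exact: bounded_measurable_sqrB.
apply: le_Rintegral => //.
- by apply: bounded_measurable_integrable; apply: bounded_measurable_sqrB;
  exact: bounded_measurableM.
- by apply: bounded_measurable_integrable; apply: bounded_measurableM;
  [exact: bounded_measurable_cst|exact: bounded_measurable_sqrB].
move=> x _; rewrite -mulrBr exprMn ler_wpM2r ?sqr_ge0//.
by rewrite -[h x ^+ 2]real_normK ?num_real// lerXn2r ?nnegrE// (le_trans _ (hM x)).
Qed.

Variable A : set (T -> R).
Hypothesis A_bm : forall p, A p -> bounded_measurable p.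
Hypothesis A_cst : forall c, A (fun=> c).
Hypothesis AD : forall p q, A p -> A q -> A (fun x => p x + q x).
Hypothesis AM : forall p q, A p -> A q -> A (fun x => p x * q x).

(** The L^2(D)-closure of [A] within bounded functions; boundedness is part of the definition
    because products of L^2 limits are controlled only with it. *)
Definition approximable f := bounded_measurable f /\
  forall e, 0 < e -> exists2 p, A p & sqdist f p < e.

Lemma approximable_sub p : A p -> approximable p.
Proof.
move=> Ap; split; first exact: A_bm.
move=> e e0; exists p => //; rewrite /sqdist.
by under eq_Rintegral do rewrite subrr expr0n; rewrite Rintegral_cst// mul0r.
Qed.

Lemma approximable_trans f : bounded_measurable f ->
  (forall e, 0 < e -> exists2 g, approximable g & sqdist f g < e) -> approximable f.
Proof.
move=> bf fg; split => // e e0.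
have e4 : 0 < e / 4 by rewrite divr_gt0.
have [g [bg /(_ _ e4)[p Ap gp]] fge] := fg _ e4.
exists p => //; apply: (le_lt_trans (sqdist_le_trans bf bg (A_bm Ap))).
by move: fge gp; rewrite -/(sqdist f g); lra.
Qed.

Lemma approximableD f g : approximable f -> approximable g ->
  approximable (fun x => f x + g x).
Proof.
move=> [bf af] [bg ag]; split; first exact: bounded_measurableD.
move=> e e0; have e4 : 0 < e / 4 by rewrite divr_gt0.
have [p Ap fp] := af _ e4; have [q Aq gq] := ag _ e4.
have bp := A_bm Ap; have bq := A_bm Aq.
exists (fun x => p x + q x); first exact: AD.
have := sqdist_le_trans (bounded_measurableD bf bg) (bounded_measurableD bp bg)
  (bounded_measurableD bp bq).
rewrite [in X in _ <= 2 * X + _ -> _]/sqdist [in X in _ <= _ + 2 * X -> _]/sqdist.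
under eq_Rintegral do rewrite opprD addrACA subrr addr0.
under [in X in _ <= _ + 2 * X -> _]eq_Rintegral do rewrite opprD addrACA subrr add0r.
by move: fp gq; rewrite /sqdist; lra.
Qed.

(** One factor is replaced at a time, the other one being bounded: f g is close to p g with p in
    [A], and p g is close to p q. *)
Lemma approximableM f g : approximable f -> approximable g ->
  approximable (fun x => f x * g x).
Proof.
move=> [bf af] [bg ag].
have AfM p : A p -> approximable (fun x => p x * g x).
  move=> Ap; have bp := A_bm Ap; have [_ [M pM]] := bp.
  split; first exact: bounded_measurableM.
  (* Adding 1 to M^2 keeps the denominator positive when M = 0. *)
  move=> e e0; have e4 : 0 < e / (M ^+ 2 + 1).
    by rewrite divr_gt0// ltr_wpDl// sqr_ge0.
  have [q Aq gq] := ag _ e4; exists (fun x => p x * q x); first exact: AM.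
  apply: (le_lt_trans (sqdistMl bg (A_bm Aq) bp pM)).
  rewrite ltr_pdivlMr in gq; last by rewrite ltr_wpDl// sqr_ge0.
  apply: le_lt_trans gq; rewrite mulrDr mulr1 mulrC lerDl.
  by apply: Rintegral_ge0 => x _; exact: sqr_ge0.
apply: approximable_trans; first exact: bounded_measurableM.
have [_ [M gM]] := bg.
move=> e e0; have e4 : 0 < e / (M ^+ 2 + 1).
  by rewrite divr_gt0// ltr_wpDl// sqr_ge0.
have [p Ap fp] := af _ e4; exists (fun x => p x * g x); first exact: AfM.
have bp := A_bm Ap; have := sqdistMl bf bp bg gM.
have E h : (fun x => g x * h x) = fun x => h x * g x by apply/funext => x; rewrite mulrC.
rewrite !E => /le_lt_trans; apply.
rewrite ltr_pdivlMr in fp; last by rewrite ltr_wpDl// sqr_ge0.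
apply: le_lt_trans fp; rewrite mulrDr mulr1 mulrC lerDl.
by apply: Rintegral_ge0 => x _; exact: sqr_ge0.
Qed.

Lemma approximableZ c f : approximable f -> approximable (fun x => c * f x).
Proof. by apply: approximableM; apply: approximable_sub; exact: A_cst. Qed.

Lemma approximableB f g : approximable f -> approximable g ->
  approximable (fun x => f x - g x).
Proof.
move=> af ag; have -> : (fun x => f x - g x) = fun x => f x + (-1) * g x.
  by apply/funext => x; rewrite mulN1r.
by apply: approximableD => //; exact: approximableZ.
Qed.

Lemma approximableX f n : approximable f -> approximable (fun x => f x ^+ n).
Proof.
move=> af; elim: n => [|n IH].
  by under eq_fun do rewrite expr0; apply: approximable_sub; exact: A_cst.
by under eq_fun do rewrite exprS; exact: approximableM.
Qed.

(** Since D has finite measure, the constant (2M)^2 is integrable and dominates the squared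
    differences; dominated convergence gives convergence in L^2(D). *)
Lemma approximable_cvg (F : nat -> T -> R) f (M : R) :
  (forall n, approximable (F n)) -> (forall n x, `|F n x| <= M) ->
  (forall x, F ^~ x @ \oo --> f x) -> approximable f.
Proof.
move=> aF FM Ff.
have mf : measurable_fun setT f.
  by apply: (measurable_fun_cvg (h := F)) => [n|x _]; [exact: (aF n).1.1|exact: Ff].
have fM x : `|f x| <= M.
  have nF : (fun n => `|F n x|) @ \oo --> `|f x| by apply: cvg_norm; exact: Ff.
  rewrite -(cvg_lim _ nF)//; apply: limr_le; first exact: cvgP nF.
  by apply: nearW => n; exact: FM.
have bf : bounded_measurable f by split => //; exists M.
apply: approximable_trans => // e e0.
have bF n := (aF n).1.
have sq_le u v : `|u| <= M -> `|v| <= M -> (u - v) ^+ 2 <= (2 * M) ^+ 2.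
  move=> uM vM; rewrite -real_normK ?num_real// lerXn2r ?nnegrE//.
    by rewrite mulr_ge0//; exact: le_trans (normr_ge0 _) uM.
  by rewrite (le_trans (ler_normB _ _))//; lra.
have cvg0 : {ae mu, forall x, D x -> ((f x - F n x) ^+ 2)%:E @[n --> \oo] --> (0%E : \bar R)}.
  apply: aeW => x _.
  have : (fun n => (f x - F n x) * (f x - F n x)) @ \oo --> (f x - f x) * (f x - f x).
    by apply: cvgM; apply: cvgB; [exact: cvg_cst|exact: Ff|exact: cvg_cst|exact: Ff].
  by rewrite subrr mulr0 => h; apply: cvg_EFin; [exact: nearW|exact: h].
have dom : {ae mu, forall x n, D x -> (`|((f x - F n x) ^+ 2)%:E| <= ((2 * M) ^+ 2)%:E)%E}.
  by apply: aeW => x n _; rewrite gee0_abs ?lee_fin ?sqr_ge0// sq_le.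
have [_ _] := @dominated_convergence _ _ _ mu D mD (fun n x => ((f x - F n x) ^+ 2)%:E)
    (fun=> 0%E) (fun=> ((2 * M) ^+ 2)%:E)
    (fun n => iffRL (measurable_EFinP _ _) (measurable_funTS (bounded_measurable_sqrB bf (bF n)).1))
    (measurable_cst _) cvg0 (bounded_measurable_integrable (bounded_measurable_cst _)) dom.
rewrite integral0 => intF.
have /cvgr_lt/(_ _ e0) : sqdist f (F n) @[n --> \oo] --> (0 : R) by exact: fine_cvg.
by move=> /filter_ex[n fn]; exists (F n).
Qed.

(* The iteration S (n + 1) = S n + (t^2 - (S n)^2) / 2 from 0 increases to |t|. *)
Let approximable_norm1 f : approximable f -> (forall x, `|f x| <= 1) ->
  approximable (fun x => `|f x|).
Proof.
move=> af f1.
pose S (t : R) := fix S n := if n is m.+1 then S m + (t ^+ 2 - S m ^+ 2) / 2 else 0 : R.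
have Sbnd t n : 0 <= t <= 1 -> 0 <= t - S t n <= t * (1 - t / 2) ^+ n /\ 0 <= S t n.
  move=> t01; elim: n => [|n [IH1 IH2]]; first by rewrite /= expr0; lra.
  have -> : S t n.+1 = S t n + (t ^+ 2 - S t n ^+ 2) / 2 by [].
  have := IH1; move: (S t n) IH2 => s s0 {IH1}; set r := _ * _ ^+ n => IH.
  rewrite [_ ^+ n.+1]exprSr [t * _]mulrA -/r.
  split; last by nra.
  (* The error is multiplied at each step by 1 - (t + s)/2, which lies between 0 and 1 - t/2 because
     0 <= s <= t <= 1. *)
  have -> : t - (s + (t ^+ 2 - s ^+ 2) / 2) = (t - s) * (1 - (t + s) / 2) by field.
  apply/andP; split; first by rewrite mulr_ge0; lra.
  by rewrite ler_pM; lra.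
have SE t n : S `|t| n = S t n.
  by elim: n => //= n ->; rewrite real_normK ?num_real.
apply: (approximable_cvg (F := fun n x => S (f x) n) (M := 1)).
- elim=> [|n IH]; first by apply: approximable_sub; exact: A_cst.
  have -> : (fun x => S (f x) n.+1) = fun x => S (f x) n + 2^-1 * (f x ^+ 2 - S (f x) n ^+ 2).
    by apply/funext => x /=; rewrite [2^-1 * _]mulrC.
  apply: approximableD => //; apply: approximableZ; apply: approximableB; exact: approximableX.
- move=> n x; have [] := Sbnd `|f x| n; first by rewrite normr_ge0 f1.
  by rewrite SE => h1 h2; rewrite ger0_norm//; have := f1 x; lra.
- move=> x; have t01 : 0 <= `|f x| <= 1 by rewrite normr_ge0 f1.
  under eq_cvg do rewrite -SE.
  move: (`|f x|) t01 => t t01.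
  (* The geometric ratio 1 - t/2 equals 1 at t = 0, where the iteration is constantly 0. *)
  have [->|t0] := eqVneq t 0.
    rewrite (_ : S 0 = fun=> 0); first exact: cvg_cst.
    apply/funext => n; have [|] := Sbnd 0 n; first by rewrite lexx ler01.
    by rewrite mul0r; lra.
  have hb : (fun n => t - t * (1 - t / 2) ^+ n) @ \oo --> t - t * 0.
    apply: cvgB; first exact: cvg_cst.
    apply: cvgMr; apply: cvg_expr; rewrite ltr_norml; lra.
  rewrite mulr0 subr0 in hb.
  apply: (squeeze_cvgr _ hb (@cvg_cst _ t _ _ _)).
  by apply: nearW => n; have [] := Sbnd t n t01; lra.
Qed.

Lemma approximable_norm f : approximable f -> approximable (fun x => `|f x|).
Proof.
move=> af; have [[mf [M fM]] _] := af.
pose K := `|M| + 1; have K0 : 0 < K by rewrite ltr_wpDl.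
have aK := approximableZ K^-1 af.
have := approximableZ K (approximable_norm1 aK _).
under eq_fun do rewrite normrM gtr0_norm ?invr_gt0// mulrA divff ?gt_eqF// mul1r.
apply=> x; rewrite normrM gtr0_norm ?invr_gt0// mulrC ler_pdivrMr// mul1r.
by rewrite (le_trans (fM x))// (le_trans (ler_norm _))// lerDl.
Qed.

(* With u = f^+ / K in [0, 1], 1 - (1 - u)^n tends to the indicator of {0 < f}. *)
Lemma approximable_gt0 f : approximable f -> approximable \1_[set x | 0 < f x].
Proof.
move=> af.
have [[mf [M fM]] _] := af.
pose K := `|M| + 1; have K0 : 0 < K by rewrite ltr_wpDl.
pose u x := 2^-1 * K^-1 * (f x + `|f x|).
have au : approximable u by apply: approximableZ; apply: approximableD => //;
  exact: approximable_norm.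
have u01 x : 0 <= u x <= 1.
  have := fM x; have := ler_norm (f x); have := ler_norm (- f x); rewrite normrN.
  have := ler_norm M => h1 h2 h3 h4.
  have r0 : 0 <= f x + `|f x| by lra.
  have rK : f x + `|f x| <= 2 * K by rewrite /K; lra.
  rewrite /u -invfM mulrC; apply/andP; split.
    by rewrite divr_ge0// mulr_ge0// ltW.
  by rewrite ler_pdivrMr ?mul1r// mulr_gt0.
apply: (approximable_cvg (F := fun n x => 1 - (1 - u x) ^+ n) (M := 1)).
- move=> n; apply: approximableB; first exact/approximable_sub/A_cst.
  apply: approximableX; apply: approximableB => //; exact/approximable_sub/A_cst.
- move=> n x; have := u01 x => ux.
  have h0 : 0 <= (1 - u x) ^+ n by rewrite exprn_ge0; lra.
  have h1 : (1 - u x) ^+ n <= 1 by rewrite exprn_ile1; lra.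
  by rewrite ger0_norm; lra.
- move=> x; rewrite indicE; case: (boolP (x \in _)); rewrite ?inE ?notin_setE /= => fx.
    have u0 : 0 < u x by rewrite /u gtr0_norm// !mulr_gt0 ?invr_gt0// addr_gt0.
    rewrite [X in _ --> X](_ : _ = 1 - 0); last by rewrite subr0.
    apply: cvgB; first exact: cvg_cst.
    by apply: cvg_expr; rewrite ltr_norml; have := u01 x; lra.
  have -> : u x = 0.
    by rewrite /u ler0_norm ?leNgt; [rewrite subrr mulr0|exact/negP].
  by under eq_cvg do rewrite subr0 expr1n subrr; exact: cvg_cst.
Qed.

Lemma approximable_indicC (S : set T) : approximable (\1_S : T -> R) ->
  approximable (\1_(~` S) : T -> R).
Proof.
move=> aS; have -> : \1_(~` S) = (fun x => 1 - \1_S x) :> (T -> R).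
  by apply/funext => x; rewrite !indicE in_setC; case: (x \in S) => /=; rewrite ?subrr ?subr0.
by apply: approximableB => //; exact/approximable_sub/A_cst.
Qed.

Lemma approximable_indicI (S S' : set T) : approximable (\1_S : T -> R) ->
  approximable (\1_S' : T -> R) -> approximable (\1_(S `&` S') : T -> R).
Proof.
move=> aS aS'; have -> : \1_(S `&` S') = (fun x => \1_S x * \1_S' x) :> (T -> R).
  by apply/funext => x; rewrite !indicE in_setI -natrM mulnb.
exact: approximableM.
Qed.

(** Finite unions come from intersections and complements; at each point their indicators are
    eventually constant, and they are bounded by 1. *)
Lemma approximable_indic_bigcup (F : nat -> set T) :
  (forall n, approximable (\1_(F n) : T -> R)) -> approximable (\1_(\bigcup_n F n) : T -> R).
Proof.
move=> aF.
pose G n := \1_(~` (\big[setI/setT]_(i < n) ~` F i)) : T -> R.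
apply: (approximable_cvg (F := G) (M := 1)).
- move=> n; apply: approximable_indicC; elim: n => [|n IH].
    rewrite big_ord0 (_ : \1_setT = fun=> 1); first exact/approximable_sub/A_cst.
    by apply/funext => x; rewrite indicE in_setT.
  by rewrite big_ord_recr/=; apply: approximable_indicI => //; exact: approximable_indicC.
- by move=> n x; rewrite /G indicE; case: (x \in _); rewrite ?normr1 ?normr0.
- have GE n x : G n x = (x \in ~` (\bigcap_(i < n) ~` F i))%:R.
    by rewrite /G indicE bigcap_mkord.
  move=> x; have [[k _ Fkx]|nF] := pselect ((\bigcup_n F n) x).
    rewrite indicE mem_set; last by exists k.
    apply: cvg_near_cst; exists k.+1 => // n /= kn.
    by rewrite GE mem_set// => /(_ k kn).
  rewrite indicE memNset//; apply: cvg_near_cst; exists 0%N => // n /= _.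
  by rewrite GE memNset// => h; apply: h => i _ Fi; apply: nF; exists i.
Qed.

Import HBNNSimple.

(** A nonnegative bounded function is a bounded increasing limit of simple functions; the general
    case follows by adding the bound M and subtracting it again. *)
Lemma approximable_bounded_measurable f :
  (forall S, measurable S -> approximable (\1_S : T -> R)) ->
  bounded_measurable f -> approximable f.
Proof.
move=> aS bf.
have pos g : bounded_measurable g -> (forall x, 0 <= g x) -> approximable g.
  move=> [mg [M gM]] g0.
  have mG : measurable_fun setT (EFin \o g) by exact/measurable_EFinP.
  pose h := nnsfun_approx measurableT mG.
  have hg x : (fun n => h n x) @ \oo --> g x.
    have G0 y : setT y -> (0 <= (EFin \o g) y)%E by rewrite lee_fin.
    exact: (fine_cvg (cvg_nnsfun_approx measurableT mG G0 (x := x) I)).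
  apply: (approximable_cvg (F := fun n x => h n x) (M := M)) => //.
  - move=> n; under eq_fun do rewrite fimfunE fsbig_finite//=.
    elim: (finmap.enum_fset _) => [|y s IH].
      by under eq_fun do rewrite big_nil; apply: approximable_sub; exact: A_cst.
    under eq_fun do rewrite big_cons; apply: approximableD => //.
    by apply: approximableZ; exact: aS.
  - move=> n x; rewrite ger0_norm; last exact: fun_ge0.
    apply: le_trans (le_trans (ler_norm _) (gM x)).
    rewrite -(cvg_lim _ (hg x))//; apply: nondecreasing_cvgn_le; last exact: cvgP (hg x).
    by move=> p q pq; exact/lefP/nd_nnsfun_approx.
have [mf [M fM]] := bf.
have -> : f = fun x => (f x + M) - M by apply/funext => x; rewrite addrK.
apply: approximableB; last exact/approximable_sub/A_cst.
apply: pos; first by apply: bounded_measurableD => //; exact: bounded_measurable_cst.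
by move=> x; have := fM x; rewrite ler_norml; lra.
Qed.
End algebra_closure.

Section edot_bilinear.
Context {R : realType} {n : nat}.
Implicit Types x y z : 'rV[R]_n.

Lemma edotC x y : edot x y = edot y x.
Proof. by rewrite /edot; apply: eq_bigr => i _; rewrite mulrC. Qed.

Lemma edotDl x y z : edot (x + y) z = edot x z + edot y z.
Proof. by rewrite /edot -big_split; apply: eq_bigr => i _; rewrite mxE mulrDl. Qed.

Lemma edotZl (t : R) x y : edot (t *: x) y = t * edot x y.
Proof. by rewrite /edot mulr_sumr; apply: eq_bigr => i _; rewrite mxE mulrA. Qed.

Lemma edotNl x y : edot (- x) y = - edot x y.
Proof. by rewrite -scaleN1r edotZl mulN1r. Qed.

Lemma edotDr x y z : edot z (x + y) = edot z x + edot z y.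
Proof. by rewrite ![edot z _]edotC edotDl. Qed.

Lemma edotZr (t : R) x y : edot x (t *: y) = t * edot x y.
Proof. by rewrite ![edot x _]edotC edotZl. Qed.

End edot_bilinear.

(** * Fourier series on the unit cube *)

Section trigonometric_polynomials.
Context {R : realType} {n : nat}.
Implicit Types (k l : 'rV[int]_n) (x : 'rV[R]_n).

Definition expi k x : R[i] := expi2pi (edot (map_mx intr k) x).

Lemma expiD k l x : expi (k + l) x = expi k x * expi l x.
Proof. by rewrite /expi map_mxD edotDl expi2piD. Qed.

Lemma expiN k x : expi (- k) x = (expi k x)^*.
Proof. by rewrite /expi map_mxN edotNl expi2piN. Qed.

Lemma expi0 x : expi 0 x = 1.
Proof. by rewrite /expi map_mx0 -[0](scale0r 0) edotZl mul0r expi2pi0. Qed.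

Lemma cmeas_expi k : cmeas (expi k).
Proof. exact: cmeas_expi2pi_edot. Qed.

Definition trig_poly (s : seq ('rV[int]_n * R[i])) x : R[i] :=
  \sum_(j <- s) j.2 * expi j.1 x.

Lemma cmeas_trig_poly s : cmeas (trig_poly s).
Proof. by apply: cmeas_sum => j; apply: cmeasZ; exact: cmeas_expi. Qed.

Lemma cabsD (z w : R[i]) : cabs (z + w) <= cabs z + cabs w.
Proof.
have := ComplexField.lec_normD z w.
by rewrite /=; case: z w => a b [c d] /= /andP[].
Qed.

Lemma cabsN (z : R[i]) : cabs (- z) = cabs z.
Proof. by case: z => a b /=; rewrite !sqrrN. Qed.

Lemma cabs_trig_poly s x : cabs (trig_poly s x) <= \sum_(j <- s) cabs j.2.
Proof.
rewrite /trig_poly; elim: s => [|j s IH].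
  by rewrite !big_nil ComplexField.Normc.normc0.
rewrite !big_cons (le_trans (cabsD _ _))// lerD// cabsM.
by rewrite cabs_expi2pi mulr1.
Qed.

(** The approximation argument uses order and absolute values, hence real functions, while the
    coefficients to be compared belong to complex exponentials; this set links the two. *)
Definition real_trig_poly : set ('rV[R]_n -> R) :=
  [set p | exists s, forall x, (p x)%:C = trig_poly s x].

Lemma bounded_measurable_real_trig_poly p : real_trig_poly p -> bounded_measurable p.
Proof.
move=> [s ps]; split; last first.
  by exists (\sum_(j <- s) cabs j.2) => x; rewrite -cabs_real ps cabs_trig_poly.
rewrite (_ : p = fun x => complex.Re (trig_poly s x)); first exact: (cmeas_trig_poly s).1.
by apply/funext => x; rewrite -ps.
Qed.

Lemma real_trig_poly_cst c : real_trig_poly (fun=> c).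
Proof. by exists [:: (0, c%:C)] => x; rewrite /trig_poly big_seq1 expi0 mulr1. Qed.

Lemma real_trig_polyD p q : real_trig_poly p -> real_trig_poly q ->
  real_trig_poly (fun x => p x + q x).
Proof.
move=> [s ps] [t qt]; exists (s ++ t) => x.
by rewrite /trig_poly big_cat/= rmorphD/= ps qt.
Qed.

Lemma real_trig_polyM p q : real_trig_poly p -> real_trig_poly q ->
  real_trig_poly (fun x => p x * q x).
Proof.
move=> [s ps] [t qt]; exists [seq (j.1 + m.1, j.2 * m.2) | j <- s, m <- t] => x.
rewrite rmorphM/= ps qt /trig_poly big_distrl big_allpairs_dep/=.
apply: eq_bigr => j _; rewrite big_distrr/=; apply: eq_bigr => l _.
by rewrite expiD; ring.
Qed.

Let coord i x : edot (map_mx intr (delta_mx ord0 i : 'rV[int]_n)) x = x ord0 i.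
Proof.
rewrite /edot (bigD1 i)//= big1 ?addr0 => [|j ji]; rewrite !mxE eqxx/=.
  by rewrite eqxx mul1r.
by rewrite (negbTE ji) mul0r.
Qed.

Lemma real_trig_poly_cos i : real_trig_poly (fun x => cos (2 * pi * x ord0 i)).
Proof.
exists [:: (delta_mx ord0 i, (1 / 2)%:C); (- delta_mx ord0 i, (1 / 2)%:C)] => x.
rewrite /trig_poly !big_cons big_nil expiN /expi coord /expi2pi/=.
by apply: complexP => /=; field.
Qed.

Lemma real_trig_poly_sin i : real_trig_poly (fun x => sin (2 * pi * x ord0 i)).
Proof.
exists [:: (delta_mx ord0 i, 0 -i* (1 / 2)); (- delta_mx ord0 i, 0 +i* (1 / 2))] => x.
rewrite /trig_poly !big_cons big_nil expiN /expi coord /expi2pi/=.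
by apply: complexP => /=; field.
Qed.

Local Notation mu := (@lebesgue_row R n).
Local Notation Q := (@cube R n).
Local Notation approx := (approximable mu Q real_trig_poly).

Let mQ : measurable Q. Proof. exact: measurable_cube. Qed.
Let Qoo : (mu Q < +oo)%E. Proof. by rewrite lebesgue_cube ltry. Qed.

(** Only the values on the cube enter the distance, so a periodic description valid on the cube is
    enough. *)
Lemma eq_approximable f g : bounded_measurable g -> (forall x, Q x -> f x = g x) ->
  approx f -> approx g.
Proof.
move=> bg fg [_ af]; split => // e e0; have [p Ap fp] := af _ e0.
exists p => //; apply: le_lt_trans fp; rewrite /sqdist le_eqVlt; apply/orP; left; apply/eqP.
by apply: eq_Rintegral => x /set_mem Qx; rewrite fg.
Qed.

Let approx_sub p : real_trig_poly p -> approx p.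
Proof. exact: (approximable_sub mu mQ bounded_measurable_real_trig_poly). Qed.

Let approx_cst c : approx (fun=> c).
Proof. by apply: approx_sub; exact: real_trig_poly_cst. Qed.

Let approx_gt0 f : approx f -> approx \1_[set x | 0 < f x].
Proof.
exact: (approximable_gt0 mQ Qoo bounded_measurable_real_trig_poly real_trig_poly_cst real_trig_polyD real_trig_polyM).
Qed.

Let approxC S : approx \1_S -> approx \1_(~` S).
Proof.
exact: (approximable_indicC mQ Qoo bounded_measurable_real_trig_poly real_trig_poly_cst real_trig_polyD real_trig_polyM).
Qed.

Let approxI S S' : approx \1_S -> approx \1_S' -> approx \1_(S `&` S').
Proof.
exact: (approximable_indicI mQ Qoo bounded_measurable_real_trig_poly real_trig_polyM).
Qed.

Let approx_bigcup F : (forall k : nat, approx \1_(F k)) -> approx \1_(\bigcup_k F k).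
Proof.
exact: (approximable_indic_bigcup mQ Qoo bounded_measurable_real_trig_poly real_trig_poly_cst real_trig_polyD real_trig_polyM).
Qed.

Let approxB f g : approx f -> approx g -> approx (fun x => f x - g x).
Proof.
exact: (approximableB mQ Qoo bounded_measurable_real_trig_poly real_trig_poly_cst real_trig_polyD real_trig_polyM).
Qed.

Let approx_indic0 : approx \1_set0.
Proof. by rewrite indic0; exact: approx_cst. Qed.

Let bounded_measurable_indic S : measurable S -> bounded_measurable (\1_S : 'rV[R]_n -> R).
Proof.
move=> mS; split; first exact: measurable_indic.
by exists 1 => x; rewrite indicE; case: (x \in S); rewrite ?normr0 ?normr1.
Qed.

(* On the cube, c < x_i is decided by the sign of sin (2 pi x_i) together with
   the comparison of cos (2 pi x_i) with cos (2 pi c). *)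
Let approx_ray i c : approx \1_[set x | c < x ord0 i].
Proof.
have ac : approx (fun x => cos (2 * pi * x ord0 i)).
  by apply: approx_sub; exact: real_trig_poly_cos.
have as_ : approx (fun x => sin (2 * pi * x ord0 i)).
  by apply: approx_sub; exact: real_trig_poly_sin.
have mray : measurable [set x : 'rV[R]_n | c < x ord0 i].
  rewrite (_ : [set _ | _] = (fun x : 'rV[R]_n => x ord0 i) @^-1` `]c, +oo[).
    rewrite -[X in measurable X]setTI.
    exact: (@measurable_row_coord _ R n i measurableT _ (measurable_itv _)).
  by apply/seteqP; split => x /=; rewrite in_itv/= andbT.
have eqi S : approx \1_S -> (forall x, Q x -> S x <-> c < x ord0 i) ->
    approx \1_[set x | c < x ord0 i].
  move=> aS h; apply: eq_approximable aS; first exact: bounded_measurable_indic.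
  by move=> x Qx; rewrite !indicE; congr (_%:R); apply: congr1;
    apply/idP/idP => /set_mem/(h _ Qx); exact: mem_set.
have pi0 := pi_gt0 R.
have sin_ge0 (y : R) : - (1 / 2) < y <= 1 / 2 -> (0 <= sin (2 * pi * y)) = (0 <= y).
  move=> Qy; apply/idP/idP => h.
    rewrite leNgt; apply/negP => y0; move: h; apply/negP; rewrite -ltNge.
    rewrite -oppr_gt0 -sinN; apply: sin_gt0_pi; nra.
  by apply: sin_ge0_pi; nra.
have aS0 : approx \1_(~` [set x | 0 < 0 - sin (2 * pi * x ord0 i)]).
  by apply/approxC/approx_gt0/approxB => //; exact: approx_cst.
have [c1|c1] := leP c (- (1 / 2)).
  apply: (eqi _ (approxC approx_indic0)) => x /(_ i)/andP[x1 x2]; split=> [_|_ []]; lra.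
have [c2|c2] := leP (1 / 2) c.
  apply: (eqi _ approx_indic0) => x /(_ i)/andP[x1 x2]; split=> [[]|]; lra.
(* For 0 <= c < 1/2, c < x_i means sin >= 0 and cos (2 pi x_i) < cos (2 pi c), as cosine decreases
   on [0, pi]. *)
have [c3|c3] := leP 0 c.
  have a1 : approx \1_[set x | 0 < cos (2 * pi * c) - cos (2 * pi * x ord0 i)].
    by apply/approx_gt0/approxB => //; exact: approx_cst.
  apply: (eqi _ (approxI aS0 a1)) => x /(_ i) Qx /=.
  rewrite sub0r oppr_gt0 subr_gt0; split.
    move=> [/negP]; rewrite -leNgt sin_ge0// => x0.
    rewrite ltr_cos ?in_itv/=; [nra|nra|nra].
  move=> cx; split; first by apply/negP; rewrite -leNgt sin_ge0//; lra.
  by rewrite ltr_cos ?in_itv/=; nra.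
(* For -1/2 < c < 0 the complement is described: x_i <= c means sin < 0 and cos (2 pi x_i) <= cos (2
   pi c), as cosine increases on [-pi, 0]. The point x_i = 1/2 is kept out of it by sin >= 0. *)
have a1 : approx \1_(~` [set x | 0 < cos (2 * pi * x ord0 i) - cos (2 * pi * c)]).
  by apply/approxC/approx_gt0/approxB => //; exact: approx_cst.
apply: (eqi _ (approxC (approxI (approxC aS0) a1))) => x /(_ i) Qx.
rewrite setCK/= sub0r oppr_gt0 subr_gt0; split.
  move=> h; rewrite ltNge; apply/negP => xc; apply: h; split.
    by rewrite ltNge sin_ge0// -ltNge; lra.
  apply/negP; rewrite -leNgt -[leLHS]cosN -[leRHS]cosN leNgt ltr_cos ?in_itv/= -?leNgt; nra.
move=> cx [s0 /negP]; rewrite -leNgt.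
have x0 : x ord0 i < 0 by rewrite ltNge -sin_ge0// -ltNge.
by rewrite -[leLHS]cosN -[leRHS]cosN leNgt ltr_cos ?in_itv/= -?leNgt; nra.
Qed.

Lemma approximable_trig (f : 'rV[R]_n -> R) : bounded_measurable f -> approx f.
Proof.
apply: (approximable_bounded_measurable mQ Qoo bounded_measurable_real_trig_poly real_trig_poly_cst
  real_trig_polyD real_trig_polyM) => S.
(* Used twice: with [id], to pass from a measurable set of rows to the preimage of a measurable set
   of reals under a coordinate, then with that coordinate, to pass to open rays. *)
have sigma (U : Type) (h : 'rV[R]_n -> U) :
    sigma_algebra setT [set B | approx \1_(h @^-1` B)].
  split => [|B|F] /=.
  - by rewrite preimage_set0.
  - by rewrite setTD preimage_setC; exact: approxC.
  - by rewrite preimage_bigcup; exact: approx_bigcup.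
apply: (smallest_sub (sigma _ id)) => {}S.
rewrite -bigcup_seq => -[i _ [B mB <-]] /=; rewrite setTI preimage_id.
have {}mB : (@RGenOInfty.G R).-sigma.-measurable B by rewrite -RGenOInfty.measurableE.
move: B mB.
apply: (smallest_sub (sigma _ (fun x => x ord0 i))) => {}B [c ->] /=.
apply: eq_approximable (approx_ray i c).
  apply: bounded_measurable_indic; rewrite -[X in measurable X]setTI.
  exact: (@measurable_row_coord _ R n i measurableT _ (measurable_itv _)).
move=> x _; rewrite !indicE; congr (_%:R); apply: congr1.
by apply/idP/idP => /set_mem/= h; apply: mem_set; move: h; rewrite /= in_itv/= andbT.
Qed.

(** Frequencies may repeat in the list of a trigonometric polynomial; the orthogonality computation
    below needs them distinct. *)
Lemma trig_poly_collect s : exists K (c : 'rV[int]_n -> R[i]), uniq K /\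
  forall x, trig_poly s x = \sum_(k <- K) c k * expi k x.
Proof.
elim: s => [|[l z] s [K [c [uK sK]]]].
  by exists [::], (fun=> 0); split => // x; rewrite /trig_poly !big_nil.
have [lK|lK] := boolP (l \in K).
  exists K, (fun k => (if k == l then z else 0) + c k); split => // x.
  rewrite /trig_poly big_cons/= -/(trig_poly s x) sK.
  under [RHS]eq_bigr do rewrite mulrDl; rewrite big_split/=; congr (_ + _).
  rewrite (bigD1_seq l)//= eqxx big1 ?addr0// => k /negbTE ->.
  by rewrite mul0r.
exists (l :: K), (fun k => if k == l then z else c k); split => /=; first by rewrite lK.
move=> x; rewrite /trig_poly !big_cons/= eqxx -/(trig_poly s x) sK; congr (_ + _).
rewrite big_seq [RHS]big_seq; apply: eq_bigr => k kK.
by case: eqP => // kl; rewrite -kl kK in lK.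
Qed.

Definition bounded_cmeas (F : 'rV[R]_n -> R[i]) :=
  cmeas F /\ exists M, forall x, cabs (F x) <= M.

Definition fourier_coef (F : 'rV[R]_n -> R[i]) k : R[i] :=
  cint mu Q (fun x => F x * expi (- k) x).

Let N (F : 'rV[R]_n -> R[i]) : R := \int[mu]_(x in Q) nsq (F x).

Lemma bounded_cmeas_expi k : bounded_cmeas (expi k).
Proof. by split; [exact: cmeas_expi|exists 1 => x; rewrite cabs_expi2pi]. Qed.

Lemma bounded_cmeasM F G : bounded_cmeas F -> bounded_cmeas G ->
  bounded_cmeas (fun x => F x * G x).
Proof.
move=> [mF [M FM]] [mG [K GK]]; split; first exact: cmeasM.
by exists (M * K) => x; rewrite cabsM ler_pM// cabs_ge0.
Qed.

Lemma bounded_cmeas_cst c : bounded_cmeas (fun=> c).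
Proof. by split; [exact: cmeas_cst|exists (cabs c)]. Qed.

Lemma bounded_cmeasB F G : bounded_cmeas F -> bounded_cmeas G ->
  bounded_cmeas (fun x => F x - G x).
Proof.
move=> [mF [M FM]] [mG [K GK]]; split; first exact: cmeasB.
exists (M + K) => x; rewrite (le_trans (cabsD _ _))// lerD//.
by rewrite cabsN.
Qed.

Lemma bounded_cmeas_integrable F : bounded_cmeas F -> cintegrable mu Q F.
Proof. by move=> [mF [M FM]]; exact: (cintegrable_bounded mQ Qoo mF (fun x _ => FM x)). Qed.

Lemma bounded_cmeas_nsq F : bounded_cmeas F -> bounded_measurable (fun x => nsq (F x)).
Proof.
move=> [mF [M FM]]; split; first exact: measurable_nsq.
exists (M ^+ 2) => x; rewrite ger0_norm ?nsq_ge0// -sqr_cabs lerXn2r ?nnegrE ?cabs_ge0//.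
by rewrite (le_trans _ (FM x)) ?cabs_ge0.
Qed.

(** Orthonormality of the exponentials in the form used below: subtracting a multiple of one of them
    affects only its own coefficient. *)
Lemma fourier_coefB F c l k : bounded_cmeas F ->
  fourier_coef (fun x => F x - c * expi l x) k = fourier_coef F k - c * (k == l)%:R.
Proof.
move=> bF; rewrite /fourier_coef.
have b1 := bounded_cmeasM bF (bounded_cmeas_expi (- k)).
have b2 := bounded_cmeas_expi (l - k).
rewrite -[cint _ _ _ in RHS]/(cint mu Q (fun x => F x * expi (- k) x)).
have -> : c * (k == l)%:R = cint mu Q (fun x => c * expi (l - k) x).
  rewrite cintZ//; last exact: bounded_cmeas_integrable.
  congr (_ * _); have [->|kl] := eqVneq k l; last by rewrite cint_cube_expi2pi// subr_eq0 eq_sym.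
  rewrite subrr (_ : cint mu Q _ = cint mu Q (fun=> 1)); last first.
    by apply: eq_cint => x _; exact: expi0.
  apply: complexP => /=; rewrite Rintegral_cst// ?mul0r// mul1r.
  by rewrite [X in fine X]lebesgue_cube.
rewrite -cintB//; last 2 first.
- exact: bounded_cmeas_integrable.
- by apply: cintegrableZ => //; exact: bounded_cmeas_integrable.
by apply: eq_cint => x _; rewrite mulrBl -mulrA -expiD.
Qed.

(** Completing the square: the expansion N F - 2 Re (conj c F^) + |c|^2, with F^ the coefficient of
    F at k, equals N F + |c - F^|^2 - |F^|^2. *)
Lemma sqnorm_sub_expi F c k : bounded_cmeas F ->
  N (fun x => F x - c * expi k x) =
  N F + (nsq (c - fourier_coef F k) - nsq (fourier_coef F k)).
Proof.
move=> bF.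
have bG := bounded_cmeasM bF (bounded_cmeas_expi (- k)).
have := bounded_cmeas_integrable bG; rewrite /fourier_coef; set G := (fun x => _) => -[G1 G2].
have E x : nsq (F x - c * expi k x) = nsq (F x) +
    ((- 2 * complex.Re c) * complex.Re (G x) + (- 2 * complex.Im c) * complex.Im (G x)) + nsq c.
  have := nsq_expi2pi (edot (map_mx intr k) x); rewrite /G expiN /expi.
  case: (F x) (expi2pi _) c => f1 f2 [e1 e2] [c1 c2]; rewrite /nsq/= => e12.
  have -> : c1 ^+ 2 + c2 ^+ 2 = (c1 ^+ 2 + c2 ^+ 2) * (e1 ^+ 2 + e2 ^+ 2) by rewrite e12 mulr1.
  ring.
have iZ (r : R) (h : 'rV[R]_n -> R) : mu.-integrable Q (fun x => (h x)%:E) ->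
    mu.-integrable Q (fun x => (r * h x)%:E).
  by move=> jh; have := integrableZl mQ r jh; apply: eq_integrable => // x _ /=; rewrite EFinM.
have iD (h g : 'rV[R]_n -> R) : mu.-integrable Q (fun x => (h x)%:E) ->
    mu.-integrable Q (fun x => (g x)%:E) -> mu.-integrable Q (fun x => (h x + g x)%:E).
  by move=> jh jg; have := integrableD mQ jh jg; apply: eq_integrable => // x _ /=; rewrite EFinD.
have jF := bounded_measurable_integrable mQ Qoo (bounded_cmeas_nsq bF).
have j1 := iZ (- 2 * complex.Re c) _ G1; have j2 := iZ (- 2 * complex.Im c) _ G2.
rewrite /N; under eq_Rintegral do rewrite E.
rewrite RintegralD//; last 2 first.
- by apply: (iD (fun x => nsq (F x))) => //; exact: iD.
- by apply: bounded_measurable_integrable => //; exact: bounded_measurable_cst.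
rewrite RintegralD//; last exact: iD.
rewrite (_ : \int[mu]_(x in Q) (- 2 * complex.Re c * complex.Re (G x) +
      - 2 * complex.Im c * complex.Im (G x)) =
    (- 2 * complex.Re c) * \int[mu]_(x in Q) complex.Re (G x) +
    (- 2 * complex.Im c) * \int[mu]_(x in Q) complex.Im (G x)); last first.
  by rewrite RintegralD// !RintegralZl.
rewrite Rintegral_cst// [X in fine X]lebesgue_cube/= mulr1.
rewrite -addrA; congr (_ + _); rewrite /cint.
case: c {E j1 j2} => c1 c2; rewrite /nsq/=; ring.
Qed.

Lemma sqnorm_sub_trig F (c : 'rV[int]_n -> R[i]) K : bounded_cmeas F -> uniq K ->
  N (fun x => F x - \sum_(k <- K) c k * expi k x) =
  N F + \sum_(k <- K) (nsq (c k - fourier_coef F k) - nsq (fourier_coef F k)).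
Proof.
move=> + uK; elim: K uK F => [|l K IH] /=.
  by move=> _ F _; rewrite big_nil addr0 /N; under eq_Rintegral do rewrite big_nil subr0.
move=> /andP[lK uK] F bF.
have bG : bounded_cmeas (fun x => F x - c l * expi l x).
  apply: bounded_cmeasB => //; apply: bounded_cmeasM; first exact: bounded_cmeas_cst.
  exact: bounded_cmeas_expi.
transitivity (N (fun x => (F x - c l * expi l x) - \sum_(k <- K) c k * expi k x)).
  by apply: eq_Rintegral => x _; rewrite big_cons opprD addrA.
rewrite IH// sqnorm_sub_expi// big_cons -addrA; congr (_ + (_ + _)).
rewrite big_seq [RHS]big_seq; apply: eq_bigr => k kK.
rewrite fourier_coefB// (_ : (k == l) = false) ?mulr0 ?subr0//.
by apply/negbTE; apply: contraNneq lK => <-.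
Qed.

(** Both inequalities come from [sqnorm_sub_trig]. With c the Fourier coefficients themselves,
    nonnegativity of the left side is Bessel. With c the coefficients of a polynomial within e of F,
    it bounds N F by e plus a finite sum of squared coefficients. *)
Theorem cube_parseval F : bounded_cmeas F ->
  (\esum_(k in [set: 'rV[int]_n]) (nsq (fourier_coef F k))%:E =
   \int[mu]_(x in Q) (nsq (F x))%:E)%E.
Proof.
move=> bF; have jF := bounded_measurable_integrable mQ Qoo (bounded_cmeas_nsq bF).
have -> : (\int[mu]_(x in Q) (nsq (F x))%:E = (N F)%:E)%E.
  by rewrite /N /Rintegral fineK// integrable_fin_num.
have N0 G : 0 <= N G by apply: Rintegral_ge0 => x _; exact: nsq_ge0.
apply/eqP; rewrite eq_le; apply/andP; split.
  apply: ge_ereal_sup => _ [X [finX _] <-]; rewrite fsbig_finite//= sumEFin lee_fin.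
  have uX := finmap.fset_uniq (fset_set X).
  have := N0 (fun x => F x - \sum_(k <- finmap.enum_fset (fset_set X)) fourier_coef F k * expi k x).
  rewrite sqnorm_sub_trig//.
  under eq_bigr do rewrite subrr /nsq/= !expr0n addr0 sub0r.
  by rewrite sumrN subr_ge0.
apply/lee_addgt0Pr => e e0.
have [mF [M FM]] := bF.
have bRe : bounded_measurable (fun x => complex.Re (F x)).
  by split; [exact: mF.1|exists M => x; exact: le_trans (normRe_le_cabs _) (FM x)].
have bIm : bounded_measurable (fun x => complex.Im (F x)).
  by split; [exact: mF.2|exists M => x; exact: le_trans (normIm_le_cabs _) (FM x)].
have e2 : 0 < e / 2 by rewrite divr_gt0.
have [_ /(_ _ e2)[p Ap Fp]] := approximable_trig bRe.
have [_ /(_ _ e2)[q Aq Fq]] := approximable_trig bIm.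
have bp := bounded_measurable_real_trig_poly Ap; have bq := bounded_measurable_real_trig_poly Aq.
have [s ps] := Ap; have [t qt] := Aq.
(* The approximants p and q of the real and imaginary parts are combined into p + i q, written with
   distinct frequencies. *)
have [K [c [uK KE]]] := trig_poly_collect (s ++ [seq (j.1, 'i * j.2) | j <- t]).
have pqE x : p x +i* q x = \sum_(k <- K) c k * expi k x.
  rewrite -KE /trig_poly big_cat big_map/= -/(trig_poly s x) -ps.
  rewrite (_ : \sum_(j <- t) _ = 'i * trig_poly t x); last first.
    by rewrite /trig_poly mulr_sumr; apply: eq_bigr => j _; rewrite mulrA.
  by rewrite -qt; apply: complexP => /=; ring.
have NE : N (fun x => F x - \sum_(k <- K) c k * expi k x) < e.
  rewrite [X in X < _](_ : _ = sqdist mu Q (fun x => complex.Re (F x)) p +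
    sqdist mu Q (fun x => complex.Im (F x)) q); first by lra.
  rewrite /sqdist -RintegralD//.
  - by apply: eq_Rintegral => x _; rewrite -pqE /nsq cReD cImD/=.
  - by apply: (bounded_measurable_integrable mQ Qoo); under eq_fun do rewrite expr2;
    apply: bounded_measurableM; exact: bounded_measurableB.
  - by apply: (bounded_measurable_integrable mQ Qoo); under eq_fun do rewrite expr2;
    apply: bounded_measurableM; exact: bounded_measurableB.
move: NE; rewrite sqnorm_sub_trig// sumrB => NE.
have S0 : 0 <= \sum_(k <- K) nsq (c k - fourier_coef F k).
  by apply: sumr_ge0 => k _; exact: nsq_ge0.
apply: (@le_trans _ _ ((\sum_(k <- K) nsq (fourier_coef F k))%:E + e%:E)%E).
  by rewrite -EFinD lee_fin; lra.
rewrite leeD2r//; apply: esum_ge; exists [set` K].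
  by split => //; exact: finite_seq.
rewrite fsbig_finite/=; last exact: finite_seq.
rewrite -sumEFin (perm_big (finmap.enum_fset (fset_set [set` K])))//=.
apply: uniq_perm => // k.
by apply/idP/idP; rewrite (in_fset_set (finite_seq K)) inE.
Qed.

End trigonometric_polynomials.

(** * The Plancherel identity *)

Section plancherel.
Context {R : realType} {n : nat}.
Implicit Types (f g h : 'rV[R]_n -> R[i]).
Local Notation mu := (@lebesgue_row R n).
Local Notation Q := (@cube R n).

Let mQ : measurable Q. Proof. exact: measurable_cube. Qed.
Let Qoo : (mu Q < +oo)%E. Proof. by rewrite lebesgue_cube ltry. Qed.

Lemma inverse_fourierE g x :
  inverse_fourier g x = cint mu setT (fun y => g y * expi2pi (edot x y)).
Proof. by []. Qed.

Lemma measurable_edot2 d (T : measurableType d) (u v : T -> 'rV[R]_n) :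
  measurable_fun setT u -> measurable_fun setT v ->
  measurable_fun setT (fun t => edot (u t) (v t)).
Proof.
move=> mu_ mv; rewrite /edot; apply: measurable_sum => i.
by apply: measurable_funM; apply: (measurableT_comp (@measurable_row_coord _ R n i)).
Qed.

Lemma cmeas_inverse_fourier g : cmeas g -> cmeas (inverse_fourier g).
Proof.
move=> mg.
apply: (cmeas_cint _ (f := fun z : 'rV[R]_n * 'rV[R]_n => g z.2 * expi2pi (edot z.1 z.2))).
apply: cmeasM; first exact: (cmeas_comp mg measurable_snd).
apply: cmeas_expi2pi; apply: measurable_edot2; [exact: measurable_fst|exact: measurable_snd].
Qed.

(** Bounded support, phrased as vanishing off the dilated cube L Q so that x |-> L x reduces to the
    cube. *)
Definition supported_in (L : R) h := forall x, ~ Q (L^-1 *: x) -> h x = 0.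

Lemma cint_supported h : (forall x, ~ Q x -> h x = 0) -> cint mu setT h = cint mu Q h.
Proof.
move=> h0; rewrite [RHS]cint_mkcond; apply: eq_cint => x _; rewrite indicE.
by case: (boolP (x \in Q)); rewrite ?inE ?notin_setE => Qx; rewrite ?mul1r// h0// mul0r.
Qed.

Lemma integral_supported h : (forall x, ~ Q x -> h x = 0) ->
  (\int[mu]_x (nsq (h x))%:E = \int[mu]_(x in Q) (nsq (h x))%:E)%E.
Proof.
move=> h0; rewrite [RHS]integral_mkcond; apply: eq_integral => x _; rewrite patchE.
by case: (boolP (x \in Q)); rewrite ?inE ?notin_setE => // /h0 ->; rewrite (nsq_real 0) expr0n.
Qed.

Lemma cintegrable_supported_cube h : bounded_cmeas h -> (forall x, ~ Q x -> h x = 0) ->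
  cintegrable mu setT h.
Proof.
move=> bh h0; have := (cintegrable_mkcond mu h mQ).1 (bounded_cmeas_integrable bh).
apply: eq_cintegrable => // x _; rewrite indicE.
by case: (boolP (x \in Q)); rewrite ?inE ?notin_setE => Qx; rewrite ?mul1r// h0// mul0r.
Qed.

Lemma bounded_cmeas_affine h (t : R) (s : 'rV[R]_n) : bounded_cmeas h ->
  bounded_cmeas (fun x => h (t *: x + s)).
Proof.
move=> [mh [M hM]]; split; last by exists M => x.
exact: (cmeas_comp mh (measurable_row_affine t s)).
Qed.

Lemma bounded_cmeas_scale h (t : R) : bounded_cmeas h ->
  bounded_cmeas (fun x => h (t *: x)).
Proof. by move=> /(bounded_cmeas_affine t 0); under eq_fun do rewrite addr0. Qed.

Lemma cintegrable_supported L h : 0 < L -> bounded_cmeas h -> supported_in L h ->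
  cintegrable mu setT h.
Proof.
move=> L0 bh hL.
have jL : cintegrable mu setT (fun x => h (L *: x)).
  apply: cintegrable_supported_cube; first exact: bounded_cmeas_scale.
  by move=> x Qx; apply: hL; rewrite scalerA mulVf ?gt_eqF// scale1r.
have iL0 : 0 < L^-1 by rewrite invr_gt0.
have [+ _] := cint_row_affine 0 iL0 jL; apply: eq_cintegrable => // x _.
by rewrite addr0 scalerA divff ?gt_eqF// scale1r.
Qed.

Lemma bounded_cmeas_expi2pi (s : 'rV[R]_n) : bounded_cmeas (fun x => expi2pi (edot s x)).
Proof. by split; [exact: cmeas_expi2pi_edot|exists 1 => x; rewrite cabs_expi2pi]. Qed.

(* For fixed s in the cube, the values of the transform of h at the points
   s - k are the Fourier coefficients of y |-> h(y) e(s.y). *)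
Lemma plancherel_cube h : bounded_cmeas h -> (forall x, ~ Q x -> h x = 0) ->
  (\int[mu]_x (nsq (inverse_fourier h x))%:E = \int[mu]_x (nsq (h x))%:E)%E.
Proof.
move=> bh h0; have mh := bh.1.
have mI : measurable_fun setT (fun x => (nsq (inverse_fourier h x))%:E).
  by apply/measurable_EFinP/measurable_nsq/cmeas_inverse_fourier.
rewrite ge0_integral_tiling//; last by move=> x; rewrite lee_fin nsq_ge0.
rewrite -integral_esum//; last 2 first.
- move=> k; apply: measurable_funTS; apply: (measurableT_comp mI).
  have -> : (fun x : 'rV[R]_n => x - map_mx intr k) = fun x => 1 *: x + (- map_mx intr k).
    by apply/funext => x; rewrite scale1r.
  exact: measurable_row_affine.
- by move=> k x; rewrite lee_fin nsq_ge0.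
have E s : (\esum_(k in [set: 'rV[int]_n])
    (nsq (inverse_fourier h (s - map_mx intr k)%R))%:E = \int[mu]_x (nsq (h x))%:E)%E.
  have bs := bounded_cmeasM bh (bounded_cmeas_expi2pi s).
  rewrite integral_supported//.
  transitivity (\int[mu]_(x in Q) (nsq (h x * expi2pi (edot s x)))%:E)%E; last first.
    by apply: eq_integral => x _; rewrite nsqM nsq_expi2pi mulr1.
  rewrite -cube_parseval//; apply: eq_esum => k _; congr (nsq _)%:E.
  rewrite inverse_fourierE cint_supported => [|x /h0 ->]; last by rewrite mul0r.
  apply: eq_cint => x _; rewrite -mulrA; congr (_ * _).
  by rewrite edotDl expi2piD /expi map_mxN.
under eq_integral do rewrite E.
by rewrite integral_cst// [X in (_ * X)%E]lebesgue_cube mule1.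
Qed.

(** By dilation from the cube: with hs(x) = h(L x), the transform of h at x is L^n times that of hs
    at L x. Its squared norm gains L^(2n) from the factor and loses L^n from the variable, as the
    squared norm of h is L^n times that of hs. *)
Theorem plancherel L h : 0 < L -> bounded_cmeas h -> supported_in L h ->
  (\int[mu]_x (nsq (inverse_fourier h x))%:E = \int[mu]_x (nsq (h x))%:E)%E.
Proof.
move=> L0 bh hL; pose hs x := h (L *: x).
have Ln0 : L != 0 by rewrite gt_eqF.
have bs : bounded_cmeas hs by exact: bounded_cmeas_scale.
have hs0 x : ~ Q x -> hs x = 0.
  by move=> Qx; apply: hL; rewrite scalerA mulVf// scale1r.
have IE x : inverse_fourier h x = (L ^+ n)%:C * inverse_fourier hs (L *: x).
  rewrite inverse_fourierE.
  have b1 := bounded_cmeasM bh (bounded_cmeas_expi2pi x).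
  have s1 : supported_in L (fun y => h y * expi2pi (edot x y)).
    by move=> y /hL ->; rewrite mul0r.
  have [_ ->] := cint_row_affine 0 L0 (cintegrable_supported L0 b1 s1).
  congr (_ * _); rewrite inverse_fourierE; apply: eq_cint => y _.
  by rewrite addr0 edotZr edotZl.
have mI : measurable_fun setT (fun x => (nsq (inverse_fourier hs x))%:E).
  by apply/measurable_EFinP/measurable_nsq/cmeas_inverse_fourier/bs.1.
have mh : measurable_fun setT (fun x => (nsq (h x))%:E).
  by apply/measurable_EFinP/measurable_nsq/bh.1.
have n0 x : (0 <= (nsq x)%:E :> \bar R)%E by rewrite lee_fin nsq_ge0.
rewrite [RHS](ge0_integral_row_affine 0 L0)//.
under [in RHS]eq_integral do rewrite addr0 -/(hs _).
rewrite -(plancherel_cube bs hs0).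
have -> : (\int[mu]_x (nsq (inverse_fourier hs x))%:E =
    (L ^+ n)%:E * \int[mu]_x (nsq (inverse_fourier hs (L *: x + 0)))%:E)%E.
  exact: (ge0_integral_row_affine 0 L0 mI).
rewrite muleA -EFinM.
rewrite -ge0_integralZl//; last 2 first.
- apply: (measurableT_comp mI); exact: measurable_row_affine.
- by rewrite lee_fin mulr_ge0// exprn_ge0// ltW.
apply: eq_integral => x _.
by rewrite IE nsqM nsq_real addr0 -EFinM expr2.
Qed.

End plancherel.

(** The factor 2 comes from bounding the two parts separately; this suffices for the boundedness of
    transforms. *)
Lemma cabs_cint_le {d} {T : measurableType d} {R : realType}
    (mu : {measure set T -> \bar R}) (D : set T) (f : T -> R[i]) : measurable D ->
  cmeas f -> cintegrable mu D f ->
  cabs (cint mu D f) <= 2 * \int[mu]_(x in D) cabs (f x).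
Proof.
move=> mD mf jf; have jc := integrable_cabs mD mf jf; have [f1 f2] := jf.
rewrite (le_trans (cabs_le_ReIm _))// mulr_natl mulr2n lerD//=.
  rewrite (le_trans (le_normr_Rintegral mD f1))// le_Rintegral//.
    exact: integrable_norm.
  by move=> x _; exact: normRe_le_cabs.
rewrite (le_trans (le_normr_Rintegral mD f2))// le_Rintegral//.
  exact: integrable_norm.
by move=> x _; exact: normIm_le_cabs.
Qed.

Lemma lebesgue_row_coord0 {R : realType} n :
  @lebesgue_row R n.+1 [set x | x ord0 ord0 = 0] = 0%E.
Proof.
rewrite /= /lebesgue_row_step /pushforward.
rewrite (_ : _ @^-1` _ = [set 0] `*` setT).
  by rewrite product_measure1E//= lebesgue_measure_set1 mul0e.
apply/seteqP; split => -[x v]/=.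
  have := @row_consK R n (x, v); rewrite /row_uncons => /(congr1 fst)/= -> ->.
  by [].
by move=> [-> _]; have := @row_consK R n (0, v); rewrite /row_uncons => /(congr1 fst).
Qed.

(** * The frame identity *)

Section wavelet_coefficients.
Context {R : realType} {n : nat}.
Local Notation mu := (@lebesgue_row R n).
Local Notation Q := (@cube R n).
Variable g : 'rV[R]_n -> R.
Hypotheses (bg : bounded_measurable g) (gQ : forall x, ~ Q x -> g x = 0).
Let gC (x : 'rV[R]_n) : R[i] := (g x)%:C.
Let psi := inverse_fourier gC.

Lemma bounded_cmeas_real (f : 'rV[R]_n -> R) : bounded_measurable f ->
  bounded_cmeas (fun x => (f x)%:C).
Proof.
move=> [mf [M fM]]; split; first exact: cmeas_real.
by exists M => x; rewrite cabs_real.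
Qed.

Let bgC : bounded_cmeas gC. Proof. exact: bounded_cmeas_real. Qed.
Let gC0 x : ~ Q x -> gC x = 0. Proof. by rewrite /gC => /gQ ->. Qed.

(** Boundedness is what lets [cube_parseval] be applied to the product of [g] with a dilated
    transform. *)
Lemma bounded_cmeas_inverse_fourier L h : 0 < L -> bounded_cmeas h -> supported_in L h ->
  bounded_cmeas (inverse_fourier h : 'rV[R]_n -> R[i]).
Proof.
move=> L0 bh hL; split; first exact: (cmeas_inverse_fourier bh.1).
exists (2 * \int[mu]_x cabs (h x)) => x; rewrite inverse_fourierE.
have b1 := bounded_cmeasM bh (bounded_cmeas_expi2pi x).
apply: le_trans (cabs_cint_le measurableT b1.1 _) _.
  by apply: (cintegrable_supported L0 b1) => y /hL ->; rewrite mul0r.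
by under eq_Rintegral do rewrite cabsM cabs_expi2pi mulr1.
Qed.

Definition dilation (m : int) : R := 2 `^ (m%:~R * n%:R / 2).

(** Insert the integral defining psi and exchange the integrals: (2^m x - k).y = (2^m y).x - k.y
    splits the kernel into that of the transform of h at 2^m y and the k-th exponential. As [g]
    vanishes off the cube, the outer integral is a Fourier coefficient. *)
Lemma wavelet_coef (L : R) (h : 'rV[R]_n -> R[i]) m k : 0 < L -> bounded_cmeas h ->
  supported_in L h ->
  cint mu setT (fun x => wavelet_system psi (m, k) x * h x) =
  fourier_coef (fun y => (dilation m)%:C * (gC y * inverse_fourier h (2 ^ m *: y))) k.
Proof.
move=> L0 bh hL; pose h' x := (dilation m)%:C * h x.
have bh' : bounded_cmeas h' by apply: bounded_cmeasM => //; exact: bounded_cmeas_cst.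
have hL' : supported_in L h' by move=> x /hL; rewrite /h' => ->; rewrite mulr0.
pose u (z : 'rV[R]_n * 'rV[R]_n) := expi2pi (edot (2 ^ m *: z.1 - map_mx intr k) z.2).
have mu_ : cmeas u.
  apply: cmeas_expi2pi; apply: measurable_edot2; last exact: measurable_snd.
  exact: (measurableT_comp (measurable_row_affine (2 ^ m) (- map_mx intr k)) measurable_fst).
have u1 z : cabs (u z) <= 1 by rewrite cabs_expi2pi.
have jg := cintegrable_supported_cube bgC gC0.
have jh' := cintegrable_supported L0 bh' hL'.
have := cint_fubini (cintegrable_prod bh'.1 jh' bgC.1 jg mu_ u1).
rewrite -[LHS]/(cint mu setT (fun x => cint mu setT (fun y => h' x * gC y * u (x, y)))).
rewrite -[RHS]/(cint mu setT (fun y => cint mu setT (fun x => h' x * gC y * u (x, y)))).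
have jgu x : cintegrable mu setT (fun y => gC y * u (x, y)).
  have b1 := bounded_cmeasM bgC (bounded_cmeas_expi2pi (2 ^ m *: x - map_mx intr k)).
  by apply: (cintegrable_supported_cube b1) => y /gC0 ->; rewrite mul0r.
have jhe y : cintegrable mu setT (fun x => h x * expi2pi (edot (2 ^ m *: y) x)).
  have b1 := bounded_cmeasM bh (bounded_cmeas_expi2pi (2 ^ m *: y)).
  by apply: (cintegrable_supported L0 b1) => x /hL ->; rewrite mul0r.
rewrite (_ : cint _ _ _ = cint mu setT (fun x => wavelet_system psi (m, k) x * h x)); last first.
  apply: eq_cint => x _.
  rewrite /wavelet_system/= -/(dilation m) /psi inverse_fourierE mulrAC -cintZ//;
    last exact: (jgu x).
  by apply: eq_cint => y _; rewrite -mulrA.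
move=> ->; rewrite /fourier_coef -cint_supported; last first.
  by move=> y /gC0 ->; rewrite mul0r mulr0 mul0r.
apply: eq_cint => y _; rewrite inverse_fourierE.
transitivity ((dilation m)%:C * gC y * expi (- k) y *
    cint mu setT (fun x => h x * expi2pi (edot (2 ^ m *: y) x))); last by ring.
rewrite -cintZ//.
apply: eq_cint => x _; rewrite /h' /u/= edotDl expi2piD edotZl -edotZr edotC.
by rewrite /expi map_mxN; ring.
Qed.

Lemma dilation_sqr m : dilation m ^+ 2 = (2 ^ m) ^+ n.
Proof.
rewrite /dilation -powR_mulrn ?powR_ge0// -powRrM.
rewrite divfK// powRrM powR_mulrn ?powR_ge0//; congr (_ ^+ _).
by rewrite powR_intmul.
Qed.

(** The squared normalisation 2^(mn) of the wavelets is exactly the Jacobian of y |-> 2^m y. *)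
Lemma esum_wavelet_coef (L : R) (h : 'rV[R]_n -> R[i]) m : 0 < L -> bounded_cmeas h ->
  supported_in L h ->
  (\esum_(k in [set: 'rV[int]_n])
    (nsq (cint mu setT (fun x => wavelet_system psi (m, k) x * h x)))%:E =
  \int[mu]_y ((g (2 ^ (- m) *: y)) ^+ 2 * nsq (inverse_fourier h y))%:E)%E.
Proof.
move=> L0 bh hL.
have m20 : 0 < (2 : R) ^ m by rewrite exprz_gt0.
have bH := bounded_cmeas_inverse_fourier L0 bh hL.
under eq_esum do rewrite (wavelet_coef _ _ L0 bh hL).
rewrite cube_parseval; last first.
  apply: bounded_cmeasM; first exact: bounded_cmeas_cst.
  by apply: bounded_cmeasM => //; exact: bounded_cmeas_scale.
rewrite -integral_supported; last by move=> y /gC0 ->; rewrite mul0r mulr0.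
have mg := bg.1.
have mf : measurable_fun setT (fun y :
  'rV[R]_n => ((g (2 ^ (- m) *: y)) ^+ 2 * nsq (inverse_fourier h y))%:E).
  apply/measurable_EFinP; apply: measurable_funM; last exact: measurable_nsq bH.1.
  apply: measurable_funX.
  have := measurable_row_affine (2 ^ (- m)) (0 : 'rV[R]_n).
  by under eq_fun do rewrite addr0; exact: measurableT_comp.
rewrite [RHS](ge0_integral_row_affine 0 m20 mf); last first.
  by move=> y; rewrite lee_fin mulr_ge0// ?sqr_ge0// nsq_ge0.
rewrite -ge0_integralZl//; last 3 first.
- exact: (measurableT_comp mf (measurable_row_affine _ _)).
- by move=> y _; rewrite lee_fin mulr_ge0// ?sqr_ge0// nsq_ge0.
- by rewrite lee_fin exprn_ge0// ltW.
apply: eq_integral => y _; rewrite addr0 scalerA -expfzDr// addNr expr0z scale1r.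
by rewrite -EFinM nsqM nsq_real dilation_sqr nsqM nsq_real.
Qed.

End wavelet_coefficients.

Section frame_identity.
Context {R : realType} {n : nat}.
Local Notation mu := (@lebesgue_row R n.+1).
Local Notation Q := (@cube R n.+1).
Variable g : 'rV[R]_n.+1 -> R.
Hypotheses (bg : bounded_measurable g) (gQ : forall x, ~ Q x -> g x = 0).
Hypothesis g1 : forall x, x != 0 ->
  (\esum_(m in [set: int]) (g (2 ^ (- m) *: x) ^+ 2)%:E = 1)%E.
Let psi := inverse_fourier (fun x => (g x)%:C).

Theorem frame_identity_supported (L : R) (h : 'rV[R]_n.+1 -> R[i]) :
  0 < L -> bounded_cmeas h -> supported_in L h ->
  (\esum_(j in [set: int * 'rV[int]_n.+1])
    (nsq (cint mu setT (fun x => wavelet_system psi j x * h x)))%:E =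
  \int[mu]_y (nsq (h y))%:E)%E.
Proof.
move=> L0 bh hL.
rewrite -(plancherel L0 bh hL).
have bH := bounded_cmeas_inverse_fourier L0 bh hL.
have -> : [set: int * 'rV[int]_n.+1] = [set: int] `*`` (fun=> setT) by apply/seteqP; split.
rewrite -(esum_esum (a := fun m k =>
  (nsq (cint mu setT (fun x => wavelet_system psi (m, k) x * h x)))%:E)); last first.
  by move=> *; rewrite lee_fin nsq_ge0.
under eq_esum do rewrite (esum_wavelet_coef bg gQ _ L0 bh hL).
have mg := bg.1.
have mf (m : int) : measurable_fun setT (fun y :
  'rV[R]_n.+1 => ((g (2 ^ (- m) *: y)) ^+ 2 * nsq (inverse_fourier h y))%:E).
  apply/measurable_EFinP; apply: measurable_funM; last exact: measurable_nsq bH.1.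
  apply: measurable_funX.
  have := measurable_row_affine (2 ^ (- m)) (0 : 'rV[R]_n.+1).
  by under eq_fun do rewrite addr0; exact: measurableT_comp.
rewrite -integral_esum//; last first.
  by move=> m y; rewrite lee_fin mulr_ge0// ?sqr_ge0// nsq_ge0.
apply: ae_eq_integral => //.
- apply: measurable_esum => // m y.
  by rewrite lee_fin mulr_ge0// ?sqr_ge0// nsq_ge0.
- by apply/measurable_EFinP/measurable_nsq/bH.1.
(* The hypothesis [g1] excludes the origin, which is covered by a null hyperplane. The dimension is
   positive here; in dimension 0 the origin has mass 1. *)
exists [set x : 'rV[R]_n.+1 | x ord0 ord0 = 0]; split.
- rewrite (_ : [set _ | _] = (fun x : 'rV[R]_n.+1 => x ord0 ord0) @^-1` [set 0])//.
  rewrite -[X in measurable X]setTI.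
  exact: (@measurable_row_coord _ R n.+1 ord0 measurableT _ (measurable_set1 _)).
- exact: lebesgue_row_coord0.
move=> x /= h0; apply: contrapT => x0; apply: h0 => _.
have xn0 : x != 0 by apply/eqP => x1; apply: x0; rewrite x1 mxE.
under eq_esum do rewrite mulrC EFinM.
rewrite ge0_esumZl ?nsq_ge0//; last by move=> m; rewrite lee_fin sqr_ge0.
by rewrite g1// mule1.
Qed.
End frame_identity.

(** * Extension to square-integrable functions *)

Section square_integrable.
Context {R : realType} {n : nat}.
Local Notation mu := (@lebesgue_row R n).
Implicit Types (f g h : 'rV[R]_n -> R[i]).

Definition sq_integrable f := cmeas f /\
  mu.-integrable setT (fun x => (nsq (f x))%:E).

Let Lfun2P (u : 'rV[R]_n -> R) : u \in Lfun mu 2%:E <->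
  measurable_fun setT u /\ mu.-integrable setT (fun x => (u x ^+ 2)%:E).
Proof.
split=> [lu|[mu_ ju]].
  split; last exact: Lfun2_integrable_sqr.
  by move: lu; rewrite inE => /andP[]; rewrite inE.
rewrite inE; apply/andP; split; rewrite inE//=.
rewrite /finite_norm unlock poweR_lty//.
have /integrableP[_] := ju; apply: le_lt_trans; rewrite le_eqVlt; apply/orP; left; apply/eqP.
apply: eq_integral => x _ /=; rewrite powR_mulrn// real_normK ?num_real//.
by rewrite ger0_norm// sqr_ge0.
Qed.

Lemma L2P f : L2 f <-> sq_integrable f.
Proof.
split=> [[/Lfun2P[m1 j1] /Lfun2P[m2 j2]]|[[m1 m2] j]].
  split => //; have := integrableD measurableT j1 j2.
  by apply: eq_integrable => // x _; rewrite /nsq EFinD.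
split; apply/Lfun2P; split=> //; apply: le_integrable j => //.
- exact/measurable_EFinP/measurable_funX.
- by move=> x _ /=; rewrite lee_fin !ger0_norm ?sqr_ge0 ?nsq_ge0// lerDl sqr_ge0.
- exact/measurable_EFinP/measurable_funX.
- by move=> x _ /=; rewrite lee_fin !ger0_norm ?sqr_ge0 ?nsq_ge0// lerDr sqr_ge0.
Qed.

Lemma integrable_mul_cabs f g : sq_integrable f -> sq_integrable g ->
  mu.-integrable setT (fun x => (cabs (f x) * cabs (g x))%:E).
Proof.
move=> [mf jf] [mg jg]; have j := integrableD measurableT jf jg.
apply: le_integrable j => //.
  by apply/measurable_EFinP; apply: measurable_funM; exact: measurable_cabs.
move=> x _ /=; rewrite lee_fin [leLHS]ger0_norm; last by rewrite mulr_ge0 ?cabs_ge0.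
rewrite [leRHS]ger0_norm; last by apply: addr_ge0; exact: nsq_ge0.
rewrite -!sqr_cabs; have := cabs_ge0 (f x); have := cabs_ge0 (g x).
by have := sqr_ge0 (cabs (f x) - cabs (g x)); nra.
Qed.

Lemma cintegrable_mul f g : sq_integrable f -> sq_integrable g ->
  cintegrable mu setT (fun x => f x * g x).
Proof.
move=> sf sg; apply: (cintegrable_dom measurableT _ (integrable_mul_cabs sf sg)).
  exact: cmeasM sf.1 sg.1.
by move=> x _; rewrite cabsM.
Qed.

Lemma sq_integrable_conj f : sq_integrable f -> sq_integrable (fun x => (f x)^*).
Proof.
move=> [mf jf]; split; first exact: cmeas_conj.
by under eq_fun do rewrite nsq_conj.
Qed.

Lemma sq_integrable_le f g : cmeas g -> (forall x, nsq (g x) <= nsq (f x)) ->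
  sq_integrable f -> sq_integrable g.
Proof.
move=> mg gf [mf jf]; split=> //; apply: le_integrable jf => //.
  exact/measurable_EFinP/measurable_nsq.
by move=> x _ /=; rewrite lee_fin !ger0_norm ?nsq_ge0.
Qed.

Lemma sq_integrableZ c f : sq_integrable f -> sq_integrable (fun x => c * f x).
Proof.
move=> [mf jf]; split; first exact: cmeasZ.
by under eq_fun do rewrite nsqM EFinM; exact: integrableZl.
Qed.

Lemma sq_integrable_affine f (t : R) (s : 'rV[R]_n) : 0 < t ->
  sq_integrable f -> sq_integrable (fun x => f (t *: x + s)).
Proof.
move=> t0 [mf jf]; split; first exact: (cmeas_comp mf (measurable_row_affine t s)).
exact: (integral_row_affine s t0 jf).1.
Qed.

Lemma sq_integrable_supported (L : R) h : 0 < L -> bounded_cmeas h ->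
  supported_in L h -> sq_integrable h.
Proof.
move=> L0 bh hL; split; first exact: bh.1.
have bc : bounded_cmeas (fun x => (h x)^*).
  by case: bh => mh [M hM]; split; [exact: cmeas_conj|exists M => x; rewrite cabs_conj].
have hhL : supported_in L (fun x => h x * (h x)^*) by move=> x /hL ->; rewrite mul0r.
have [+ _] := cintegrable_supported L0 (bounded_cmeasM bh bc) hhL.
by apply: eq_integrable => // x _; rewrite mulc_conj.
Qed.

(** Plancherel supplies the finiteness; this is how psi is seen to be in L^2. *)
Lemma sq_integrable_inverse_fourier (L : R) h : 0 < L -> bounded_cmeas h ->
  supported_in L h -> sq_integrable (inverse_fourier h).
Proof.
move=> L0 bh hL; have mI := cmeas_inverse_fourier bh.1; split => //.
have [_ /integrableP[_]] := sq_integrable_supported L0 bh hL.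
under eq_integral do rewrite gee0_abs ?lee_fin ?nsq_ge0//.
rewrite -(plancherel L0 bh hL) => I_fin; apply/integrableP; split.
  exact/measurable_EFinP/measurable_nsq.
by under eq_integral do rewrite gee0_abs ?lee_fin ?nsq_ge0//.
Qed.

Definition sqnorm f : R := \int[mu]_x nsq (f x).

Lemma sqnormE f : sq_integrable f -> (\int[mu]_x (nsq (f x))%:E)%E = (sqnorm f)%:E.
Proof. by move=> [_ jf]; rewrite /sqnorm /Rintegral fineK// integrable_fin_num. Qed.

(** Cuts off in value and in space at once. The scale [M.+1] keeps the dilation invertible at M =
    0. *)
Definition truncation f (M : nat) x : R[i] :=
  if `[< cabs (f x) <= M%:R /\ cube n (M.+1%:R^-1 *: x) >] then f x else 0.

Let trunc_set f (M : nat) : set 'rV[R]_n :=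
  [set x | cabs (f x) <= M%:R] `&` (fun x => M.+1%:R^-1 *: x) @^-1` cube n.

Let truncationE f M x : truncation f M x = (\1_(trunc_set f M) x)%:C * f x.
Proof.
rewrite /truncation indicE; case: asboolP => h; first by rewrite mem_set// mul1r.
by rewrite memNset// mul0r.
Qed.

Lemma cmeas_truncation f M : cmeas f -> cmeas (truncation f M).
Proof.
move=> mf; rewrite (funext (truncationE f M)); apply: cmeasM => //.
apply/cmeas_real/measurable_indic/measurableI.
  rewrite (_ : [set _ | _] = (fun x => cabs (f x)) @^-1` `]-oo, M%:R]).
    by rewrite -[X in measurable X]setTI; apply: (measurable_cabs mf).
  by apply/seteqP; split => x /=; rewrite in_itv.
rewrite -[X in measurable X]setTI.
have := measurable_row_affine (M.+1%:R^-1) (0 : 'rV[R]_n).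
by under eq_fun do rewrite addr0; apply=> //; exact: measurable_cube.
Qed.

Lemma bounded_truncation f M : cmeas f -> bounded_cmeas (truncation f M).
Proof.
move=> mf; split; first exact: cmeas_truncation.
exists M%:R => x; rewrite /truncation; case: asboolP => [[]//|_].
by rewrite ComplexField.Normc.normc0.
Qed.

Lemma truncation_supported f M : supported_in M.+1%:R (truncation f M).
Proof. by move=> x Qx; rewrite /truncation; case: asboolP => // -[]. Qed.

Lemma nsq_truncation_le f M x : nsq (truncation f M x) <= nsq (f x).
Proof.
by rewrite /truncation; case: ifP => // _; rewrite (nsq_real 0) expr0n nsq_ge0.
Qed.

Lemma nsq_sub_truncation_le f M x : nsq (f x - truncation f M x) <= nsq (f x).
Proof.
rewrite /truncation; case: ifP => // _; rewrite ?subr0// subrr.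
by rewrite (nsq_real 0) expr0n nsq_ge0.
Qed.

(** At each point one of the two summands is 0, so squared norms add exactly. *)
Lemma nsq_truncation_split f M x :
  nsq (f x) = nsq (truncation f M x) + nsq (f x - truncation f M x).
Proof.
by rewrite /truncation; case: ifP => // _;
  rewrite ?subr0 ?subrr (nsq_real 0) expr0n/= ?addr0 ?add0r.
Qed.

Lemma truncation_near f x : \forall M \near \oo, truncation f M x = f x.
Proof.
(* Dominates both |f(x)| and every 2 |x_i|; the 2 accounts for the half-side 1/2 of the cube. *)
pose K := cabs (f x) + \sum_(i < n) 2 * `|x ord0 i| .
exists (Num.truncn K).+1 => // M /= KM.
have KM' : K < M%:R.
  by rewrite (lt_le_trans (truncnS_gt K))// ler_nat.
have s0 : 0 <= \sum_(i < n) 2 * `|x ord0 i| by apply: sumr_ge0 => i _; rewrite mulr_ge0.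
rewrite /truncation asboolT//; split.
  by rewrite (le_trans _ (ltW KM'))// lerDl.
move=> i; rewrite mxE.
have xi : 2 * `|x ord0 i| <= K.
  rewrite /K (bigD1 i)//= addrCA lerDl addr_ge0 ?cabs_ge0//.
  by apply: sumr_ge0 => j _; rewrite mulr_ge0.
have M1 : M%:R < M.+1%:R :> R by rewrite ltr_nat.
have M0 : 0 < M.+1%:R :> R by rewrite ltr0n.
rewrite [M.+1%:R^-1 * _]mulrC ltr_pdivlMr// ler_pdivrMr//.
by have := ler_norm (x ord0 i); have := ler_norm (- x ord0 i); rewrite normrN; lra.
Qed.

Lemma truncation_sqnorm_cvg f : sq_integrable f ->
  sqnorm (fun x => f x - truncation f M x) @[M --> \oo] --> 0.
Proof.
move=> sf; have [mf jf] := sf.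
have mt M := cmeasB mf (cmeas_truncation M mf).
have cvg0 : {ae mu, forall x, setT x ->
  (nsq (f x - truncation f M x))%:E @[M --> \oo] --> (0%E : \bar R)}.
  apply: aeW => x _; apply: cvg_near_cst.
  by apply: filterS (truncation_near f x) => M ->; rewrite subrr (nsq_real 0) expr0n.
have dom : {ae mu, forall x M, setT x ->
    (`|(nsq (f x - truncation f M x))%:E| <= (nsq (f x))%:E)%E}.
  by apply: aeW => x M _; rewrite gee0_abs ?lee_fin ?nsq_ge0 ?nsq_sub_truncation_le.
have [_ _] := @dominated_convergence _ _ _ mu setT measurableT
   (fun M x => (nsq (f x - truncation f M x))%:E) (fun=> 0%E) (fun x => (nsq (f x))%:E)
   (fun M => iffRL (measurable_EFinP _ _) (measurable_nsq (mt M))) (measurable_cst _)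
   cvg0 jf dom.
by rewrite integral0 => intF; exact: fine_cvg.
Qed.

Lemma cint_mul_truncation_cvg e f : sq_integrable e -> sq_integrable f ->
  nsq (cint mu setT (fun x => e x * truncation f M x)) @[M --> \oo] -->
  nsq (cint mu setT (fun x => e x * f x)).
Proof.
move=> se sf; have [mf jf] := sf; have [me _] := se.
have jef := integrable_mul_cabs se sf.
(* Dominated convergence with bound |e| |f|, to be used with [u] the real and the imaginary part. *)
have H (u : R[i] -> R) : measurable_fun setT (fun x => u (e x * f x)) ->
    (forall M, measurable_fun setT (fun x => u (e x * truncation f M x))) ->
    (forall z, `|u z| <= cabs z) ->
    \int[mu]_x u (e x * truncation f M x) @[M --> \oo] --> \int[mu]_x u (e x * f x).
  move=> mu1 mu2 uz; apply: fine_cvg; rewrite fineK; last first.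
    apply: integrable_fin_num => //; apply: le_integrable jef => //.
      exact/measurable_EFinP.
    by move=> x _ /=; rewrite lee_fin (le_trans (uz _))// cabsM ler_norm.
  have cvg1 : {ae mu, forall x, setT x -> (u (e x * truncation f M x))%:E @[M --> \oo] -->
      (u (e x * f x))%:E}.
    apply: aeW => x _; apply: cvg_near_cst.
    by apply: filterS (truncation_near f x) => M ->.
  have dom : {ae mu, forall x M, setT x ->
      (`|(u (e x * truncation f M x))%:E| <= (cabs (e x) * cabs (f x))%:E)%E}.
    apply: aeW => x M _; rewrite /= lee_fin (le_trans (uz _))// cabsM ler_wpM2l ?cabs_ge0//.
    rewrite /truncation; case: ifP => // _.
    by rewrite ComplexField.Normc.normc0 cabs_ge0.
  by have [_ _] := @dominated_convergence _ _ _ mu setT measurableT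
     (fun M x => (u (e x * truncation f M x))%:E) (fun x => (u (e x * f x))%:E) _
     (fun M => iffRL (measurable_EFinP _ _) (mu2 M)) (iffRL (measurable_EFinP _ _) mu1)
     cvg1 jef dom.
have mt M := cmeasM me (cmeas_truncation M mf).
have mef := cmeasM me mf.
have cRe := H (@complex.Re R) mef.1 (fun M => (mt M).1) (@normRe_le_cabs R).
have cIm := H (@complex.Im R) mef.2 (fun M => (mt M).2) (@normIm_le_cabs R).
rewrite /nsq/=; apply: cvgD; [exact: (cvgM cRe cRe)|exact: (cvgM cIm cIm)].
Qed.

End square_integrable.

(** In each real component, the right side minus the left side is the square (eps x - y)^2 / eps.
    Summed over an index, this stands in for Minkowski's inequality in l^2. *)
Lemma nsqD_weighted {R : realType} (eps : R) (z w : R[i]) : 0 < eps ->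
  nsq (z + w) <= (1 + eps) * nsq z + (1 + eps^-1) * nsq w.
Proof.
case: z w => a b [c d] e0; rewrite /nsq/=.
have H (x y : R) : (x + y) ^+ 2 <= (1 + eps) * x ^+ 2 + (1 + eps^-1) * y ^+ 2.
  have -> : (1 + eps) * x ^+ 2 + (1 + eps^-1) * y ^+ 2 =
      (x + y) ^+ 2 + eps^-1 * (eps * x - y) ^+ 2.
    by field; rewrite gt_eqF.
  by rewrite lerDl mulr_ge0 ?sqr_ge0// invr_ge0 ltW.
have := H a c; have := H b d; lra.
Qed.

Section parseval_extension.
Context {R : realType} {n : nat} {J : countType}.
Local Notation mu := (@lebesgue_row R n).
Implicit Types f h : 'rV[R]_n -> R[i].
Variable e : J -> 'rV[R]_n -> R[i].
Hypothesis e_sq : forall j, sq_integrable (e j).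
Let coef h j := nsq (cint mu setT (fun x => e j x * h x)).
Let energy h := (\esum_(j in [set: J]) (coef h j)%:E)%E.
Hypothesis e_parseval : forall (L : R) h, 0 < L -> bounded_cmeas h -> supported_in L h ->
  energy h = (\int[mu]_x (nsq (h x))%:E)%E.

Let sq_truncation f M : sq_integrable f -> sq_integrable (truncation f M).
Proof.
move=> sf; apply: (sq_integrable_le _ _ sf); first exact: cmeas_truncation sf.1.
exact: nsq_truncation_le.
Qed.

Let sq_sub_truncation f M : sq_integrable f -> sq_integrable (fun x => f x - truncation f M x).
Proof.
move=> sf; apply: (sq_integrable_le _ _ sf); first exact: cmeasB sf.1 (cmeas_truncation M sf.1).
exact: nsq_sub_truncation_le.
Qed.

Let energy_truncation f M : sq_integrable f ->
  energy (truncation f M) = (sqnorm (truncation f M))%:E.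
Proof.
move=> sf; rewrite -sqnormE; last exact: sq_truncation.
apply: (e_parseval (L := M.+1%:R)) => //.
- exact: bounded_truncation sf.1.
- exact: truncation_supported.
Qed.

(** For a finite set of indices, the coefficients of the truncations converge to those of f, while
    their squares sum to at most the norm of the truncation. *)
Lemma bessel f : sq_integrable f -> (energy f <= (sqnorm f)%:E)%E.
Proof.
move=> sf; apply: ge_ereal_sup => _ [X [finX _] <-].
rewrite fsbig_finite//= sumEFin lee_fin.
have cv : \sum_(j <- finmap.enum_fset (fset_set X)) coef (truncation f M) j @[M --> \oo] -->
    \sum_(j <- finmap.enum_fset (fset_set X)) coef f j.
  elim: (finmap.enum_fset _) => [|j s IH].
    by under eq_cvg do rewrite big_nil; rewrite big_nil; exact: cvg_cst.
  under eq_cvg do rewrite big_cons; rewrite big_cons; apply: cvgD => //.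
  exact: cint_mul_truncation_cvg.
rewrite -(cvg_lim _ cv)//; apply: limr_le; first exact: cvgP cv.
apply: nearW => M.
apply: (@le_trans _ _ (sqnorm (truncation f M))).
  rewrite -lee_fin -energy_truncation// -sumEFin.
  by apply: esum_ge; exists X => //; rewrite fsbig_finite.
apply: le_Rintegral => //; [exact: (sq_truncation M sf).2|exact: sf.2|].
by move=> x _; exact: nsq_truncation_le.
Qed.

Theorem parseval_sq_integrable f : sq_integrable f -> energy f = (sqnorm f)%:E.
Proof.
move=> sf; apply/eqP; rewrite eq_le bessel//=.
have e0 h : (0 <= energy h)%E by apply: esum_ge0 => j _; rewrite lee_fin nsq_ge0.
have Ef : energy f = (fine (energy f))%:E.
  by rewrite fineK// ge0_fin_numE// (le_lt_trans (bessel sf))// ltry.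
set r := fine _ in Ef; rewrite Ef lee_fin.
have r0 : 0 <= r by rewrite /r fine_ge0.
(* Apply the weighted inequality to truncation = f - remainder and bound the energy of the remainder
   by [bessel]. The extra 1 in c + 1 is the remainder's share of the norm of f; it all vanishes as M
   grows. *)
have main eps : 0 < eps -> sqnorm f <= (1 + eps) * r.
  move=> eps0; set c := 1 + eps^-1.
  have c0 : 0 < c by rewrite ltr_wpDr// invr_ge0 ltW.
  pose D M := sqnorm (fun x => f x - truncation f M x).
  have ineq M : sqnorm f <= (1 + eps) * r + (c + 1) * D M.
    have sM := sq_truncation M sf; have sD := sq_sub_truncation M sf.
    have split : sqnorm f = sqnorm (truncation f M) + D M.
      rewrite /D /sqnorm -RintegralD//; [|exact: sM.2|exact: sD.2].
      by apply: eq_Rintegral => x _; exact: nsq_truncation_split.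
    rewrite split [(c + 1) * _]mulrDl mul1r addrA lerD2r -lee_fin -energy_truncation//.
    pose fM x := f x - truncation f M x.
    apply: (@le_trans _ _ ((1 + eps)%:E * energy f + c%:E * energy fM)%E).
      have p1 : 0 <= 1 + eps by rewrite addr_ge0// ltW.
      have p2 := ltW c0.
      have n0 h j : (0 <= (coef h j)%:E)%E by rewrite lee_fin nsq_ge0.
      rewrite -!ge0_esumZl// -esumD; try by move=> j _; rewrite mule_ge0.
      apply: le_esum => j _; rewrite -!EFinM -EFinD lee_fin /coef.
      have -> : cint mu setT (fun x => e j x * truncation f M x) =
          cint mu setT (fun x => e j x * f x) +
          - cint mu setT (fun x => e j x * (f x - truncation f M x)).
        rewrite -cintB//; [|exact: cintegrable_mul|exact: cintegrable_mul].
        by apply: eq_cint => x _; ring.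
      rewrite (le_trans (nsqD_weighted _ _ eps0))// lerD2l ler_wpM2l//.
      have nsqN (z : R[i]) : nsq (- z) = nsq z by case: z => u v; rewrite /nsq/= !sqrrN.
      by rewrite nsqN.
    rewrite Ef [leRHS]EFinD !EFinM leeD2l// lee_pmul2l ?lte_fin// bessel//.
  have cv : (1 + eps) * r + (c + 1) * D M @[M --> \oo] --> (1 + eps) * r + (c + 1) * 0.
    apply: cvgD; first exact: cvg_cst.
    by apply: cvgMr; exact: truncation_sqnorm_cvg.
  rewrite mulr0 addr0 in cv; rewrite -(cvg_lim _ cv)//.
  by apply: limr_ge; [exact: cvgP cv|exact: nearW].
apply/ler_addgt0Pr => eps eps0.
have r1 : 0 < r + 1 by rewrite ltr_wpDl.
(* With this weight the excess eps r / (r + 1) is at most eps; r + 1 is positive even if r = 0. *)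
have := main (eps / (r + 1)) (divr_gt0 eps0 r1).
rewrite mulrDl mul1r => /le_trans; apply; rewrite lerD2l mulrAC ler_pdivrMr//.
by rewrite ler_wpM2l ?ltW// ltrDl.
Qed.

End parseval_extension.

(** A directional derivative depends only on the restriction to a line, so one-variable calculus,
    including the chain rule, applies to partial derivatives. *)
Lemma is_derive_lineP {R : realType} {V : normedModType R} (f : V -> R) x v df :
  is_derive x v f df <-> is_derive (0 : R) 1 (fun h : R => f (h *: v + x)) df.
Proof.
have DE : 'D_v f x = 'D_1 (fun h : R => f (h *: v + x)) 0.
  rewrite /derive; set g1 := fun h => h^-1 *: _; set g2 := fun h => h^-1 *: _.
  suff -> : g1 = g2 by [].
  by apply/funext => h; rewrite /g1 /g2/= addr0 scale0r add0r [_%:A]mulr1.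
split=> -[d1 d2].
  by apply: DeriveDef; [exact: (derivable1P _ _ _).1|rewrite -DE].
by apply: DeriveDef; [exact: (derivable1P _ _ _).2|rewrite DE].
Qed.

Lemma is_derive_comp1 {R : realType} {V : normedModType R} (f : V -> R) (g : R -> R) x v df dg :
  is_derive x v f df -> is_derive (f x) 1 g dg -> is_derive x v (g \o f) (dg * df).
Proof.
move=> /is_derive_lineP Df Dg; apply/is_derive_lineP.
apply: (is_derive1_comp (f := g) (g := fun h : R => f (h *: v + x))) => //.
by rewrite scale0r add0r.
Qed.

(** * Smoothness of radial functions *)

Section radial_functions.
Context {R : realType} {n : nat}.
Local Notation V := 'rV[R]_n.+1.
Implicit Types (x : V) (i : 'I_n.+1).

Lemma enorm_ge0 x : 0 <= enorm x. Proof. exact: sqrtr_ge0. Qed.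

Lemma edot_ge0 x : 0 <= edot x x.
Proof. by apply: sumr_ge0 => i _; rewrite -expr2 sqr_ge0. Qed.

Lemma sqr_coord_le x i : x ord0 i ^+ 2 <= edot x x.
Proof.
rewrite /edot (bigD1 i)//= -expr2 lerDl; apply: sumr_ge0 => j _.
by rewrite -expr2 sqr_ge0.
Qed.

Lemma coord_le_enorm x i : `|x ord0 i| <= enorm x.
Proof. by rewrite /enorm -sqrtr_sqr ler_wsqrtr// sqr_coord_le. Qed.

Lemma edot_gt0 x : x != 0 -> 0 < edot x x.
Proof.
move=> x0; rewrite lt_neqAle edot_ge0 andbT eq_sym; apply: contra_neq x0 => e0.
apply/rowP => i; rewrite mxE; apply/eqP.
by rewrite -sqrf_eq0 eq_le sqr_ge0 -e0 sqr_coord_le.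
Qed.

Lemma enorm_gt0 x : x != 0 -> 0 < enorm x.
Proof. by move=> /edot_gt0; rewrite sqrtr_gt0. Qed.

Lemma enormZ (t : R) x : 0 <= t -> enorm (t *: x) = t * enorm x.
Proof.
by move=> t0; rewrite /enorm edotZl edotZr mulrA -expr2 sqrtrM ?sqr_ge0// sqrtr_sqr ger0_norm.
Qed.

Lemma differentiable_edot x : differentiable (fun y : V => edot y y : R) x.
Proof.
rewrite (_ : (fun y : V => _) = \sum_(i < n.+1) (fun y : V => y ord0 i * y ord0 i)); last first.
  by apply/funext => y; rewrite /edot fct_sumE.
apply: differentiable_sum => i.
apply: (differentiableM (f := fun y : V => y ord0 i) (g := fun y : V => y ord0 i));
  exact: differentiable_coord.
Qed.

Lemma continuous_enorm : continuous (enorm : V -> R).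
Proof.
move=> x; apply: (@continuous_comp _ _ _ (fun y : V => edot y y) (@Num.sqrt R)).
  exact/differentiable_continuous/differentiable_edot.
exact: sqrt_continuous.
Qed.

Lemma differentiable_enorm x : x != 0 -> differentiable (enorm : V -> R) x.
Proof.
move=> x0; apply: (@differentiable_comp _ _ _ _ (fun y : V => edot y y) (@Num.sqrt R)).
  exact: differentiable_edot.
by apply/derivable1_diffP; have [] := is_derive1_sqrt (edot_gt0 x0).
Qed.

Lemma is_derive_enorm x i : x != 0 ->
  is_derive x (delta_mx ord0 i : V) (enorm : V -> R) (x ord0 i * (enorm x)^-1).
Proof.
move=> x0; have e0 := edot_gt0 x0.
rewrite (_ : _ * _^-1 = (2 * Num.sqrt (edot x x))^-1 * (2 * x ord0 i)); last first.
  by rewrite /enorm; field; rewrite gt_eqF// sqrtr_gt0.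
apply: (is_derive_comp1 (f := fun y : V => edot y y) (g := @Num.sqrt R));
  last exact: is_derive1_sqrt.
apply/is_derive_lineP.
(* Along a coordinate line the squared norm is a quadratic polynomial in h. *)
have E (h : R) : edot (h *: delta_mx ord0 i + x) (h *: (delta_mx ord0 i : V) + x) =
    h * (2 * x ord0 i) + h ^+ 2 + edot x x.
  have d1 y : edot (delta_mx ord0 i : V) y = y ord0 i.
    rewrite /edot (bigD1 i)//= big1 ?addr0 => [|j ji]; rewrite !mxE eqxx/=.
      by rewrite eqxx mul1r.
    by rewrite (negbTE ji) mul0r.
  rewrite edotDl !edotDr !edotZl !edotZr [edot x (delta_mx _ _)]edotC !d1 !mxE !eqxx/=; ring.
rewrite (funext E); apply: is_derive_eq; rewrite /GRing.scale/=; ring.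
Qed.

Variable theta : R -> R.
Hypothesis theta_smooth : forall (k : nat) (y : R), derivable (derive1n k theta) y 1.

Let is_derive_theta (k : nat) (y : R) : is_derive y 1 (derive1n k theta) (derive1n k.+1 theta y).
Proof. by apply: DeriveDef => //; rewrite derive1nS derive1E. Qed.

Let is_derive_cut k (p q r : R) :
  is_derive r 1 (fun r => derive1n k theta (p * r + q)) (derive1n k.+1 theta (p * r + q) * p).
Proof.
apply: (is_derive1_comp (f := derive1n k theta) (g := fun r => p * r + q)).
  exact: is_derive_theta.
by apply: is_derive_eq; rewrite /GRing.scale/=; ring.
Qed.

(* At 0, where Rocq's inverse gives 1 / |0| = 0, these functions are not smooth;
   this is harmless because annular functions vanish near 0. *)
Inductive radial : (V -> R) -> Prop :=
| radial_cst c : radial (fun=> c)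
| radial_coord i : radial (fun x => x ord0 i)
| radial_inv : radial (fun x => (enorm x)^-1)
| radial_cut k p q : radial (fun x => derive1n k theta (p * enorm x + q))
| radialD u w : radial u -> radial w -> radial (fun x => u x + w x)
| radialM u w : radial u -> radial w -> radial (fun x => u x * w x).

Lemma differentiable_radial u x : radial u -> x != 0 -> differentiable u x.
Proof.
move=> ru x0; elim: u / ru => [c|i||k p q|u w _ IHu _ IHw|u w _ IHu _ IHw].
- exact: differentiable_cst.
- exact: differentiable_coord.
- apply: (differentiableV (f := enorm)); first exact: differentiable_enorm.
  by rewrite gt_eqF// enorm_gt0.
- apply: (@differentiable_comp _ _ _ _ enorm (fun r => derive1n k theta (p * r + q))).
    exact: differentiable_enorm.
  by apply/derivable1_diffP; case: (is_derive_cut k p q (enorm x)).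
- exact: (differentiableD IHu IHw).
- exact: (differentiableM IHu IHw).
Qed.

Lemma radial_partial u i : radial u ->
  exists2 u', radial u' & forall x, x != 0 -> is_derive x (delta_mx ord0 i : V) u (u' x).
Proof.
move=> ru; elim: u / ru => [c|j||k p q|u w ru [u' ru' Du] rw [w' rw' Dw]|u w ru [u' ru' Du] rw [w' rw' Dw]].
- by exists (fun=> 0); [exact: radial_cst|move=> x _; exact: is_derive_cst].
- exists (fun=> (delta_mx ord0 i : V) ord0 j); first exact: radial_cst.
  move=> x _; apply/is_derive_lineP.
  under eq_fun do rewrite !mxE; apply: is_derive_eq; rewrite /GRing.scale/= mxE; ring.
- exists (fun x => (- 1) * ((enorm x)^-1 * (enorm x)^-1) * (x ord0 i * (enorm x)^-1)).
    by do !apply: radialM; (exact: radial_cst || exact: radial_inv || exact: radial_coord).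
  move=> x x0; have e0 := enorm_gt0 x0.
  apply: (is_derive_comp1 (f := enorm) (g := fun y => y^-1)); first exact: is_derive_enorm.
  have H := is_deriveV (f := id) (lt0r_neq0 e0) (is_derive_id (enorm x) (1 : R)).
  by apply: is_derive_eq; rewrite /GRing.scale/= mulr1 mulN1r -invfM -expr2.
- exists (fun x => (derive1n k.+1 theta (p * enorm x + q) * p) * (x ord0 i * (enorm x)^-1)).
    by do !apply: radialM; (exact: radial_cst || exact: radial_inv ||
      exact: radial_coord || exact: radial_cut).
  move=> x x0.
  by apply: (is_derive_comp1 (f := enorm) (g := fun r => derive1n k theta (p * r + q)));
    first exact: is_derive_enorm.
- exists (fun x => u' x + w' x); first exact: radialD.
  by move=> x x0; exact: (is_deriveD (Du x x0) (Dw x x0)).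
- exists (fun x => u x * w' x + w x * u' x); first by apply: radialD; exact: radialM.
  by move=> x x0; exact: (is_deriveM (Du x x0) (Dw x x0)).
Qed.

(** By structural induction; compactness of [r1, r2] enters only for the derivatives of theta,
    through the extreme value theorem in the variable r = |x|. *)
Lemma radial_bounded u r1 r2 : radial u -> 0 < r1 -> exists C, forall x,
  r1 <= enorm x <= r2 -> `|u x| <= C.
Proof.
move=> ru r10; elim: u / ru => [c|j||k p q|u w ru [A uA] rw [B wB]|u w ru [A uA] rw [B wB]].
- by exists `|c|.
- by exists r2 => x /andP[_ xr]; exact: le_trans (coord_le_enorm x j) xr.
- exists r1^-1 => x /andP[xr _]; rewrite ger0_norm ?invr_ge0 ?enorm_ge0//.
  by rewrite lef_pV2 ?posrE// (lt_le_trans r10).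
- have [r12|r21] := leP r1 r2; last by exists 0 => x; lra.
  pose f r := `|derive1n k theta (p * r + q)|.
  have cf : {within `[r1, r2], continuous f}.
    apply: continuous_subspaceT => r;
      apply: (@continuous_comp _ _ _ (fun r => derive1n k theta (p * r + q)) Num.norm);
        last exact: norm_continuous.
    by apply/differentiable_continuous/derivable1_diffP; case: (is_derive_cut k p q r).
  have [c _ fc] := EVT_max r12 cf.
  by exists (f c) => x xr; apply: (fc (enorm x)); rewrite in_itv.
- by exists (A + B) => x xr; rewrite (le_trans (ler_normD _ _))// lerD ?uA ?wB.
- by exists (A * B) => x xr; rewrite normrM ler_pM ?uA ?wB.
Qed.

Variables (r1 r2 : R).
Hypothesis r10 : 0 < r1.

(** The complement of the closed annulus and the complement of the origin are open and cover the
    space: near each point the function is either 0 or radial. Hence the class is stable under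
    partial derivatives, although radial functions may be singular at 0. *)
Definition annular (w : V -> R) :=
  (forall x, ~~ (r1 <= enorm x <= r2) -> w x = 0) /\
  exists2 u, radial u & forall x, x != 0 -> w x = u x.

Let enorm0 : enorm (0 : V) = 0.
Proof. by rewrite -(scale0r (0 : V)) enormZ// mul0r. Qed.

Let near_outside w x : annular w -> ~~ (r1 <= enorm x <= r2) ->
  \forall y \near x, 0 = w y.
Proof.
move=> [w0 _]; rewrite negb_and -!ltNge => /orP[xr|xr].
  have : \forall y \near x, enorm y < r1 by apply: (cvgr_lt _ (@continuous_enorm x) _ xr).
  by apply: filterS => y yr; rewrite w0// negb_and -!ltNge yr.
have : \forall y \near x, r2 < enorm y by apply: (cvgr_gt _ (@continuous_enorm x) _ xr).
by apply: filterS => y yr; rewrite w0// negb_and -!ltNge yr orbT.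
Qed.

Let near_inside (w u : V -> R) x : (forall y : V, y != 0 -> w y = u y) -> x != 0 ->
  \forall y \near x, u y = w y.
Proof.
move=> wu x0; have : \forall y \near x, 0 < enorm y by apply: (cvgr_gt _
  (@continuous_enorm x) _ (enorm_gt0 x0)).
apply: filterS => y y0; rewrite wu//; apply: contraTneq y0 => ->.
by rewrite enorm0 ltxx.
Qed.

Let inside_neq0 x : r1 <= enorm x <= r2 -> x != 0.
Proof.
by move=> /andP[xr _]; apply: contraTneq xr => ->; rewrite enorm0 -ltNge.
Qed.

Lemma continuous_annular w : annular w -> continuous w.
Proof.
move=> aw x; have [xr|xr] := boolP (r1 <= enorm x <= r2).
  have x0 := inside_neq0 xr; have [w0 [u ru wu]] := aw.
  rewrite /continuous_at wu//; apply: cvg_trans (near_eq_cvg (near_inside wu x0)) _.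
  exact: (differentiable_continuous (differentiable_radial ru x0)).
rewrite /continuous_at (aw.1 _ xr).
by apply: cvg_trans (near_eq_cvg (near_outside aw xr)) _; exact: cvg_cst.
Qed.

Lemma annular_partial w i : annular w -> annular (partial i w) /\
  forall x, derivable w x (delta_mx ord0 i).
Proof.
move=> aw; have [w0 [u ru wu]] := aw; have [u' ru' Du] := radial_partial i ru.
have D0 x : ~~ (r1 <= enorm x <= r2) -> is_derive x (delta_mx ord0 i : V) w 0.
  by move=> xr; apply: (near_eq_is_derive (near_outside aw xr)); exact: is_derive_cst.
have D1 x : x != 0 -> is_derive x (delta_mx ord0 i : V) w (u' x).
  by move=> x0; apply: (near_eq_is_derive (near_inside wu x0)); exact: Du.
split; first split.
- by move=> x /D0[].
- by exists u' => // x /D1[].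
move=> x; have [xr|/D0[]//] := boolP (r1 <= enorm x <= r2).
by have [] := D1 x (inside_neq0 xr).
Qed.

Lemma annular_partials w s : annular w -> annular (partials s w).
Proof. by move=> aw; elim: s => //= i s IH; have [] := annular_partial i IH. Qed.

Lemma smooth_annular w : annular w -> smooth w.
Proof.
move=> aw s; have as_ := annular_partials s aw; split; first exact: continuous_annular.
by move=> i x; have [_] := annular_partial i as_; apply.
Qed.

(** Monomials are themselves radial functions, so their products with derivatives are bounded on the
    annulus, and they vanish off it. *)
Lemma rapidly_decreasing_annular w : annular w -> rapidly_decreasing w.
Proof.
move=> aw alpha s; have [w0 [u ru wu]] := annular_partials s aw.
have rp : radial (fun x : V => \prod_(i < n.+1) x ord0 i ^+ alpha i).
  elim: (index_enum _) => [|i t IH].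
    by under eq_fun do rewrite big_nil; exact: radial_cst.
  under eq_fun do rewrite big_cons; apply: radialM => //.
  elim: (alpha i) => [|m IHm]; first by under eq_fun do rewrite expr0; exact: radial_cst.
  by under eq_fun do rewrite exprS; apply: radialM => //; exact: radial_coord.
have [C HC] := radial_bounded r2 (radialM rp ru) r10.
exists `|C| => x; have [xr|xr] := boolP (r1 <= enorm x <= r2); last by rewrite w0// mulr0 normr0.
by rewrite wu ?inside_neq0// (le_trans (HC x xr))// ler_norm.
Qed.

Lemma schwartz_annular w : annular w -> schwartz (fun x : V => (w x)%:C).
Proof.
move=> aw; have a0 : annular (fun=> 0) by split=> //; exists (fun=> 0) => //; exact: radial_cst.
by split => /=; [exact: smooth_annular|exact: smooth_annular|
  exact: rapidly_decreasing_annular|exact: rapidly_decreasing_annular].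
Qed.

End radial_functions.

(** Terms with m < -N vanish, so the sum over the integers is a series in i = m + N, whose partial
    sums telescope. *)
Lemma esum_telescope {R : realType} (B : int -> R) (N M : nat) :
  (forall m, B (m - 1) <= B m) ->
  (forall m, m < - N%:Z -> B m = 0) -> (forall m, M%:Z <= m -> B m = 1) ->
  (\esum_(m in [set: int]) (B m - B (m - 1))%:E = 1)%E.
Proof.
move=> Bnd B0 B1.
pose f (i : nat) : int := i%:Z - N%:Z.
have n0 m : (0 <= (B m - B (m - 1))%:E)%E by rewrite lee_fin subr_ge0.
rewrite (esumID (range f))// setTI [X in (_ + X)%E]esum1 ?adde0; last first.
  move=> m [_ /= mf].
  have mN : m < - N%:Z.
    rewrite ltNge; apply/negP => h; apply: mf; exists (absz (m + N%:Z)) => //.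
    by rewrite /f gez0_abs ?addrK//; lia.
  by rewrite !B0 ?subrr//; lia.
rewrite esum_image; last by move=> i j _ _ /addIr[].
rewrite -nneseries_esumT//.
apply: cvg_lim => //; apply: cvg_near_cst.
(* The K-th partial sum is B(K - N - 1) - B(-N - 1); the first value is 1 as soon as K - N - 1 >=
   M. *)
exists (M + N).+1 => // K /= KMN; rewrite sumEFin.
pose c (i : nat) := B (i%:Z - N%:Z - 1).
have cE i : B (f i) - B (f i - 1) = c i.+1 - c i.
  by rewrite /c /f; congr (B _ - B _); lia.
under eq_bigr do rewrite cE.
rewrite telescope_sumr// /c B1; last by lia.
by rewrite B0 ?subr0//; lia.
Qed.

(** * The bump function *)

Section bump.
Context {R : realType}.
Variables (theta : R -> R) (a delta : R).
Hypothesis theta_cutoff : cutoff_function theta.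
Hypotheses (a_gt0 : 0 < a) (a_lt : a < 1 / 4) (delta_gt0 : 0 < delta)
  (delta_lt : delta < 1 / 2 * Num.min (1 - 4 * a) a).

Let delta_lt1 : delta < 1 / 2 * (1 - 4 * a).
Proof.
apply: lt_le_trans delta_lt _; rewrite ler_pM2l; last lra.
by rewrite ge_min lexx.
Qed.

Let delta_lt2 : delta < a / 2.
Proof.
apply: lt_le_trans delta_lt _; rewrite mulrC mul1r ler_pM2r; last lra.
by rewrite ge_min lexx orbT.
Qed.

Let pos : [/\ 0 < a, 0 < delta, delta < a / 2 & delta < 1 / 2 * (1 - 4 * a)].
Proof. by split. Qed.

Lemma theta_sqr_le1 t : theta t ^+ 2 <= 1.
Proof. by have [_ _ _ /(_ t)] := theta_cutoff; have := sqr_ge0 (theta (- t)); lra. Qed.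

Lemma theta_bounded t : `|theta t| <= 1.
Proof.
by rewrite -(ler_pXn2r (n := 2)) ?nnegrE// expr1n real_normK ?num_real ?theta_sqr_le1.
Qed.

Local Notation bump := (bump_fun theta a (2 * a) (delta / 2) delta).

(** As the transition zones are disjoint, at least one factor is 1 at each r; the product form
    removes the case distinction. *)
Lemma bumpE r : bump r = theta ((r - a) / (delta / 2)) * theta ((2 * a - r) / delta).
Proof.
have [_ _ t1 _] := theta_cutoff; have [a0 dl0 d2 d1] := pos.
rewrite /bump_fun; case: ltP => h1.
  rewrite (t1 ((2 * a - r) / delta)) ?mulr1// ler_pdivlMr// mul1r; lra.
rewrite (t1 ((r - a) / (delta / 2))) ?mul1r; last by rewrite ler_pdivlMr ?divr_gt0// mul1r; lra.
by case: ifP => // h2; rewrite t1// ler_pdivlMr// mul1r; lra.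
Qed.

Lemma bump_eq0 r : ~~ (a - delta / 2 <= r <= 2 * a + delta) -> bump r = 0.
Proof.
have [_ t0 _ _] := theta_cutoff; have [a0 dl0 d2 d1] := pos.
rewrite negb_and -!ltNge bumpE => /orP[h|h].
  by rewrite t0 ?mul0r// ler_pdivrMr ?divr_gt0//; lra.
by rewrite (t0 ((2 * a - r) / delta)) ?mulr0// ler_pdivrMr//; lra.
Qed.

Definition lowpass r := theta ((2 * a - r) / delta) ^+ 2.

(** At 2r the argument of theta is (2a - 2r) / delta = -(r - a) / (delta/2), the opposite of the
    argument of the rising factor at r; the identity theta(t)^2 + theta(-t)^2 = 1 then turns that
    factor into 1 - lowpass(2r). *)
Lemma bump_sqr r : bump r ^+ 2 = lowpass r - lowpass (2 * r).
Proof.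
have [_ _ t1 t2] := theta_cutoff; have [a0 dl0 d2 d1] := pos.
have -> : lowpass (2 * r) = 1 - theta ((r - a) / (delta / 2)) ^+ 2.
  have := t2 ((r - a) / (delta / 2)).
  suff -> : lowpass (2 * r) = theta (- ((r - a) / (delta / 2))) ^+ 2 by lra.
  by congr (theta _ ^+ 2); field; rewrite gt_eqF.
rewrite bumpE exprMn /lowpass; have [h|h] := leP (a + delta / 2) r.
  by rewrite (t1 ((r - a) / (delta / 2))) ?expr1n ?mul1r ?subrr ?subr0// ler_pdivlMr ?divr_gt0//; lra.
rewrite (t1 ((2 * a - r) / delta)) ?expr1n ?mulr1; first by ring.
by rewrite ler_pdivlMr//; lra.
Qed.

Lemma lowpass1 r : r <= 2 * a - delta -> lowpass r = 1.
Proof.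
by have [_ _ t1 _] := theta_cutoff; have [a0 dl0 d2 d1] := pos; move=> h;
  rewrite /lowpass t1 ?expr1n// ler_pdivlMr//; lra.
Qed.

Lemma lowpass0 r : 2 * a + delta <= r -> lowpass r = 0.
Proof.
by have [_ t0 _ _] := theta_cutoff; have [a0 dl0 d2 d1] := pos; move=> h;
  rewrite /lowpass t0 ?expr0n// ler_pdivrMr//; lra.
Qed.

Lemma esum_bump_dyadic r : 0 < r ->
  (\esum_(m in [set: int]) (bump (2 ^ (- m) * r) ^+ 2)%:E = 1)%E.
Proof.
move=> r0; pose B (m : int) := lowpass (2 ^ (- m) * r).
have BE m : bump (2 ^ (- m) * r) ^+ 2 = B m - B (m - 1).
  rewrite bump_sqr /B mulrA; congr (_ - lowpass (_ * _)).
  by rewrite opprB expfzDr// expr1z.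
under eq_esum do rewrite BE.
have pow_ge (K : R) : exists N : nat, K <= 2 ^+ N.
  exists (Num.truncn K).+1; apply: le_trans (ltW (truncnS_gt K)) _.
  by rewrite -natrX ler_nat ltnW// ltn_expl.
(* N is chosen so that 2^N r is beyond the support of [lowpass], and M below so that r / 2^M is
   where it equals 1. *)
have [N hN] := pow_ge ((2 * a + delta) / r).
have [M hM] := pow_ge (r / (2 * a - delta)).
have [a0 dl0 d2 d1] := pos.
apply: (@esum_telescope _ B N M).
- by move=> m; rewrite -subr_ge0 -BE sqr_ge0.
- move=> m mN; apply: lowpass0; rewrite -ler_pdivrMr//; apply: le_trans hN _.
  by rewrite exprnP; apply: ler_weXz2l; rewrite ?ler1n//; lia.
- move=> m mM; apply: lowpass1; rewrite -invr_expz mulrC ler_pdivrMr ?exprz_gt0// mulrC.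
  rewrite ler_pdivrMr in hM; last by lra.
  apply: le_trans hM _; rewrite ler_pM2r; last by lra.
  by rewrite exprnP; apply: ler_weXz2l; rewrite ?ler1n//; lia.
Qed.

Let theta_smooth : forall (k : nat) (y : R), derivable (derive1n k theta) y 1.
Proof. by have [] := theta_cutoff. Qed.

Lemma annular_psi_hat n :
  annular theta (a - delta / 2) (2 * a + delta) (psi_hat theta a delta : 'rV[R]_n.+1 -> R).
Proof.
split; first by move=> x; exact: bump_eq0.
exists (fun x : 'rV[R]_n.+1 => derive1n 0 theta ((delta / 2)^-1 * enorm x + - (a / (delta / 2))) *
   derive1n 0 theta (- delta^-1 * enorm x + 2 * a / delta)).
  by apply: radialM; exact: radial_cut.
move=> x _; rewrite /psi_hat bumpE !derive1n0; congr (theta _ * theta _); field; rewrite gt_eqF//.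
Qed.

Lemma psi_hat_cube n (x : 'rV[R]_n.+1) : ~ cube _ x -> psi_hat theta a delta x = 0.
Proof.
have [a0 dl0 d2 d1] := pos; move=> Qx; apply: bump_eq0; apply/negP => /andP[_ xr]; apply: Qx => i.
have := coord_le_enorm x i; have := ler_norm (x ord0 i); have := ler_norm (- x ord0 i).
by rewrite normrN; lra.
Qed.

Lemma measurable_enorm n : measurable_fun [set: 'rV[R]_n.+1] enorm.
Proof.
apply: (measurableT_comp (f := @Num.sqrt R)).
  by apply: continuous_measurable_fun; exact: sqrt_continuous.
by apply: measurable_edot2; exact: measurable_id.
Qed.

Lemma bounded_measurable_psi_hat n :
  bounded_measurable (psi_hat theta a delta : 'rV[R]_n.+1 -> R).
Proof.
have mt : measurable_fun setT theta.
  apply: continuous_measurable_fun => y.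
  apply: differentiable_continuous; apply/derivable1_diffP.
  exact: (@theta_smooth 0%N y).
have E : psi_hat theta a delta = (fun x : 'rV[R]_n.+1 =>
    theta ((enorm x - a) / (delta / 2)) * theta ((2 * a - enorm x) / delta)).
  by apply/funext => x; rewrite /psi_hat bumpE.
rewrite E; apply: bounded_measurableM; (split; last by exists 1 => x; exact: theta_bounded).
- apply: (measurableT_comp mt); apply: measurable_funM => //; apply: measurable_funB => //.
  exact: measurable_enorm.
- apply: (measurableT_comp mt); apply: measurable_funM => //; apply: measurable_funB => //.
  exact: measurable_enorm.
Qed.

End bump.

(** * Schwartz class and frame property of the wavelet *)

Theorem corollary19 (R : realType) (theta : R -> R)
    (theta_cutoff : cutoff_function theta)
    (d : nat) (d_gt2 : (2 < d)%N)
    (a : R) (a_gt0 : 0 < a) (a_lt : a < 1 / 4)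
    (delta : R) (delta_gt0 : 0 < delta)
    (delta_lt : delta < 1 / 2 * Num.min (1 - 4 * a) a) :
  schwartz (fun x : 'rV[R]_d => (psi_hat theta a delta x)%:C) /\
  parseval_frame L2 L2_dot
    (wavelet_system (psi theta a delta : 'rV[R]_d -> R[i])).
Proof.
case: d d_gt2 => // n _.
have da : delta < a / 2.
  apply: lt_le_trans delta_lt _; rewrite mulrC mul1r ler_pM2r; last lra.
  by rewrite ge_min lexx orbT.
have bg : bounded_measurable (psi_hat theta a delta : 'rV[R]_n.+1 -> R).
  exact: bounded_measurable_psi_hat.
have gQ (x : 'rV[R]_n.+1) : ~ cube _ x -> psi_hat theta a delta x = 0.
  exact: psi_hat_cube.
have g1 (x : 'rV[R]_n.+1) : x != 0 ->
    (\esum_(m in [set: int]) (psi_hat theta a delta (2 ^ (- m) *: x) ^+ 2)%:E = 1)%E.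
  move=> x0; transitivity (\esum_(m in [set: int])
      (bump_fun theta a (2 * a) (delta / 2) delta (2 ^ (- m) * enorm x) ^+ 2)%:E)%E; last first.
    by apply: esum_bump_dyadic => //; exact: enorm_gt0.
  by apply: eq_esum => m _; rewrite /psi_hat enormZ// exprz_ge0.
split.
  have an : annular theta (a - delta / 2) (2 * a + delta)
    (psi_hat theta a delta : 'rV[R]_n.+1 -> R) by exact: annular_psi_hat.
  apply: (schwartz_annular _ _ an); last by lra.
  by have [] := theta_cutoff.
(* The profile vanishes off the unit cube, so Plancherel applies with L = 1. *)
have psi_sq : sq_integrable (psi theta a delta : 'rV[R]_n.+1 -> R[i]).
  apply: (sq_integrable_inverse_fourier ltr01 (bounded_cmeas_real bg)) => x.
  by rewrite invr1 scale1r => /gQ ->.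
have e_sq (j : int * 'rV[int]_n.+1) :
    sq_integrable (wavelet_system (psi theta a delta : 'rV[R]_n.+1 -> R[i]) j).
  apply: sq_integrableZ; apply: sq_integrable_affine => //.
  by rewrite exprz_gt0.
split=> [j|f /L2P sf]; first exact/L2P.
(* The integral of e_j times the conjugate of f is the conjugate of the inner product of f with e_j,
   so the bilinear Parseval identity is applied to the conjugate of f. *)
have sc := sq_integrable_conj sf.
have := parseval_sq_integrable e_sq (frame_identity_supported bg gQ g1) sc.
rewrite (_ : sqnorm _ = complex.Re (L2_dot f f)); last first.
  by apply: eq_Rintegral => x _; rewrite mulc_conj nsq_conj.
move=> <-; apply: eq_esum => j _; rewrite sqr_cabs; congr _%:E.
rewrite -[RHS]nsq_conj -cint_conj//; last exact: cintegrable_mul.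
congr nsq; apply: eq_cint => x _.
by rewrite [RHS]rmorphM/= conjcK mulrC.
Qed.
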